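(* Let $q$ be a prime power, let $V=\mathbb{F}^d$ be a $d$-dimensional vector space over a finite field $\mathbb{F}$ equipped with a non-degenerate form, and let $e,e'$ be positive integers with $e+e'\le d$. Suppose one of the following holds, with the constant $c$ as indicated: (1) (unitary) the form is hermitian, $|\mathbb{F}|=q^2$, $q\ge 2$, $e,e'\ge 1$, and $c=1.72$; (2) (symplectic) the form is alternating, $|\mathbb{F}|=q$, $q\ge2$, $e,e'\ge2$ are both even, and $c=1.75$; (3) (orthogonal) the form is quadratic, $|\mathbb{F}|=q\ge 4$, $e,e'\ge 2$ are both even, and $c=3.125$; (4) (orthogonal) the form is quadratic, $|\mathbb{F}|=q=3$, $e,e'\ge 2$ are both even, and $c=2.85$. In cases (1) and (2) let $\mathcal{U}$ and $\mathcal{U}'$ be the sets of all non-degenerate subspaces of $V$ of dimension $e$ and $e'$ respectively. In cases (3) and (4) fix arbitrary $\sigma,\sigma'\in\{-,+\}$ and let $\mathcal{U}$ be the set of non-degenerate $e$-dimensional subspaces of $V$ of type $\sigma$ and $\mathcal{U}'$ the set of non-degenerate $e'$-dimensional subspaces of $V$ of type $\sigma'$. Then $$\frac{|\{(U,U')\in\mathcal{U}\times\mathcal{U}' : U\cap U'=0 \text{ and } U\oplus U' \text{ is non-degenerate}\}|}{|\mathcal{U}|\cdot|\mathcal{U}'|}\ \ge\ 1-\frac{c}{q}\ >\ 0 .$$ (In the orthogonal case, $U\oplus U'$ is allowed to have either type.)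
   Context: In the orthogonal case, $V$ carries a quadratic form whose polar form is a non-degenerate symmetric bilinear form; thus either $d$ is even, or both $d$ and $q$ are odd. A subspace $U$ of $V$ is non-degenerate if the restriction to $U$ of the hermitian form, alternating form, or (in the orthogonal case) polar form is non-degenerate, equivalently $U\cap U^\perp=0$. In the orthogonal case a non-degenerate subspace of even dimension $2m$ has type $+$ if its maximal totally singular subspaces have dimension $m$, and type $-$ if they have dimension $m-1$. *)

(* Defs.v *)
From HB Require Import structures.
From mathcomp Require Import all_boot all_order all_algebra.

Set Implicit Arguments.
Unset Strict Implicit.
Unset Printing Implicit Defensive.

Import Order.TTheory GRing.Theory Num.Theory.
Import VectorInternalTheory. (* the subType structure of {vspace vT} *)
Local Open Scope ring_scope.

HB.instance Definition _ (F : finFieldType) (vT : vectType F) :=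
  [Countable of {vspace vT} by <:].
HB.instance Definition _ (F : finFieldType) (vT : vectType F) :=
  [Finite of {vspace vT} by <:].

Definition polar (R : pzRingType) (U : lmodType R) (Q : U -> R) (u v : U) : R :=
  Q (u + v) - Q u - Q v.

HB.mixin Record isQuadratic (R : fieldType) (U : lmodType R) (Q : U -> R) := {
  quadraticZ : forall a u, Q (a *: u) = a ^+ 2 * Q u;
  polar_bilinear : bilinear_for *%R *%R (polar Q)
}.

#[short(type="quadraticForm")]
HB.structure Definition Quadratic (R : fieldType) (U : lmodType R) :=
  {Q of isQuadratic R U Q}.

Section Polar.
Variables (R : fieldType) (U : lmodType R) (Q : quadraticForm U).

Fact polar_bilinear_idfun :
  bilinear_for (GRing.Scale.Law.clone _ _ *%R _)
               (GRing.Scale.Law.clone _ _ (idfun \; *%R) _) (polar Q).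
Proof. exact: polar_bilinear. Qed.

Fact polar_sym u v : polar Q u v = (-1) ^+ false * idfun (polar Q v u).
Proof. by rewrite expr0 mul1r /= /polar [v + u]addrC addrAC. Qed.

HB.instance Definition _ :=
  bilinear_isBilinear.Build R U U R _ _ (polar Q) polar_bilinear_idfun.
HB.instance Definition _ :=
  isHermitianSesquilinear.Build R U false idfun (polar Q) polar_sym.

Definition polar_form : {symmetric U} := polar Q.

End Polar.

Variant subspace_type := PlusType | MinusType.

Section Subspaces.
Variables (F : finFieldType) (d : nat).
Local Notation V := 'rV[F]_d.

Section Nondegenerate.
Variables (eps : bool) (theta : {rmorphism F -> F}).
Variable f : {hermitian V for eps & theta}.

(* [orthov f U] is the perp of U, so [U :&: orthov f U] is the radical of the
   restriction of f to U. *)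
Definition nondegenerate_on (U : {vspace V}) : bool :=
  (U :&: orthov f U)%VS == 0%VS.

Definition nondeg_subspaces (e : nat) : {set {vspace V}} :=
  [set U | nondegenerate_on U & \dim U == e].

Definition nondeg_sum_pairs (A A' : {set {vspace V}}) :
    {set {vspace V} * {vspace V}} :=
  [set W in setX A A' | ((W.1 :&: W.2)%VS == 0%VS)
                        && nondegenerate_on (W.1 + W.2)%VS].

Definition nondeg_sum_proportion (A A' : {set {vspace V}}) : rat :=
  #|nondeg_sum_pairs A A'|%:R / (#|A| * #|A'|)%:R.

End Nondegenerate.

Section Orthogonal.
Variable Q : quadraticForm V.

Definition totally_singular (W : {vspace V}) : bool :=
  [forall w : V, (w \in W) ==> (Q w == 0)].

Definition max_totally_singular_in (U W : {vspace V}) : bool :=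
  [&& (W <= U)%VS, totally_singular W &
      [forall W' : {vspace V},
        [&& (W <= W')%VS, (W' <= U)%VS & totally_singular W'] ==> (W' == W)]].

(* For dim U = 2m, the successor on the left in the minus case states
   dim W = m - 1 without truncated subtraction. *)
Definition has_type (s : subspace_type) (U : {vspace V}) : bool :=
  ~~ odd (\dim U) &&
  [forall W : {vspace V}, max_totally_singular_in U W ==>
     (match s with
      | PlusType => \dim W
      | MinusType => (\dim W).+1
      end == (\dim U)./2)].

Definition nondeg_subspaces_of_type (s : subspace_type) (e : nat) :
    {set {vspace V}} :=
  [set U in nondeg_subspaces (polar_form Q) e | has_type s U].

End Orthogonal.
End Subspaces.

(* Main.v *)
(* Fix [U]; it suffices to bound the proportion of the [U'] that are bad for [U].

   Unitary and symplectic case: the good [U'] are exactly the nondegenerate graphs of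
   linear maps from a nondegenerate subspace [W] of [U^perp] of dimension [e'] to [U].
   The degenerate graphs are counted through the vectors in their radical, and the
   number of [W] is compared with the number of nondegenerate [e']-dimensional
   subspaces of [V].

   Orthogonal case: if [U'] is bad, then [U] and [U'] share a nonzero vector, or there
   are a nonzero [u] in [U] and a nonzero singular [y] orthogonal to [U] and to [U'] with
   [u + y] in [U'] (in characteristic 2 such a singular [y] exists because the radical
   of [U + U'] is even-dimensional and two of its vectors have the same value).  By
   Witt's theorem the number of [U'] containing [u], or containing [u + y] and
   orthogonal to [y], depends only on the value of [u], so the expected number of such
   configurations is a sum of products of numbers of vectors of given value. *)
Require Import Defs.
From HB Require Import structures.
From mathcomp Require Import all_boot all_order all_algebra all_field.
From mathcomp Require Import zify ring lra.

Set Implicit Arguments.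
Unset Strict Implicit.
Unset Printing Implicit Defensive.

Import Order.TTheory GRing.Theory Num.Theory.
Local Open Scope ring_scope.

(** * Nondegenerate subspaces *)

(** Graphs over [W] need not have the type of [W], so the graph count does not adapt to families of
    prescribed type; this is why quadratic forms get a first moment. There each bad [U'] carries at
    least [q - 1] configurations, since configurations can be rescaled, while their expected number
    is at most [c * (q - 1) / q]; the quotient is the loss [c / q]. The hermitian and the
    even-dimensional quadratic counts deviate from uniform distribution through a single small
    number, [(-1/q)^m] in dimension [m] or plus or minus [q^-m] in dimension [2m]. If [a] and [b]
    are these numbers for [U] and its partner, both expectations lead to
    [(1 - a)(1 - b)(1 + a + b + q a b)], which is largest at [a = b = -1/q]. In odd dimension the
    deviations have an uncontrolled sign, but constant square and zero sum. For [q = 3] and two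
    planes, bounding the factors of the quadratic estimate one by one is too lossy, and they are
    evaluated exactly. The transitivity argument uses a scalar that avoids two values, hence a field
    with more than two elements. *)

Section NondegenerateSubspaces.
Variables (F : finFieldType) (d : nat).
Local Notation V := 'rV[F]_d.
Variables (eps : bool) (theta : {rmorphism F -> F}).
Variable f : {hermitian V for eps & theta}.
Implicit Types (U W X Y L : {vspace V}) (u v w x y : V).
Local Notation "U ^_" := (orthov f U) (at level 2, format "U ^_").
Local Notation nd := (nondegenerate_on f).

Lemma card_vspace_set X : #|[set x | x \in X]| = (#|F| ^ \dim X)%N.
Proof. by rewrite cardsE -card_vspace. Qed.

(* The generic [linearDl] etc. leave [f] under another coercion path, which
   blocks later rewriting. *)
Lemma fDl u v w : f (u + v) w = f u w + f v w. Proof. exact: linearDl. Qed.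
Lemma fDr u v w : f w (u + v) = f w u + f w v. Proof. exact: linearDr. Qed.
Lemma fBl u v w : f (u - v) w = f u w - f v w. Proof. exact: linearBl. Qed.
Lemma fBr u v w : f w (u - v) = f w u - f w v. Proof. exact: linearBr. Qed.
Lemma fNr u w : f w (- u) = - f w u. Proof. exact: linearNr. Qed.
Lemma fZl a u w : f (a *: u) w = a * f u w. Proof. exact: linearZl_LR. Qed.
Lemma fZr a u w : f w (a *: u) = theta a * f w u. Proof. exact: linearZr_LR. Qed.
Lemma f0l w : f 0 w = 0. Proof. exact: linear0l. Qed.
Lemma f0r w : f w 0 = 0. Proof. exact: linear0r. Qed.
Lemma fC u v : f u v = (-1) ^+ eps * theta (f v u). Proof. exact: hermC. Qed.

Lemma form_eq0_sym u v : f u v = 0 -> f v u = 0.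
Proof. by move/eqP; rewrite herm_eq0C => /eqP. Qed.

(** Each vector of a spanning list of [X] imposes one linear condition on [U]. No nondegeneracy
    enters, so this supplies the hard half of the dimension formula for [L] and its perp. *)
Lemma leq_dim_cap_orthov U X : (\dim U <= \dim (U :&: X^_) + \dim X)%N.
Proof.
suff H (s : seq V) : (\dim U <= \dim (U :&: <<s>>^_)%VS + size s)%N.
  by have := H (vbasis X); rewrite size_tuple (span_basis (vbasisP X)).
elim: s => [|v s IH] /=; first by rewrite span_nil orthov0 capvf addn0.
have := leq_dim_orthov1 f v (U :&: <<s>>^_).
have -> : (U :&: <<s>>^_ :&: <[v]>^_ = U :&: <<v :: s>>^_)%VS.
  rewrite -capvA; congr (_ :&: _)%VS; apply/eqP; rewrite eqEsubv.
  by rewrite span_cons orthovD capvSl capvSr subv_cap andbC -orthovD addvC subvv.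
rewrite addnS -addSn => dimS; apply: leq_trans IH _; rewrite leq_add2r.
by case: (\dim _) dimS.
Qed.

Lemma nd_eq0 X x : nd X -> x \in X -> {in X, forall y, f x y = 0} -> x = 0.
Proof.
move=> /eqP ndX xX x_perp; apply/eqP; rewrite -memv0 -ndX memv_cap xX.
exact/mem_orthovP.
Qed.

Lemma ndP X : reflect (forall x, x \in X -> {in X, forall y, f x y = 0} -> x = 0)
  (nd X).
Proof.
apply: (iffP idP) => [ndX x|H]; first exact: nd_eq0.
rewrite /nondegenerate_on -subv0; apply/subvP => x.
by rewrite memv_cap memv0 => /andP[xX /mem_orthovP /H ->].
Qed.

Lemma nd0 : nd 0.
Proof. by rewrite /nondegenerate_on cap0v. Qed.

Lemma ndfE : nd fullv = nondegenerate f.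
Proof. by rewrite /nondegenerate_on capfv. Qed.

Lemma dim_cap_orthov L X : nd L -> (L <= X)%VS ->
  (\dim L + \dim (X :&: L^_) = \dim X)%N.
Proof.
move=> ndL LX; apply/eqP; rewrite eqn_leq addnC leq_dim_cap_orthov andbT addnC.
have <- : \dim (L + X :&: L^_) = (\dim L + \dim (X :&: L^_))%N.
  apply: dimv_disjoint_sum; apply/eqP; rewrite capvA (capv_idPl LX); exact: ndL.
by apply: dimvS; rewrite subv_add LX capvSl.
Qed.

Lemma addv_cap_orthov L X : nd L -> (L <= X)%VS -> (L + (X :&: L^_))%VS = X.
Proof.
move=> ndL LX; apply/eqP; rewrite eqEdim subv_add LX capvSl /=.
rewrite dimv_disjoint_sum ?dim_cap_orthov //.
by apply/eqP; rewrite capvA (capv_idPl LX); exact: ndL.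
Qed.

Lemma orthov_decomp L x : nd L ->
  exists2 l, l \in L & x - l \in L^_.
Proof.
move=> ndL; have : x \in (L + (fullv :&: L^_))%VS.
  by rewrite addv_cap_orthov ?subvf ?memvf.
case/memv_addP => l lL [y]; rewrite memv_cap => /andP[_ yL] ->.
by exists l; rewrite // [l + y]addrC addrK.
Qed.

Lemma orthov_cap_eq0 L Y : nd L -> (Y <= L^_)%VS -> (L :&: Y = 0)%VS.
Proof.
move=> /eqP ndL YL; apply/eqP; rewrite -subv0 -ndL; exact: capvS.
Qed.

Lemma dim_nd_addv L Y : nd L -> (Y <= L^_)%VS -> \dim (L + Y) = (\dim L + \dim Y)%N.
Proof. by move=> ndL YL; rewrite dimv_disjoint_sum ?orthov_cap_eq0. Qed.

Lemma cap_orthov_addv L Y : nd L -> (Y <= L^_)%VS -> ((L + Y) :&: L^_ = Y)%VS.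
Proof.
move=> ndL YL; apply/esym/eqP; rewrite eqEdim subv_cap YL addvSr /=.
by have := dim_cap_orthov ndL (addvSl L Y); rewrite dim_nd_addv //; lia.
Qed.

Lemma nd_addv L Y : nd L -> (Y <= L^_)%VS -> nd (L + Y) = nd Y.
Proof.
move=> ndL YL; apply/ndP/ndP => H x.
  move=> xY xperp; apply: (H x) => [|z /memv_addP[l lL [y yY ->]]].
    by rewrite (subvP (addvSr L Y)).
  rewrite fDr (xperp y) // addr0.
  by move/(subvP YL): xY => /mem_orthovP ->.
case/memv_addP => l lL [y yY ->] xperp.
have l0 : l = 0.
  apply: (nd_eq0 ndL lL) => l' l'L.
  have := xperp l'; rewrite (subvP (addvSl L Y)) // => /(_ isT).
  rewrite fDl.
  by have /mem_orthovP -> // : y \in L^_; [exact: (subvP YL)|rewrite addr0].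
rewrite l0 add0r; apply: H => // y' y'Y.
by have := xperp y'; rewrite (subvP (addvSr L Y)) // l0 add0r; exact.
Qed.

Lemma nd_cap_orthov L X : nd L -> (L <= X)%VS -> nd X = nd (X :&: L^_).
Proof. by move=> ndL LX; rewrite -{1}(addv_cap_orthov ndL LX) nd_addv ?capvSr. Qed.

Definition nd_in X k : {set {vspace V}} :=
  [set U | [&& nd U, \dim U == k & (U <= X)%VS]].

Lemma nd_in_fullv k : nd_in fullv k = nondeg_subspaces f k.
Proof. by apply/setP => U; rewrite !inE subvf andbT. Qed.

(** The maps [Y] to [L + Y] and [U] to [U :&: L^_] are mutually inverse; they turn subspaces above
    [L] into subspaces of the perp and drive the recursive counts. *)
Lemma card_nd_in_containing L X k : nd L -> (L <= X)%VS ->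
  #|[set U in nd_in X (\dim L + k) | (L <= U)%VS]| = #|nd_in (X :&: L^_) k|.
Proof.
move=> ndL LX.
rewrite -(@card_in_imset _ _ (fun Y => L + Y)%VS (mem (nd_in (X :&: L^_) k))).
  apply: eq_card => U; rewrite !inE.
  apply/idP/imsetP => [/andP[/and3P[ndU /eqP dimU UX] LU]|[Y]].
    exists (U :&: L^_)%VS; last by rewrite addv_cap_orthov.
    rewrite inE -(nd_cap_orthov ndL LU) ndU /= capvS // andbT.
    by have := dim_cap_orthov ndL LU; rewrite dimU => /addnI ->.
  rewrite inE => /and3P[ndY /eqP dimY]; rewrite subv_cap => /andP[YX YL] ->.
  by rewrite nd_addv // ndY dim_nd_addv // dimY eqxx subv_add LX YX addvSl.
move=> Y Y'; rewrite !inE !subv_cap => /and3P[_ _ /andP[_ YL]] /and3P[_ _ /andP[_ YL']].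
by move=> /(congr1 (fun U => U :&: L^_)%VS); rewrite !cap_orthov_addv.
Qed.

End NondegenerateSubspaces.

(** * Subspaces as graphs over an orthogonal sum *)

Section Graphs.
Variables (F : finFieldType) (d : nat).
Local Notation V := 'rV[F]_d.
Variables (eps : bool) (theta : {rmorphism F -> F}).
Variable f : {hermitian V for eps & theta}.
Implicit Types (U W X Y L : {vspace V}) (u v w : V).
Local Notation "U ^_" := (orthov f U) (at level 2, format "U ^_").
Local Notation nd := (nondegenerate_on f).

(** Translation by a multiple of a vector [x0] with [f x0 y != 0] carries every level set of [f _ y]
    onto the zero level. The factor [#|F|] is kept on the left to avoid a predecessor in the
    exponent. *)
Lemma card_level_form X (y : V) c : y \notin X^_ ->
  (#|[set x in X | f x y == c]| * #|F| = #|F| ^ \dim X)%N.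
Proof.
case/mem_orthovPn => x0 x0X; rewrite herm_eq0C => fx0.
have lev c' : #|[set x in X | f x y == c']| = #|[set x in X | f x y == 0]|.
  pose x1 := (c' / f x0 y) *: x0.
  have fx1 : f x1 y = c' by rewrite fZl mulfVK.
  have x1X : x1 \in X by rewrite memvZ.
  rewrite -(card_imset [set x in X | f x y == c'] (addIr (- x1))).
  apply: eq_card => x; rewrite !inE; apply/imsetP/andP => [[z]|[xX /eqP fx]].
    by rewrite inE => /andP[zX /eqP fz] ->; rewrite memvB // fBl fz fx1 subrr.
  by exists (x + x1); rewrite ?addrK // inE memvD //= fDl fx fx1 add0r.
rewrite -card_vspace_set lev mulnC -sum_nat_const.
rewrite (eq_bigr (fun c' => \sum_(x in X | f x y == c') 1)%N); last first.
  by move=> c' _; rewrite -(lev c') -sum1_card; apply: eq_bigl => x; rewrite inE.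
rewrite -(partition_big (fun x => f x y) predT) //= -sum1_card.
by apply: eq_bigl => x; rewrite inE.
Qed.

(** Coordinates with respect to a basis of [X], so that linear maps between subspaces become
    matrices and can be counted with [card_mx]. *)
Definition frame_fun X (x : 'rV[F]_(\dim X)) : V := \sum_i x 0 i *: (vbasis X)`_i.

Fact frame_fun_is_linear X : linear (@frame_fun X).
Proof.
move=> a u v; rewrite /frame_fun scaler_sumr -big_split; apply: eq_bigr => i _ /=.
by rewrite !mxE scalerDl scalerA.
Qed.

HB.instance Definition _ X :=
  GRing.isLinear.Build F _ _ _ (@frame_fun X) (@frame_fun_is_linear X).

Definition frame X : 'Hom('rV[F]_(\dim X), V) := linfun (@frame_fun X).

Lemma frameE X (x : 'rV[F]_(\dim X)) : frame X x = \sum_i x 0 i *: (vbasis X)`_i.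
Proof. by rewrite lfunE. Qed.

Lemma frame_inj X : injective (frame X).
Proof.
move=> x y; rewrite !frameE => exy; apply/rowP => i.
have freeX := basis_free (vbasisP X).
by rewrite -(coord_sum_free (fun j => x 0 j) i freeX) exy coord_sum_free.
Qed.

Lemma mem_frame X x : frame X x \in X.
Proof.
rewrite frameE; apply: rpred_sum => i _; rewrite memvZ //.
by rewrite vbasis_mem // memt_nth.
Qed.

Lemma frame_surj X v : v \in X -> exists x, v = frame X x.
Proof.
move=> vX; exists (\row_i coord (vbasis X) i v); rewrite frameE {1}(coord_vbasis vX).
by apply: eq_bigr => i _; rewrite mxE.
Qed.

Definition norm_set X c := [set u in X | (u != 0) && (f u u == c)].

Section OneSubspace.
Variable U : {vspace V}.
Hypothesis ndU : nd U.

Definition graph W (A : 'M[F]_(\dim W, \dim U)) : 'Hom('rV[F]_(\dim W), V) :=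
  (frame W + (frame U \o linfun (mulmxr A)))%VF.

Lemma graphE W (A : 'M[F]_(\dim W, \dim U)) x :
  graph A x = frame W x + frame U (x *m A).
Proof. by rewrite /graph add_lfunE comp_lfunE [X in frame U X]lfunE. Qed.

Section OneGraph.
Variable W : {vspace V}.
Hypotheses (ndW : nd W) (WU : (W <= U^_)%VS).
Variable A : 'M[F]_(\dim W, \dim U).

Lemma orthov_frame x z : f (frame W x) (frame U z) = 0.
Proof. by move/subvP: WU => /(_ _ (mem_frame x)) /mem_orthovP -> //; apply: mem_frame. Qed.

Lemma form_graph x y :
  f (graph A x) (graph A y) =
  f (frame W x) (frame W y) + f (frame U (x *m A)) (frame U (y *m A)).
Proof.
by rewrite !graphE fDl !fDr orthov_frame (form_eq0_sym (orthov_frame _ _)) addr0 add0r.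
Qed.

Lemma graph_eq x y u u' : u \in U -> u' \in U ->
  frame W x + u = frame W y + u' -> x = y /\ u = u'.
Proof.
move=> uU u'U eqxy.
have e : frame W y - frame W x = u - u'.
  by apply/eqP; rewrite subr_eq addrAC eq_sym subr_eq [u + _]addrC eqxy.
have z0 : frame W y - frame W x = 0.
  apply/eqP; rewrite -memv0 -(eqP ndU) memv_cap {1}e memvB //=.
  by apply: (subvP WU); rewrite memvB ?mem_frame.
split; first by apply/(@frame_inj W)/esym/eqP; rewrite -subr_eq0 z0.
by apply/eqP; rewrite -subr_eq0 -e z0.
Qed.

Lemma lker_graph : lker (graph A) == 0%VS.
Proof.
by apply/lker0P => x y; rewrite !graphE => /graph_eq[] //; rewrite mem_frame.
Qed.

Lemma dim_graph : \dim (limg (graph A)) = \dim W.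
Proof.
by rewrite limg_dim_eq ?(eqP lker_graph) ?capv0 // dimvf /dim /= mul1n.
Qed.

Lemma addv_graph : (U + limg (graph A) = U + W)%VS.
Proof.
apply/eqP; rewrite eqEsubv !subv_add !addvSl /=; apply/andP; split.
  apply/subvP => _ /memv_imgP[x _ ->]; rewrite graphE addrC.
  by rewrite memv_add ?mem_frame.
apply/subvP => w /frame_surj[x ->].
rewrite -[frame W x](addrK (frame U (x *m A))) -graphE addrC.
by rewrite memv_add ?memvN ?mem_frame ?memv_img ?memvf.
Qed.

Lemma cap_graph : (U :&: limg (graph A) = 0)%VS.
Proof.
apply/eqP; rewrite -dimv_eq0; have := dimv_sum_cap U (limg (graph A)).
by rewrite addv_graph (dim_nd_addv ndU WU) dim_graph; lia.
Qed.

Lemma nd_addv_graph : nd (U + limg (graph A)).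
Proof. by rewrite addv_graph (nd_addv ndU WU). Qed.

Lemma graph_orthov : ((U + limg (graph A)) :&: U^_ = W)%VS.
Proof. by rewrite addv_graph (cap_orthov_addv ndU WU). Qed.

End OneGraph.

Lemma graph_inj W (A B : 'M[F]_(\dim W, \dim U)) : (W <= U^_)%VS ->
  limg (graph A) = limg (graph B) -> A = B.
Proof.
move=> WU eAB; apply/row_matrixP => i; rewrite !rowE.
have : graph A (delta_mx 0 i) \in limg (graph B) by rewrite -eAB memv_img ?memvf.
case/memv_imgP => x _; rewrite !graphE => /(graph_eq WU)[]; rewrite ?mem_frame //.
by move=> -> /frame_inj.
Qed.

(** The nonzero radical vectors of the graph, read in the coordinates of [W]; the coordinates stay
    the same while the graph varies with [A], which allows an exchange of sums. *)
Definition radical_coords W (A : 'M[F]_(\dim W, \dim U)) :=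
  [set x | (x != 0) && [forall y, f (graph A x) (graph A y) == 0]].

(** If [x 0 i0 != 0], the equation [x *m A == r] determines row [i0] from the other rows, so only
    [k.-1] rows are free. *)
Lemma card_matrices_row_constraints k e (S : 'I_k -> {set 'rV[F]_e}) (x : 'rV[F]_k)
    (r : 'rV[F]_e) N : x != 0 -> (forall i, #|S i| <= N)%N ->
  (#|[set A : 'M[F]_(k, e) | (x *m A == r) && [forall i, row i A \in S i]]|
     <= N ^ k.-1)%N.
Proof.
case/rV0Pn => i0 xi0 cardS.
(* The determined row is overwritten by 0, which makes [h] injective on the solutions and its image
   part of a product of the sets [S']. *)
pose S' i := if i == i0 then [set 0] else S i.
pose h (A : 'M[F]_(k, e)) := [ffun i => if i == i0 then 0 else row i A].
rewrite -(@card_in_imset _ _ h) => [|A B].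
  apply: (@leq_trans #|family (fun i => mem (S' i))|).
    apply/subset_leq_card/subsetP => g /imsetP[A]; rewrite inE => /andP[_ /forallP rA] ->.
    apply/familyP => i; rewrite ffunE /S'; case: eqP => _; first exact: set11.
    exact: rA.
  rewrite card_family foldrE big_map big_enum (bigD1 i0) //= /S' eqxx cards1 mul1n.
  rewrite (eq_bigr (fun i => #|S i|)) => [|i /negPf -> //].
  apply: (@leq_trans (\prod_(i < k | i != i0) N)%N); first exact: leq_prod.
  by rewrite prod_nat_const cardC1 card_ord.
rewrite !inE => /andP[/eqP xA _] /andP[/eqP xB _] /ffunP eAB.
have eAB' i : i != i0 -> row i A = row i B.
  by move=> /negPf i_neq; have := eAB i; rewrite !ffunE i_neq.
apply/row_matrixP => i; have [->|/eAB' //] := eqVneq i i0.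
have : x *m A = x *m B by rewrite xA.
rewrite !mulmx_sum_row (bigD1 i0) //= [in RHS](bigD1 i0) //=.
rewrite (eq_bigr (fun j => x 0 j *: row j B)) => [/addIr|j /eAB' -> //].
by move=> /(scalerI xi0).
Qed.

(** Let [w = frame W x] and [r = frame U (x *m A)]. If [x] gives a radical vector of the graph, then
    [f r r = - f w w], and [r] is nonzero because otherwise [w] would lie in the radical of [W]. For
    fixed [r], orthogonality to the graph of the [i]th basis vector confines row [i] to a level set
    of [f _ r], of size [#|F| ^ (\dim U).-1]. *)
Lemma card_matrices_radical W x : nd W -> (W <= U^_)%VS -> x != 0 ->
  (#|[set A : 'M[F]_(\dim W, \dim U) | x \in radical_coords A]|
   <= #|norm_set U (- f (frame W x) (frame W x))|
      * (#|F| ^ (\dim U).-1) ^ (\dim W).-1)%N.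
Proof.
move=> ndW WU x0.
pose R := norm_set U (- f (frame W x) (frame W x)).
pose T r := [set A : 'M[F]_(\dim W, \dim U) | (x \in radical_coords A) && (frame U (x *m A) == r)].
have inT (A : 'M[F]_(\dim W, \dim U)) : x \in radical_coords A -> frame U (x *m A) \in R.
  rewrite inE => /andP[_ /forallP xrad]; rewrite inE mem_frame /=; apply/andP; split.
    apply: contra x0 => /eqP xA0; apply/eqP/(@frame_inj W); rewrite linear0.
    apply: (nd_eq0 ndW (mem_frame _)) => _ /frame_surj[y ->].
    by apply/eqP; move/eqP: (xrad y); rewrite form_graph // xA0 f0l addr0 => ->.
  by have := xrad x; rewrite form_graph // addrC addr_eq0.
rewrite -sum1_card (partition_big (fun A => frame U (x *m A)) (mem R)) /=; last first.
  by move=> A; rewrite inE => /inT.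
rewrite -sum_nat_const; apply: leq_sum => r.
rewrite inE => /and3P[rU r0 /eqP rr].
have [z ez] := frame_surj rU.
pose S i := [set y : 'rV[F]_(\dim U) | f (frame U y) r == - f (frame W (delta_mx 0 i)) (frame W x)].
have cardS i : (#|S i| <= #|F| ^ (\dim U).-1)%N.
  rewrite -(card_imset _ (@frame_inj U)).
  have rU' : r \notin U^_.
    by apply: contra r0 => rU'; rewrite -memv0 -(eqP ndU) memv_cap rU.
  have U_gt0 : (0 < \dim U)%N.
    by rewrite lt0n dimv_eq0; apply: contra r0 => /eqP U0; rewrite -memv0 -U0.
  rewrite -(leq_pmul2r (ltnW (finNzRing_gt1 F))) -expnSr prednK //.
  rewrite -(card_level_form (- f (frame W (delta_mx 0 i)) (frame W x)) rU').
  rewrite leq_mul2r; apply/orP; right; apply/subset_leq_card/subsetP => u.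
  by case/imsetP => y; rewrite !inE => fy ->; rewrite mem_frame.
rewrite sum1_card.
apply: leq_trans (card_matrices_row_constraints z x0 cardS).
apply/subset_leq_card/subsetP => A; rewrite !inE -topredE /= !inE => /andP[/andP[_ /forallP xrad] /eqP fA].
apply/andP; split; first by apply/eqP/(@frame_inj U); rewrite fA.
apply/forallP => i; rewrite inE rowE -fA -addr_eq0 addrC -form_graph //.
by rewrite herm_eq0C.
Qed.

(** Double count of the pairs of a matrix and a nonzero radical vector. The lower bound [m] for
    degenerate graphs stays a parameter: it is [q ^ 2 - 1] for alternating forms, whose radicals
    here have even dimension, and [#|F| - 1] for hermitian ones. *)
Lemma card_degenerate_graphs W m : nd W -> (W <= U^_)%VS ->
  (forall A : 'M[F]_(\dim W, \dim U), ~~ nd (limg (graph A)) -> m <= #|radical_coords A|)%N ->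
  (m * #|[set A : 'M[F]_(\dim W, \dim U) | ~~ nd (limg (graph A))]|
   <= (\sum_(w in W | w != 0%R) #|norm_set U (- f w w)%R|)
      * (#|F| ^ (\dim U).-1) ^ (\dim W).-1)%N.
Proof.
move=> ndW WU radA; rewrite mulnC -sum_nat_const.
apply: (@leq_trans (\sum_(A : 'M[F]_(\dim W, \dim U)) #|radical_coords A|)).
  by rewrite big_mkcond leq_sum // => A _; rewrite inE; case: ifP => // /radA.
have -> : (\sum_(A : 'M[F]_(\dim W, \dim U)) #|radical_coords A| =
  \sum_(x | x != 0%R) #|[set A : 'M[F]_(\dim W, \dim U) | x \in radical_coords A]|)%N.
  rewrite (eq_bigr (fun A => \sum_(x | x != 0%R) (x \in radical_coords A : nat))%N).
    rewrite exchange_big; apply: eq_bigr => x x0 /=.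
    by rewrite -sum1_card [RHS]big_mkcond; apply: eq_bigr => A _; rewrite inE; case: (_ \in _).
  move=> A _; rewrite -sum1_card big_mkcond [RHS]big_mkcond; apply: eq_bigr => x _.
  by rewrite inE; case: (x == 0) => //=; case: ifP.
have -> : (\sum_(w in W | w != 0%R) #|norm_set U (- f w w)%R| =
    \sum_(x | x != 0%R) #|norm_set U (- f (frame W x) (frame W x))%R|)%N.
  rewrite (reindex_onto (frame W) (fun v => (frame W)^-1%VF v)); last first.
    by move=> v /andP[/frame_surj[x ->] _]; rewrite lker0_lfunK //; apply/lker0P/frame_inj.
  apply: eq_bigl => x; rewrite mem_frame lker0_lfunK ?eqxx ?andbT /=; last first.
    exact/lker0P/frame_inj.
  by rewrite -{1}(linear0 (frame W)) (inj_eq (@frame_inj W)).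
rewrite big_distrl; apply: leq_sum => x x0; exact: card_matrices_radical.
Qed.

Definition nondeg_partners k :=
  [set U' in nondeg_subspaces f k | ((U :&: U')%VS == 0%VS) && nd (U + U')].

(** The space [W] is recovered from [U'] as [(U + U') :&: U^_], and the matrix from [W] and [U'], so
    distinct graphs give distinct partners. This inequality is enough for a lower bound. *)
Lemma card_nondeg_partners_graphs k :
  (\sum_(W in nd_in f U^_ k)
     #|[set A : 'M[F]_(\dim W, \dim U) | nd (limg (graph A))]|
   <= #|nondeg_partners k|)%N.
Proof.
rewrite -[X in (_ <= X)%N]sum1_card.
rewrite [X in (_ <= X)%N](partition_big (fun U' => (U + U') :&: U^_)%VS predT) //=.
rewrite [X in (X <= _)%N]big_mkcond /=; apply: leq_sum => W _; case: ifP => // Wk.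
move: Wk; rewrite inE => /and3P[ndW dimW WU].
rewrite sum1_card -(card_imset _ (fun A B => @graph_inj W A B WU)).
apply/subset_leq_card/subsetP => U' /imsetP[A]; rewrite inE => ndA ->.
rewrite -topredE /= graph_orthov // eqxx andbT !inE ndA dim_graph // dimW.
by rewrite cap_graph // eqxx nd_addv_graph.
Qed.

(** Good graphs are all graphs minus the degenerate ones, summed over [W]. The inequality is
    multiplied by [m] and the loss is put on the right, so that it can be stated in [nat]. *)
Lemma leq_card_nondeg_partners k m S :
  (forall W (A : 'M[F]_(\dim W, \dim U)), W \in nd_in f U^_ k ->
     ~~ nd (limg (graph A)) -> m <= #|radical_coords A|)%N ->
  (forall W, W \in nd_in f U^_ k ->
     \sum_(w in W | w != 0%R) #|norm_set U (- f w w)%R| <= S)%N ->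
  (#|nd_in f U^_ k| * (m * #|F| ^ (k * \dim U))
   <= m * #|nondeg_partners k|
      + #|nd_in f U^_ k| * (S * (#|F| ^ (\dim U).-1) ^ k.-1))%N.
Proof.
move=> radA sumS.
apply: leq_trans (leq_add (leq_mul (leqnn m) (card_nondeg_partners_graphs k)) (leqnn _)).
rewrite big_distrr /= -!sum_nat_const -big_split /=; apply: leq_sum => W Wk.
have := sumS _ Wk; have := radA W ^~ Wk.
move: Wk; rewrite inE => /and3P[ndW /eqP dimW WU] radW sumW.
rewrite -dimW -[X in (m * X <= _)%N]card_mx.
rewrite -(cardC [pred A : 'M[F]_(\dim W, \dim U) | nd (limg (graph A))]) mulnDr.
apply: leq_add; first by rewrite leq_mul2l cardsE leqnn orbT.
apply: (@leq_trans (m * #|[set A : 'M[F]_(\dim W, \dim U) | ~~ nd (limg (graph A))]|)%N).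
  by rewrite leq_mul2l cardsE leqnn orbT.
apply: leq_trans (card_degenerate_graphs ndW WU radW) _.
by rewrite leq_mul2r sumW orbT.
Qed.

End OneSubspace.
End Graphs.

(** * Radicals, and the parity of dimensions under alternating forms *)

Section Radical.
Variables (F : finFieldType) (d : nat).
Local Notation V := 'rV[F]_d.
Variables (eps : bool) (theta : {rmorphism F -> F}).
Variable f : {hermitian V for eps & theta}.
Implicit Types (U W X Y L : {vspace V}) (u v w : V).
Local Notation "U ^_" := (orthov f U) (at level 2, format "U ^_").
Local Notation nd := (nondegenerate_on f).

Lemma nd_diffv_radical X : nd (X :\: (X :&: X^_)).
Proof.
apply/ndP => x; set C := (X :\: _)%VS => xC xperp.
have xX : x \in X by apply: (subvP (diffvSl _ _)) xC.
apply/eqP; rewrite -memv0 -(capv_diff X (X :&: X^_)) memv_cap xC memv_cap xX /=.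
apply/mem_orthovP => y; rewrite -{1}(addv_diff_cap X (X :&: X^_)).
case/memv_addP => c cC [r rR ->]; rewrite fDr xperp // add0r.
have /mem_orthovP/(_ x xX) : r \in X^_ by move: rR; rewrite !memv_cap => /and3P[].
exact: form_eq0_sym.
Qed.

Lemma nd_plane u v : f u u = 0 -> f u v != 0 ->
  nd (<[u]> + <[v]>) /\ \dim (<[u]> + <[v]>) = 2%N.
Proof.
move=> fuu fuv; split.
  apply/ndP => w /memv_addP[_ /vlineP[a ->] [_ /vlineP[b ->] ->]] wperp.
  have fvu : f v u != 0 by rewrite herm_eq0C.
  have b0 : b = 0.
    have := wperp u; rewrite memvE addvSl => /(_ isT)/eqP.
    by rewrite fDl !fZl fuu mulr0 add0r mulf_eq0 (negPf fvu) orbF => /eqP.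
  have := wperp v; rewrite memvE addvSr => /(_ isT)/eqP.
  rewrite b0 scale0r addr0 fZl mulf_eq0 (negPf fuv) orbF => /eqP ->.
  by rewrite scale0r.
have v0 : v != 0 by apply: contraNneq fuv => ->; rewrite f0r.
have u0 : u != 0 by apply: contraNneq fuv => ->; rewrite f0l.
rewrite dimv_disjoint_sum ?dim_vline ?u0 ?v0 //.
apply/eqP; rewrite -subv0; apply/subvP => w; rewrite memv_cap memv0.
case/andP => /vlineP[a ->] /vlineP[b eab].
have : f u (a *: u) = 0 by rewrite fZr fuu mulr0.
rewrite eab fZr => /eqP; rewrite mulf_eq0 (negPf fuv) orbF fmorph_eq0 => /eqP ->.
by rewrite scale0r.
Qed.

Section Alternating.
Hypothesis alt : forall u, f u u = 0.

Lemma even_dim_alternating X : nd X -> ~~ odd (\dim X).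
Proof.
have [n] := ubnP (\dim X); elim: n X => // n IH X /ltnSE dimX ndX.
have [->|] := eqVneq X 0%VS; first by rewrite dimv0.
rewrite -vpick0; set u := vpick X => u0.
have /mem_orthovPn[v vX fuv] : u \notin X^_.
  by apply: contra u0 => uX; rewrite -memv0 -(eqP ndX) memv_cap memv_pick.
have [ndL dimL] := nd_plane (alt u) fuv.
have LX : (<[u]> + <[v]> <= X)%VS by rewrite subv_add -!memvE memv_pick.
have := dim_cap_orthov ndL LX; rewrite dimL => eX.
by rewrite -eX add2n /= negbK IH -?(nd_cap_orthov ndL LX) //; lia.
Qed.

(** A complement of the radical is nondegenerate, hence of even dimension. *)
Lemma odd_dim_radical_alternating X : odd (\dim (X :&: X^_)) = odd (\dim X).
Proof.
rewrite -[in RHS](dimv_cap_compl X (X :&: X^_)) oddD capvA capvv.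
by rewrite [X in _ (+) X](negPf (even_dim_alternating (nd_diffv_radical X))) addbF.
Qed.

End Alternating.

Lemma card_radical_coords (U W : {vspace V}) (A : 'M[F]_(\dim W, \dim U)) :
  nd U -> nd W -> (W <= U^_)%VS ->
  #|radical_coords f A| =
    (#|F| ^ \dim (limg (graph A) :&: (limg (graph A))^_)).-1.
Proof.
move=> ndU ndW WU; set R := (_ :&: _)%VS; rewrite -card_vspace_set (cardsD1 0 [set x | x \in R]) inE mem0v /=.
have gA_inj : injective (graph A) by apply/lker0P/lker_graph/WU.
rewrite -(card_imset _ gA_inj); apply: eq_card => v; rewrite !inE.
apply/imsetP/andP => [[x]|[v0]].
  rewrite inE => /andP[x0 /forallP xrad] ->; split.
    by rewrite -(linear0 (graph A)) (inj_eq gA_inj).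
  rewrite memv_cap memv_img ?memvf //=; apply/mem_orthovP => _ /memv_imgP[y _ ->].
  exact/eqP.
rewrite memv_cap => /andP[/memv_imgP[x _ ev] /mem_orthovP vperp]; exists x => //.
rewrite inE; apply/andP; split.
  by apply: contra v0 => /eqP x0; rewrite ev x0 linear0.
by apply/forallP => y; rewrite -ev vperp ?memv_img ?memvf.
Qed.

Lemma nd_limg_eq0 X : nd X = (\dim (X :&: X^_) == 0)%N.
Proof. by rewrite dimv_eq0. Qed.

End Radical.

Lemma nondeg_sum_proportion_ge (F : finFieldType) d eps (theta : {rmorphism F -> F})
    (f : {hermitian 'rV[F]_d for eps & theta}) (A A' : {set {vspace 'rV[F]_d}}) rho :
  (0 < #|A|)%N -> (0 < #|A'|)%N ->
  (forall U, U \in A -> rho * #|A'|%:R <=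
     #|[set U' in A' | ((U :&: U')%VS == 0%VS) && nondegenerate_on f (U + U')]|%:R) ->
  rho <= nondeg_sum_proportion f A A'.
Proof.
move=> A_gt0 A'_gt0 H; rewrite /nondeg_sum_proportion ler_pdivlMr; last first.
  by rewrite ltr0n muln_gt0 A_gt0.
suff -> : #|nondeg_sum_pairs f A A'| = (\sum_(U in A)
    #|[set U' in A' | ((U :&: U')%VS == 0%VS) && nondegenerate_on f (U + U')]|)%N.
  rewrite natr_sum natrM mulrCA mulr_natl -sumr_const.
  by apply: ler_sum => U UA; exact: H.
rewrite -sum1_card (partition_big (fun W => W.1) (mem A)) /=; last first.
  by move=> [U U']; rewrite !inE => /andP[/andP[]].
apply: eq_bigr => U UA; rewrite sum1_card.
rewrite -(@card_imset _ _ (fun U' => (U, U')) [set U' in A' | _]); last by move=> ? ? [].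
apply: eq_card => -[U1 U']; rewrite -topredE /= !inE /=.
apply/andP/imsetP => [[/andP[/andP[_ U'A] H1] /eqP eU]|[U2]].
  by exists U'; rewrite ?inE ?U'A /= -eU.
by rewrite inE => /and3P[U2A cap0 ndU] [-> ->]; rewrite UA U2A cap0 ndU eqxx.
Qed.

(** * Symplectic spaces *)

Section Flags.
Variables (F : finFieldType) (d : nat).
Local Notation V := 'rV[F]_d.
Variables (eps : bool) (theta : {rmorphism F -> F}).
Variable f : {hermitian V for eps & theta}.
Implicit Types (U W X Y L : {vspace V}) (u v w : V).
Local Notation "U ^_" := (orthov f U) (at level 2, format "U ^_").
Local Notation nd := (nondegenerate_on f).

(** Both sides count the pairs of an index [t] and a nondegenerate [U] with [L t <= U <= X]. With
    hyperbolic pairs or nonisotropic vectors as indices, the inner cardinality on the left depends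
    only on [\dim U], and a recursion for the number of nondegenerate subspaces results. *)
Lemma sum_card_flags (T : finType) (P : pred T) (L : T -> {vspace V}) l X k :
  (forall t, P t -> nd (L t) /\ \dim (L t) = l) ->
  (\sum_(U in nd_in f X (l + k)) #|[set t | P t && (L t <= U)%VS]| =
   \sum_(t | P t && (L t <= X)%VS) #|nd_in f (X :&: (L t)^_) k|)%N.
Proof.
move=> PL.
rewrite (eq_bigr (fun U => \sum_(t | P t && (L t <= X)%VS) (L t <= U)%VS : nat)%N).
  rewrite exchange_big; apply: eq_bigr => t /andP[Pt LX] /=.
  have [ndL <-] := PL _ Pt; rewrite -(card_nd_in_containing k ndL LX) -sum1_card.
  rewrite [RHS](eq_bigl (fun U => (U \in nd_in f X (\dim (L t) + k)) && (L t <= U)%VS)); last first.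
    by move=> U; rewrite inE.
  by rewrite [RHS]big_mkcondr; apply: eq_bigr => U _; case: (L t <= U)%VS.
move=> U; rewrite inE => /and3P[_ _ UX]; rewrite -sum1_card.
rewrite [LHS]big_mkcond [RHS]big_mkcond; apply: eq_bigr => t _.
rewrite inE; case: (P t) => //=; case LU : (L t <= U)%VS; last by case: ifP.
by rewrite (subv_trans LU UX).
Qed.

End Flags.

(** The number of pairs [(u, v)] with [f u v != 0] in a symplectic space of dimension [m]. The value
    of [f u v] is not normalised to 1, since the factor [q - 1] cancels in [symplectic_count]. *)
Definition hyperbolic_count (R : realFieldType) (q : R) m : R :=
  (q ^+ m - 1) * (q ^+ m - q ^+ m.-1).

Fixpoint symplectic_count (R : realFieldType) (q : R) j m : R :=
  if j is j'.+1 then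
    hyperbolic_count q m / hyperbolic_count q j.*2 * symplectic_count q j' (m - 2)%N
  else 1.

Lemma hyperbolic_count_gt0 (R : realFieldType) (q : R) m : 2 <= q -> (0 < m)%N ->
  0 < hyperbolic_count q m.
Proof.
case: m => // m q2 _; rewrite /hyperbolic_count /= mulr_gt0 ?subr_gt0 //.
  by rewrite exprn_egt1 //; lra.
by rewrite ltr_eXn2l //; lra.
Qed.

Lemma symplectic_count_gt0 (R : realFieldType) (q : R) j m : 2 <= q ->
  (j.*2 <= m)%N -> 0 < symplectic_count q j m.
Proof.
move=> q2; elim: j m => [|j IH] m /=; first by rewrite ltr01.
rewrite -/(j.+1.*2) => jm.
by rewrite mulr_gt0 ?divr_gt0 ?hyperbolic_count_gt0 ?IH //; lia.
Qed.

(* The deficit telescopes: [1 - q^-m] is the ratio of the [hyperbolic_count]s in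
   dimensions [m] and [m + e] up to [q ^ (2e)], and [q^-r - q^-(2j+r)] over
   [q^2 - 1] is the geometric sum of the [q^-m] that occur. *)
Lemma symplectic_count_ratio (R : realFieldType) (q : R) j r e : 2 <= q ->
  symplectic_count q j (j.*2 + r + e) *
    (1 - (q^-1 ^+ r - q^-1 ^+ (j.*2 + r)) / (q ^+ 2 - 1))
  <= symplectic_count q j (j.*2 + r) * q ^+ (j.*2 * e).
Proof.
move=> q2; have q0 : q != 0 by lra.
have qq : 0 < q ^+ 2 - 1 by nra.
elim: j => [|j IH]; first by rewrite add0n mul0n subrr mul0r subr0 expr0.
rewrite [symplectic_count _ _ _]/= [X in _ <= X * _]/=.
have -> : (j.+1.*2 + r + e - 2 = j.*2 + r + e)%N by lia.
have -> : (j.+1.*2 + r - 2 = j.*2 + r)%N by lia.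
rewrite -/(j.+1.*2).
set D := hyperbolic_count q j.+1.*2.
have D0 : 0 < D by apply: hyperbolic_count_gt0.
have -> : q ^+ (j.+1.*2 * e) = q ^+ (e * 2) * q ^+ (j.*2 * e).
  by rewrite -exprD; congr (_ ^+ _); lia.
rewrite !(mulrAC _ D^-1) ler_pM2r ?invr_gt0 //.
have c0 : 0 < symplectic_count q j (j.*2 + r + e) by apply: symplectic_count_gt0 => //; lia.
set y := q^-1 ^+ (j.+1.*2 + r).
have y0 : 0 < y by rewrite exprn_gt0 // invr_gt0; lra.
have y1 : y <= 1 by rewrite exprn_ile1 // ?invr_ge0 ?invf_le1; lra.
have eh : hyperbolic_count q (j.+1.*2 + r + e) * (1 - y) <= hyperbolic_count q (j.+1.*2 + r) * q ^+ (e * 2).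
  rewrite /hyperbolic_count.
  have -> : ((j.+1.*2 + r + e).-1 = (j.*2 + r).+1 + e)%N by lia.
  have -> : ((j.+1.*2 + r).-1 = (j.*2 + r).+1)%N by lia.
  have -> : (j.+1.*2 + r = (j.*2 + r).+2)%N by lia.
  have ez : q ^+ (j.*2 + r).+2 = q * q ^+ (j.*2 + r).+1 by rewrite exprS.
  have yz : y = (q * q ^+ (j.*2 + r).+1)^-1.
    by rewrite /y exprVn -ez; congr (_ ^+ _)^-1; lia.
  rewrite yz !exprD ez muln2 -(addnn e) exprD.
  set z := q ^+ _.+1; have z1 : 1 <= z by rewrite exprn_ege1 //; lra.
  set w := q ^+ e; have w1 : 1 <= w by rewrite exprn_ege1 //; lra.
  rewrite -subr_ge0.
  have -> : (q * z - 1) * (q * z - z) * (w * w) -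
    (q * z * w - 1) * (q * z * w - z * w) * (1 - (q * z)^-1) =
    (q - 1) * w * (q * z - 1) / q by field; rewrite q0; lra.
  by rewrite divr_ge0 ?mulr_ge0 //; nra.
set B := (q^-1 ^+ r - q^-1 ^+ (j.*2 + r)) / (q ^+ 2 - 1) in IH.
have yB : (q^-1 ^+ r - y) / (q ^+ 2 - 1) = B + y.
  have -> : y = q^-1 ^+ 2 * q^-1 ^+ (j.*2 + r) by rewrite -exprD /y; congr (_ ^+ _); lia.
  by rewrite /B; field; rewrite q0; lra.
have B0 : 0 <= B.
  apply: divr_ge0; last exact: ltW.
  by rewrite subr_ge0 ler_wiXn2l ?leq_addl ?invr_ge0 ?invf_le1 //; lra.
have B1 : B <= 1.
  rewrite ler_pdivrMr // mul1r.
  have : q^-1 ^+ r <= 1 by rewrite exprn_ile1 // ?invr_ge0 ?invf_le1; lra.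
  have : 0 <= q^-1 ^+ (j.*2 + r) by rewrite exprn_ge0 // invr_ge0; lra.
  by nra.
rewrite yB; set c := symplectic_count q j _ in c0 IH *.
apply: (@le_trans _ _ ((hyperbolic_count q (j.+1.*2 + r + e) * (1 - y)) * (c * (1 - B)))).
  have h0 : 0 < hyperbolic_count q (j.+1.*2 + r + e) by apply: hyperbolic_count_gt0 => //; lia.
  rewrite mulrACA ler_pM2l ?(mulr_gt0 h0 c0) //.
  by have := mulr_ge0 B0 (ltW y0); lra.
rewrite [X in _ <= X]mulrACA; apply: ler_pM => //; apply: mulr_ge0; rewrite ?subr_ge0 ?(ltW c0) //.
by apply/ltW; apply: hyperbolic_count_gt0 => //; clear; lia.
Qed.

(** The first factor bounds the proportion of nondegenerate graphs; the second compares the choices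
    of [W], times the number of graphs, with the number of all [U']. *)
Lemma symplectic_bound (R : realFieldType) (q : R) : 2 <= q ->
  1 - (7 / 4) / q <= (1 - q / (q ^+ 2 - 1)) * (1 - 1 / (q ^+ 2 - 1)).
Proof.
move=> q2; have q0 : q != 0 by lra.
have q1 : 0 < q ^+ 2 - 1 by nra.
rewrite -subr_ge0.
have -> : (1 - q / (q ^+ 2 - 1)) * (1 - 1 / (q ^+ 2 - 1)) - (1 - (7 / 4) / q) =
 (7 * (q ^+ 2 - 1) ^+ 2 - 4 * (q + 1) * q * (q ^+ 2 - 1) + 4 * q ^+ 2) / (4 * q * (q ^+ 2 - 1) ^+ 2).
  by field; rewrite q0 /=; lra.
apply: divr_ge0; last by rewrite mulr_ge0 ?sqr_ge0 //; lra.
pose t := q - 2; have -> : q = t + 2 by rewrite /t; ring.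
have t0 : 0 <= t by rewrite /t; lra.
by nra.
Qed.

Lemma natr_graph_bound (R : numDomainType) (q n g e e' : nat) : (0 < q)%N ->
  (n * ((q ^ 2 - 1) * q ^ (e' * e)) <=
     (q ^ 2 - 1) * g + n * ((q ^ e' - 1) * (q ^ e - 1) * (q ^ e.-1) ^ e'.-1))%N ->
  n%:R * ((q%:R ^+ 2 - 1) * q%:R ^+ (e' * e)) <= (q%:R ^+ 2 - 1) * g%:R +
    n%:R * ((q%:R ^+ e' - 1) * (q%:R ^+ e - 1) * (q%:R ^+ e.-1) ^+ e'.-1) :> R.
Proof.
move=> q0; rewrite -(ler_nat R) natrD !natrM !natrB ?expn_gt0 ?q0 //.
by rewrite !natrX.
Qed.

Lemma symplectic_graph_bound (R : realFieldType) (q G : R) e e' d :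
  2 <= q -> (0 < e)%N -> (0 < e')%N -> (e + e' <= d)%N -> ~~ odd e' ->
  let N := symplectic_count q e'./2 (d - e) in let N' := symplectic_count q e'./2 d in
  N * ((q ^+ 2 - 1) * q ^+ (e' * e)) <=
    (q ^+ 2 - 1) * G + N * ((q ^+ e' - 1) * (q ^+ e - 1) * (q ^+ e.-1) ^+ e'.-1) ->
  (1 - (7 / 4) / q) * N' <= G.
Proof.
move=> q2 e0 e'0 le_d e'_even N N'.
have e'E : e'./2.*2 = e' by rewrite -[RHS]odd_double_half (negPf e'_even).
have ratio : N' * (1 - (q^-1 ^+ (d - e - e') - q^-1 ^+ (d - e)) / (q ^+ 2 - 1)) <= N * q ^+ (e' * e).
  have := symplectic_count_ratio e'./2 (d - e - e') e q2; rewrite e'E.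
  have -> : (e' + (d - e - e') = d - e)%N by lia.
  by have -> : (d - e + e = d)%N by lia.
have N'0 : 0 < N' by apply: symplectic_count_gt0; rewrite ?e'E //; lia.
have N0 : 0 < N by apply: symplectic_count_gt0; rewrite ?e'E //; lia.
clearbody N N'; set P := q ^+ (e' * e) in ratio *; move=> H.
have ip k : 0 <= q^-1 ^+ k <= 1.
  by clear - q2; rewrite exprn_ge0 ?exprn_ile1 // ?invr_ge0 ?invf_le1 //; lra.
have D0 : 0 < q ^+ 2 - 1 by clear - q2; nra.
have ratio' : N' * (1 - 1 / (q ^+ 2 - 1)) <= N * P.
  apply: le_trans ratio; rewrite ler_pM2l // lerD2l lerN2.
  rewrite ler_pM2r ?invr_gt0 //.
  by move: (ip (d - e - e')%N) (ip (d - e)%N); clear; lra.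
have P0 : 0 < P by rewrite exprn_gt0 //; clear - q2; lra.
(* The exponents add up to [e' + e + (e - 1) (e' - 1) = e' e + 1]; after division by the
   [q ^+ 2 - 1] radical vectors, degenerate graphs have proportion at most [q / (q ^+ 2 - 1)]. *)
have lost : (q ^+ e' - 1) * (q ^+ e - 1) * (q ^+ e.-1) ^+ e'.-1 <= q * P.
  have -> : q * P = q ^+ e' * q ^+ e * (q ^+ e.-1) ^+ e'.-1.
    rewrite -exprM -!exprD -exprS; congr (_ ^+ _).
    by clear - e0 e'0; case: e e0 => // e _; case: e' e'0 => // e' _; lia.
  have q1 k : 1 <= q ^+ k by clear - q2; rewrite exprn_ege1 //; lra.
  rewrite ler_pM2r ?exprn_gt0 //; last by clear - q2; lra.
  by move: (q1 e) (q1 e'); clear; nra.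
have {}H : N * P * (1 - q / (q ^+ 2 - 1)) <= G.
  rewrite -(ler_pM2l D0).
  have -> : (q ^+ 2 - 1) * (N * P * (1 - q / (q ^+ 2 - 1))) = N * ((q ^+ 2 - 1) * P) - N * (q * P).
    by clear - D0; field; lra.
  by rewrite lerBlDr; apply: le_trans H _; rewrite lerD2l ler_pM2l.
apply: le_trans H; apply: (@le_trans _ _ (N' * (1 - 1 / (q ^+ 2 - 1)) * (1 - q / (q ^+ 2 - 1)))).
  rewrite [X in X <= _]mulrC -[X in _ <= X]mulrA ler_pM2l // [X in _ <= X]mulrC.
  exact: symplectic_bound.
by rewrite ler_pM2r // subr_gt0 ltr_pdivrMr //; clear - q2; nra.
Qed.

Section Symplectic.
Variables (F : finFieldType) (d : nat).
Local Notation V := 'rV[F]_d.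
Variables (eps : bool) (theta : {rmorphism F -> F}).
Variable f : {hermitian V for eps & theta}.
Implicit Types (U W X Y L : {vspace V}) (u v w : V).
Local Notation "U ^_" := (orthov f U) (at level 2, format "U ^_").
Local Notation nd := (nondegenerate_on f).
Local Notation q := (#|F|%:R : rat).
Local Notation plane t := (<[t.1]> + <[t.2]>)%VS.

Lemma q_ge2 : 2 <= q.
Proof. by rewrite ler_nat finNzRing_gt1. Qed.

Lemma nd_radical_notin X u : nd X -> u \in X -> u != 0 -> u \notin X^_.
Proof. by move=> ndX uX; apply: contra => uXp; rewrite -memv0 -(eqP ndX) memv_cap uX. Qed.

Lemma card_form_neq0 X u : nd X -> u \in X -> u != 0 ->
  (#|[set v in X | f u v != 0%R]| = #|F| ^ \dim X - #|F| ^ (\dim X).-1)%N.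
Proof.
move=> ndX uX u0; have := card_level_form 0 (nd_radical_notin ndX uX u0).
have dX : (0 < \dim X)%N.
  by rewrite lt0n dimv_eq0; apply: contraNneq u0 => X0; rewrite -memv0 -X0.
rewrite -{1}(prednK dX) expnSr => /eqP; rewrite eqn_pmul2r; last exact: ltnW (finNzRing_gt1 F).
move/eqP=> <-; rewrite -card_vspace_set.
rewrite -(cardsID [set v | f v u == 0] [set v | v \in X]).
have -> : [set v | v \in X] :&: [set v | f v u == 0] = [set v in X | f v u == 0].
  by apply/setP => v; rewrite !inE.
rewrite addKn; apply: eq_card => v; rewrite !inE andbC.
by rewrite herm_eq0C.
Qed.

Lemma card_nd_in0 X : #|nd_in f X 0| = 1%N.
Proof.
apply/eqP/cards1P; exists 0%VS; apply/setP => U.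
rewrite !inE dimv_eq0; case: eqP => [->|_]; last by rewrite andbF.
by rewrite nd0 sub0v.
Qed.

Hypothesis alt : forall u, f u u = 0.

Lemma card_hyperbolic_pairs X : nd X ->
  #|[set t : V * V | (f t.1 t.2 != 0) && (plane t <= X)%VS]|%:R =
  hyperbolic_count q (\dim X).
Proof.
move=> ndX.
have -> : #|[set t : V * V | (f t.1 t.2 != 0) && (plane t <= X)%VS]| =
    (\sum_(u in X | u != 0%R) #|[set v in X | f u v != 0%R]|)%N.
  rewrite (eq_bigr (fun u => \sum_(v | (v \in X) && (f u v != 0%R)) 1)%N); last first.
    by move=> u _; rewrite -sum1_card; apply: eq_bigl => v; rewrite inE.
  rewrite pair_big_dep -sum1_card; apply: eq_bigl => -[u v]; rewrite !inE /=.
  rewrite subv_add -!memvE andbC.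
  case: (u \in X) => //=; case: (v \in X); rewrite ?andbF //= ?andbT.
  by have [->|//] := eqVneq u 0; rewrite f0l eqxx.
rewrite (eq_bigr (fun=> #|F| ^ \dim X - #|F| ^ (\dim X).-1)%N); last first.
  by move=> u /andP[uX u0]; rewrite card_form_neq0.
rewrite sum_nat_const natrM natrB; last by rewrite leq_exp2l ?finNzRing_gt1 ?leq_pred.
rewrite !natrX /hyperbolic_count; congr (_ * _).
have := card_vspace_set X; rewrite (cardsD1 0) inE mem0v => /(congr1 (fun n : nat => n%:R : rat)).
rewrite natrD natrX => <-; rewrite [RHS]addrC addKr; congr (_%:R).
by apply: eq_card => v; rewrite !inE andbC.
Qed.

(** Flags of a hyperbolic pair inside a subspace, counted from either end, reproduce the recursion
    that defines [symplectic_count]. *)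
Lemma card_nd_in_symplectic j X : nd X ->
  #|nd_in f X j.*2|%:R = symplectic_count q j (\dim X).
Proof.
elim: j X => [|j IH] X ndX; first by rewrite card_nd_in0.
have PL t : f t.1 t.2 != 0 -> nd (plane t) /\ \dim (plane t) = 2%N.
  exact: nd_plane (alt t.1).
have := sum_card_flags X j.*2 PL; rewrite add2n -doubleS.
move/(congr1 (fun n : nat => n%:R : rat)); rewrite !natr_sum.
rewrite (eq_bigr (fun=> hyperbolic_count q j.+1.*2)); last first.
  move=> U; rewrite inE => /and3P[ndU /eqP dimU _].
  by rewrite -dimU -card_hyperbolic_pairs.
rewrite [RHS](eq_bigr (fun=> symplectic_count q j (\dim X - 2))); last first.
  move=> t /andP[Pt LX]; have [ndL dimL] := PL _ Pt.
  rewrite IH -?nd_cap_orthov //; congr symplectic_count.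
  by have := dim_cap_orthov ndL LX; rewrite dimL; lia.
rewrite !sumr_const -[X in _ = X]mulr_natl.
have -> : #|[pred t : V * V | (f t.1 t.2 != 0) && (plane t <= X)%VS]|%:R = hyperbolic_count q (\dim X).
  by rewrite -card_hyperbolic_pairs //; congr (_%:R); apply: eq_card => t; rewrite !inE.
rewrite -[hyperbolic_count _ _ *+ _]mulr_natl => eN.
have h0 : hyperbolic_count q j.+1.*2 != 0 by rewrite gt_eqF ?hyperbolic_count_gt0 ?q_ge2.
apply: (mulIf h0); rewrite eN.
change (hyperbolic_count q (\dim X) * symplectic_count q j (\dim X - 2) =
  hyperbolic_count q (\dim X) / hyperbolic_count q j.+1.*2
    * symplectic_count q j (\dim X - 2) * hyperbolic_count q j.+1.*2).
by rewrite [RHS]mulrAC mulfVK.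
Qed.

Lemma card_norm_set_alternating U c : norm_set f U c = if c == 0 then [set u in U | u != 0] else set0.
Proof.
apply/setP => u; rewrite inE alt [0 == c]eq_sym.
by case: ifP; rewrite !inE ?andbT ?andbF.
Qed.

Lemma symplectic_case (e e' : nat) : nondegenerate f ->
  (0 < e)%N -> (0 < e')%N -> (e + e' <= d)%N -> ~~ odd e -> ~~ odd e' ->
  1 - (7 / 4) / q <= nondeg_sum_proportion f (nondeg_subspaces f e) (nondeg_subspaces f e').
Proof.
rewrite -ndfE => ndV e0 e'0 le_d e_even e'_even.
have dimV : \dim {:V} = d by rewrite dimvf /dim /= mul1n.
have cardN k : ~~ odd k -> #|nondeg_subspaces f k|%:R = symplectic_count q k./2 d.
  move=> k_even; rewrite -nd_in_fullv -[in LHS](even_halfK k_even).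
  by rewrite card_nd_in_symplectic // dimV.
have N_gt0 k : ~~ odd k -> (k <= d)%N -> (0 < #|nondeg_subspaces f k|)%N.
  move=> k_even kd; rewrite -(ltr_nat rat) cardN // symplectic_count_gt0 ?q_ge2 //.
  by rewrite even_halfK.
apply: nondeg_sum_proportion_ge; [apply: N_gt0 => //; lia ..|].
move=> U; rewrite inE => /andP[ndU /eqP dimU].
have dimUp : \dim U^_ = (d - e)%N.
  by have := dim_cap_orthov ndU (subvf U); rewrite capfv dimU dimV => H; rewrite -(addKn e (\dim U^_)) H.
have ndUp : nd U^_ by have := nd_cap_orthov ndU (subvf U); rewrite capfv ndV.
rewrite -/(nondeg_partners f U e').
have q2 := q_ge2.
have Q1 : (1 < #|F|)%N by exact: finNzRing_gt1.
have Q0 : (0 < #|F|)%N by exact: ltnW.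
have H := @leq_card_nondeg_partners _ _ _ _ f U ndU e' (#|F| ^ 2 - 1)%N
  ((#|F| ^ e' - 1) * (#|F| ^ \dim U - 1))%N.
have {H} : (#|nd_in f U^_ e'| * ((#|F| ^ 2 - 1) * #|F| ^ (e' * e)) <=
    (#|F| ^ 2 - 1) * #|nondeg_partners f U e'| +
    #|nd_in f U^_ e'| * ((#|F| ^ e' - 1) * (#|F| ^ e - 1) * (#|F| ^ e.-1) ^ e'.-1))%N.
  rewrite -dimU; apply: H => [W A|W]; rewrite inE => /and3P[ndW /eqP dimW WU].
    rewrite nd_limg_eq0 => rad0; rewrite card_radical_coords // -subn1 leq_sub2r // leq_exp2l //.
    (* The graph has the even dimension of [W], so its nonzero radical has dimension at least 2 and
       contains at least [q ^ 2 - 1] nonzero vectors. *)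
    have W_even : ~~ odd (\dim W) by rewrite dimW.
    have := odd_dim_radical_alternating alt (limg (graph A)).
    rewrite (dim_graph ndU WU) (negPf W_even) => /negbT.
    by case: (\dim _) rad0 => [|[]].
  rewrite (eq_bigr (fun=> #|F| ^ \dim U - 1)%N); last first.
    move=> w _; rewrite alt oppr0 card_norm_set_alternating eqxx.
    have := card_vspace_set U; rewrite (cardsD1 0) inE mem0v => <-.
    by rewrite addKn; apply: eq_card => u; rewrite !inE andbC.
  rewrite sum_nat_const leq_mul2r; apply/orP; right.
  have := card_vspace_set W; rewrite (cardsD1 0) inE mem0v dimW => <-.
  by rewrite addKn; apply/eq_leq/eq_card => u; rewrite !inE andbC.
move/(natr_graph_bound rat Q0).
have -> : #|nd_in f U^_ e'|%:R = symplectic_count q e'./2 (d - e) :> rat.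
  by rewrite -{1}(even_halfK e'_even) card_nd_in_symplectic // dimUp.
rewrite (cardN _ e'_even); exact: symplectic_graph_bound q2 e0 e'0 le_d e'_even.
Qed.

End Symplectic.

(** * Unitary spaces *)

(** At [x = q^-1] this is the factor [1 - (-1/q)^m] from the order formula of the unitary groups. *)
Definition alt_factor (R : realFieldType) (x : R) m : R := 1 - (- x) ^+ m.

(** The number of nonisotropic vectors of an [m]-dimensional hermitian space, up to the factor
    [(q - 1) / q], which cancels in [unitary_count]. *)
Definition nonisotropic_count (R : realFieldType) (q : R) m : R :=
  (q ^+ 2) ^+ m - (- q) ^+ m.

Fixpoint unitary_count (R : realFieldType) (q : R) k m : R :=
  if k is k'.+1 then
    nonisotropic_count q m / nonisotropic_count q k * unitary_count q k' m.-1
  else 1.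

Lemma nonisotropic_countE (R : realFieldType) (q : R) m : q != 0 ->
  nonisotropic_count q m = (q ^+ 2) ^+ m * alt_factor q^-1 m.
Proof.
move=> q0; rewrite /nonisotropic_count /alt_factor mulrBr mulr1; congr (_ - _).
by rewrite -exprMn; congr (_ ^+ _); field.
Qed.

Lemma alt_factor_gt0 (R : realFieldType) (x : R) m : 0 < x < 1 -> (0 < m)%N ->
  0 < alt_factor x m.
Proof.
case/andP=> x0 x1 m0; rewrite subr_gt0; apply: le_lt_trans (ler_norm _) _.
by rewrite normrX normrN gtr0_norm // exprn_ilt1 // ?ltW // -lt0n.
Qed.

Lemma inv_ge2 (R : realFieldType) (q : R) : 2 <= q -> 0 < q^-1 < 1.
Proof.
by move=> q2; rewrite invr_gt0 invf_lt1; [apply/andP; split; lra|lra].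
Qed.

Lemma inv_ge2_half (R : realFieldType) (q : R) : 2 <= q -> 0 < q^-1 <= 1 / 2.
Proof.
by move=> q2; rewrite invr_gt0 div1r lef_pV2 ?posrE; [apply/andP; split; lra|lra..].
Qed.

Lemma nonisotropic_count_gt0 (R : realFieldType) (q : R) m : 2 <= q -> (0 < m)%N ->
  0 < nonisotropic_count q m.
Proof.
move=> q2 m0; rewrite nonisotropic_countE; last lra.
by rewrite mulr_gt0 ?alt_factor_gt0 ?inv_ge2 // !exprn_gt0 //; lra.
Qed.

Lemma unitary_count_gt0 (R : realFieldType) (q : R) k m : 2 <= q -> (k <= m)%N ->
  0 < unitary_count q k m.
Proof.
move=> q2; elim: k m => [|k IH] [|m] //= km.
by rewrite mulr_gt0 ?divr_gt0 ?nonisotropic_count_gt0 ?IH.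
Qed.

(** The factors lie alternately below and above 1 and approach 1 geometrically, so the product stays
    between 1 and a bound set by its leading term. The parity of [r] decides on which side; the
    induction peels off the first factor and thereby flips it. *)
Lemma prod_alt_factor_bounds (R : realFieldType) (x : R) k r : 0 < x <= 1 / 2 ->
  let P := \prod_(i < k) alt_factor x (r.+1 + i) in
  if odd r then 1 - x ^+ r.+1 <= P <= 1 else 1 <= P <= 1 + x ^+ r.+1.
Proof.
move=> x01; have [x0 x1] := andP x01; elim: k r => [|k IH] r /=.
  have xr : 0 <= x ^+ r.+1 by rewrite exprn_ge0 // ltW.
  by rewrite big_ord0; case: ifP => _; apply/andP; split; lra.
rewrite big_ord_recl addn0.
have -> : \prod_(i < k) alt_factor x (r.+1 + bump 0 i) = \prod_(i < k) alt_factor x (r.+2 + i).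
  by apply: eq_bigr => i _; congr alt_factor; rewrite /bump; lia.
have := IH r.+1; set P := \prod_(i < k) _ => /=.
have xr0 : 0 < x ^+ r.+1 by rewrite exprn_gt0.
have xr1 : x ^+ r.+1 <= x by rewrite exprS ger_pMr // exprn_ile1 //; lra.
rewrite [alt_factor x r.+1]/alt_factor exprNn -signr_odd /= [x ^+ r.+2]exprS.
case: (odd r) => /= /andP[P1 P2]; rewrite ?expr1 ?expr0 ?mul1r ?mulN1r ?opprK; apply/andP; split.
- by nra.
- apply: le_trans (_ : (1 - x ^+ r.+1) * (1 + x * x ^+ r.+1) <= _); last by nra.
  by rewrite ler_pM2l //; lra.
- apply: le_trans (_ : (1 + x ^+ r.+1) * (1 - x * x ^+ r.+1) <= _); first by nra.
  by rewrite ler_pM2l //; lra.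
- by nra.
Qed.

(** The denominators of the two subspace counts agree; what remains of their quotient, besides a
    power of [q], is a quotient of two products of consecutive [alt_factor]s. *)
Lemma unitary_count_prod (R : realFieldType) (q : R) k r e : 2 <= q ->
  unitary_count q k (k + r) * q ^+ (2 * k * e) * \prod_(i < k) alt_factor q^-1 ((r + e).+1 + i)
  = unitary_count q k (k + r + e) * \prod_(i < k) alt_factor q^-1 (r.+1 + i).
Proof.
move=> q2; elim: k => [|k IH]; first by rewrite !big_ord0 muln0 mul0n expr0 !mulr1.
rewrite !big_ord_recr /=.
have q0 : q != 0 by lra.
set A := \prod_(i < k) _ in IH *; set B := \prod_(i < k) _ in IH *.
have nk0 : nonisotropic_count q k.+1 != 0 by rewrite gt_eqF ?nonisotropic_count_gt0.
rewrite ![nonisotropic_count q (_ + _)]nonisotropic_countE //.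
have -> : (k.+1 + r + e = k + (r + e).+1)%N by lia.
have -> : ((r + e).+1 + k = k + (r + e).+1)%N by lia.
have -> : (k.+1 + r = r.+1 + k)%N by lia.
have -> : q ^+ (2 * k.+1 * e) = q ^+ (2 * e) * q ^+ (2 * k * e).
  by rewrite -exprD; congr (_ ^+ _); lia.
have -> : (q ^+ 2) ^+ (k + (r + e).+1) = (q ^+ 2) ^+ (r.+1 + k) * q ^+ (2 * e).
  by rewrite -!exprM -exprD; congr (_ ^+ _); lia.
set n1 := nonisotropic_count _ _ in nk0 *.
set a := alt_factor _ _; set b := alt_factor _ _; set z := _ ^+ (r.+1 + k).
move: IH; set c := unitary_count _ _ _; set c' := unitary_count _ _ _.
set w := q ^+ (2 * k * e); set v := q ^+ (2 * e) => IH.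
transitivity (z * b * v * a / n1 * (c * w * A)); first by ring.
by rewrite IH; ring.
Qed.

Lemma unitary_count_ratio (R : realFieldType) (q : R) k r e : 2 <= q -> (0 < e)%N ->
  unitary_count q k (k + r + e) * ((1 - q^-1 ^+ 2) / (1 + q^-1 ^+ 3))
  <= unitary_count q k (k + r) * q ^+ (2 * k * e).
Proof.
move=> q2 e0; have x01 := inv_ge2 q2; have [x0 x1] := andP x01.
have := unitary_count_prod k r e q2.
have /= := prod_alt_factor_bounds k r (inv_ge2_half q2).
have /= := prod_alt_factor_bounds k (r + e) (inv_ge2_half q2).
set A := \prod_(i < k) _; set B := \prod_(i < k) _.
set x := q^-1 in x0 x1 *.
have xle i j : (i <= j)%N -> x ^+ j <= x ^+ i.
  by move=> ij; rewrite ler_wiXn2l // ltW.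
have xpos i : 0 < x ^+ i by rewrite exprn_gt0.
have x2 : 0 < 1 - x ^+ 2 by rewrite subr_gt0 exprn_ilt1 // ltW.
move=> hA hB e1.
(* The product [A] exceeds 1 only for even [r + e]; as [e > 0], then [r + e >= 2], so the excess is
   at most [x ^+ 3]. Likewise [B] drops below 1 only for odd [r], with worst case [r = 1]. *)
have A1 : A <= 1 + x ^+ 3.
  move: hA; case: (boolP (odd _)) => [_ /andP[_ ?]|re /andP[_ hA]].
    by have := xpos 3; lra.
  apply: le_trans hA _; rewrite lerD2l xle //.
  by move: re; case: e e0 {e1 A} => // e _; case: (r + _)%N (addnS r e) => [|[|]].
have A0 : 0 < A.
  apply: prodr_gt0 => i _; apply: alt_factor_gt0 => //.
have B1 : 1 - x ^+ 2 <= B.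
  move: hB; case: (boolP (odd _)) => [ro /andP[hB _]|_ /andP[? _]].
    by apply: le_trans hB; rewrite lerD2l lerN2 xle //; case: (r) ro.
  by have := xpos 2; lra.
have c0 : 0 < unitary_count q k (k + r + e) by apply: unitary_count_gt0 => //; lia.
rewrite -(ler_pM2r A0) e1 -mulrA ler_pM2l //.
rewrite mulrAC ler_pdivrMr; last by have := xpos 3; lra.
have : 0 < B by lra.
by move=> B0; have := xpos 3; nra.
Qed.

(** The right-hand side equals [1 - c / q] with [c = 1 + 2 (q - 1) / (q ^+ 2 - q + 1)]. This is
    largest at [q = 2], where it is [5 / 3], slightly below [43 / 25]. *)
Lemma unitary_bound (R : realFieldType) (q : R) : 2 <= q ->
  1 - (43 / 25) / q <= (1 - (q + 1) / q ^+ 2) * ((1 - q^-1 ^+ 2) / (1 + q^-1 ^+ 3)).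
Proof.
move=> q2; have q0 : q != 0 by lra.
have d0 : 0 < q ^+ 2 - q + 1 by nra.
have -> : (1 - (q + 1) / q ^+ 2) * ((1 - q^-1 ^+ 2) / (1 + q^-1 ^+ 3)) =
   (q ^+ 2 - q - 1) * (q - 1) / (q * (q ^+ 2 - q + 1)).
  by field; rewrite q0 /=; nra.
rewrite ler_pdivlMr; last by rewrite mulr_gt0 //; lra.
have -> : (1 - 43 / 25 / q) * (q * (q ^+ 2 - q + 1)) = (q - 43 / 25) * (q ^+ 2 - q + 1).
  by field.
by nra.
Qed.

(** Here [a] and [b] stand for [(- q^-1)] raised to the two dimensions, so each is either [- x] or
    at most [x ^+ 2] in size. Equality holds at [a = b = - x], that is, for two lines. If [a = - x],
    the left-hand side collapses to [(1 - x ^+ 2) * (1 - b)]. *)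
Lemma unitary_expectation (R : realFieldType) (x q a b : R) : q * x = 1 -> 0 < x <= 1 / 2 ->
  a = - x \/ `|a| <= x ^+ 2 -> b = - x \/ `|b| <= x ^+ 2 ->
  (1 - a) * (1 - b) * (1 + a + b + q * a * b) <= (1 + x) * (1 - x ^+ 2).
Proof.
move=> qx /andP[x0 x2].
(* The expression is symmetric, so if one of the two numbers is [- x], that one may be taken to be
   [a]. *)
wlog : a b / b = - x -> a = - x.
  move=> H ha hb; have [ea|na] := eqVneq a (- x); first exact: H.
  have [eb|nb] := eqVneq b (- x); last by apply: H => // eb; rewrite eb eqxx in nb.
  have := H b a (fun _ => eb) hb ha; congr (_ <= _); ring.
have bound c : c = - x \/ `|c| <= x ^+ 2 -> - x <= c <= x ^+ 2.
  have xx : x ^+ 2 <= x by nra.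
  by rewrite real_ler_norml ?num_real //; case=> [->|/andP[? ?]]; apply/andP; split; nra.
move=> H ha hb; have := bound b hb; have := bound a ha.
case: ha => [ea _|ha _].
  move=> /andP[b1 b2]; rewrite ea.
  have -> : (1 - - x) * (1 - b) * (1 + - x + b + q * - x * b) = (1 - x ^+ 2) * (1 - b).
    by transitivity ((1 + x) * (1 - b) * (1 - x + b - (q * x) * b)); [ring|rewrite qx; ring].
  by rewrite mulrC ler_pM2r; [lra|nra].
case: hb => [/H ea|hb _].
  by exfalso; move: ha; rewrite ea normrN gtr0_norm //; nra.
set y := x ^+ 2 in ha hb; have y0 : 0 < y by rewrite /y exprn_gt0.
move: ha hb; rewrite !real_ler_norml ?num_real // => /andP[a1 a2] /andP[b1 b2].
have q0 : 2 <= q by nra.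
have e1 : (1 - a) * (1 - b) * (1 + a + b + q * a * b) =
   1 - a ^+ 2 - b ^+ 2 + (q - 1) * (a * b) * (1 - a - b) + q * (a * b) ^+ 2 by ring.
have xy : x * y <= y / 2 by nra.
have yx : y <= x / 2 by rewrite /y; nra.
have qy : q * y = x by rewrite /y expr2 mulrA qx mul1r.
apply: (@le_trans _ _ (1 + x - y - x * y)); last by rewrite le_eqVlt; apply/orP; left; apply/eqP; rewrite /y; ring.
have ab : 0 <= 1 - a - b <= 1 + 2 * y by apply/andP; split; lra.
have [/andP[ab0 ab1] sq] := (ab, sqr_ge0 (a - b)).
rewrite e1; set p := a * b; set s := q * p.
(* Both numbers are now at most [y] in size. A nonpositive product makes the cross term harmless;
   for a positive one, [s = q * p] is at most [x * y] because [q * y = x]. *)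
have [p0|p0] := leP p 0.
  have : (q - 1) * p * (1 - a - b) <= 0 by apply: mulr_le0_ge0 => //; nra.
  have b2y : b ^+ 2 <= y by nra.
  have : q * p ^+ 2 <= a ^+ 2.
    have -> : q * p ^+ 2 = (q * b ^+ 2) * a ^+ 2 by rewrite /p; ring.
    by apply: ler_piMl; [exact: sqr_ge0|nra].
  by have := sqr_ge0 b; lra.
have sqE : 2 * p <= a ^+ 2 + b ^+ 2 by rewrite /p; nra.
have s0 : 0 < s by rewrite /s; nra.
have ps : p = x * s by rewrite /s mulrA [x * q]mulrC qx mul1r.
have p1 : p <= y * y by rewrite /p; nra.
have s1 : s <= x * y by rewrite -qy -mulrA ler_pM2l //; lra.
have -> : (q - 1) * p = s - p by rewrite /s; ring.
have -> : q * p ^+ 2 = s * p by rewrite /s; ring.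
have t1 : (s - p) * (1 - a - b) <= (s - p) * (1 + 2 * y).
  by rewrite ler_wpM2l // subr_ge0 ps; nra.
suff : 1 - 2 * p + (s - p) * (1 + 2 * y) + s * p <= 1 + x - y - x * y by lra.
have -> : 1 - 2 * p + (s - p) * (1 + 2 * y) + s * p = 1 + s * (1 + 2 * y - 3 * x - 2 * x * y + x * s).
  by rewrite {1 2 3}ps; ring.
have t2 : 1 + 2 * y - 3 * x - 2 * x * y + x * s <= 1 - 2 * x by nra.
have t3 : s * (1 + 2 * y - 3 * x - 2 * x * y + x * s) <= s * (1 - 2 * x) by rewrite ler_pM2l.
have t4 : s * (1 - 2 * x) <= x * y * (1 - 2 * x) by rewrite ler_wpM2r //; lra.
by nra.
Qed.

Lemma card_roots_le (F : finFieldType) (p : {poly F}) (A : {set F}) : p != 0 ->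
  (forall x, x \in A -> root p x) -> (#|A| < size p)%N.
Proof.
move=> p0 rA; rewrite cardE; apply: max_poly_roots => //; last exact: enum_uniq.
by apply/allP => x; rewrite mem_enum => /rA.
Qed.

(** * Vectors of given norm and nondegenerate subspaces in hermitian spaces *)

Section UnitaryCounts.
Variables (F : finFieldType) (d q : nat).
Local Notation V := 'rV[F]_d.
Variables (theta : {rmorphism F -> F}).
Variable f : {hermitian V for false & theta}.
Hypotheses (cardF : #|F| = (q ^ 2)%N) (q2 : (2 <= q)%N).
Hypothesis thetaE : forall x : F, theta x = x ^+ q.
Implicit Types (U W X Y L : {vspace V}) (u v w : V).
Local Notation "U ^_" := (orthov f U) (at level 2, format "U ^_").
Local Notation nd := (nondegenerate_on f).
Local Notation qr := (q%:R : rat).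

Lemma thetaK x : theta (theta x) = x.
Proof. by rewrite !thetaE -exprM mulnn -cardF expf_card. Qed.

Lemma theta_norm u : theta (f u u) = f u u.
Proof. by rewrite [RHS]fC expr0 mul1r. Qed.

(** Counting roots, every fiber of the norm has at most [q + 1] elements and there are at most
    [q - 1] nonzero fixed scalars. The fibers cover all [(q - 1) (q + 1)] nonzero scalars, so both
    bounds are attained. *)
Lemma card_norm_fiber (c : F) : c != 0 -> theta c = c ->
  #|[set t | t * theta t == c]| = q.+1.
Proof.
pose fib (c : F) := [set t | t * theta t == c].
pose S := [set c : F | (c != 0) && (theta c == c)].
have fib_le c' : c' != 0 -> (#|fib c'| <= q.+1)%N.
  move=> c0; have sz : size ('X^(q.+1) - c'%:P) = q.+2 by rewrite size_XnsubC.
  rewrite -ltnS -sz; apply: card_roots_le; first by rewrite -size_poly_eq0 sz.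
  by move=> t; rewrite inE thetaE -exprS rootE !hornerE subr_eq0.
have S_le : (#|S| <= q.-1)%N.
  have sz : size ('X^(q.-1) - 1%:P : {poly F}) = q.-1.+1 by rewrite size_XnsubC //; lia.
  rewrite -ltnS -sz; apply: card_roots_le; first by rewrite -size_poly_eq0 sz.
  move=> t; rewrite inE thetaE => /andP[t0 /eqP tq].
  rewrite rootE !hornerE subr_eq0 -(inj_eq (mulfI t0)) -exprS mulr1 prednK ?tq //; lia.
have tot : (\sum_(c in S) #|fib c| = q.-1 * q.+1)%N.
  have <- : #|[set t : F | t != 0]| = (q.-1 * q.+1)%N.
    have := cardsC1 (0 : F); rewrite cardF => e; transitivity ((q ^ 2)%N.-1); last nia.
    by rewrite -e; apply: eq_card => t; rewrite !inE.
  rewrite -[RHS]sum1_card [RHS](partition_big (fun t => t * theta t) (mem S)) /=; last first.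
    move=> t; rewrite !inE => t0; rewrite mulf_neq0 ?fmorph_eq0 //.
    by rewrite rmorphM /= thetaK mulrC.
  apply: eq_bigr => c' cS; rewrite -sum1_card; apply: eq_bigl => t; rewrite !inE.
  have [->|t0] := eqVneq t 0; last by rewrite andTb.
  rewrite mul0r; apply/negbTE; move: cS; rewrite inE eq_sym; by case/andP.
move=> c0 cfix; have cS : c \in S by rewrite inE c0 cfix eqxx.
apply/eqP; rewrite eqn_leq fib_le //=.
rewrite leqNgt; apply/negP => lt; move: tot; rewrite (bigD1 c) //=.
have : (\sum_(i in S | i != c) #|fib i| <= #|S :\ c| * q.+1)%N.
  rewrite -sum_nat_const [X in (_ <= X)%N](eq_bigl (fun i => (i \in S) && (i != c))).
    by apply: leq_sum => i /andP[]; rewrite inE => /andP[i0 _] _; exact: fib_le.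
  by move=> i; rewrite in_setD1 andbC.
have : (1 + #|S :\ c| <= q.-1)%N by move: S_le; rewrite (cardsD1 c) cS.
have : (#|fib c| < q.+1)%N by [].
by move: (\sum_(i in S | _) _)%N #|S :\ c| #|fib c| => r s t; nia.
Qed.

Lemma exists_nonisotropic X : nd X -> X != 0%VS -> exists2 v, v \in X & f v v != 0.
Proof.
move=> ndX X0; case: (pickP (fun v => (v \in X) && (f v v != 0))) => [v /andP[]|H].
  by exists v.
have iso v : v \in X -> f v v = 0 by move=> vX; have := H v; rewrite vX => /negbFE/eqP.
case/eqP: X0; apply/eqP; rewrite -subv0; apply/subvP => u uX; rewrite memv0.
apply/eqP/(nd_eq0 ndX uX) => v vX; apply/eqP/negPn/negP => fuv.
(* Isotropy of [a *: u + v], with [a] chosen so that [f (a *: u) v = t], makes every [t] a root of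
   ['X^q + 'X]; that is [q ^ 2] roots in degree [q]. *)
have tr t : t + theta t = 0.
  pose a := t / f u v; have auX : a *: u \in X by rewrite memvZ.
  have := iso _ (memvD auX vX).
  rewrite fDl !fDr (iso _ auX) (iso _ vX) add0r addr0 [f v _]fC expr0 mul1r.
  by rewrite fZl mulfVK.
have : (#|[set: F]| < size ('X^q + 'X : {poly F})%R)%N.
  apply: card_roots_le => [|t _]; last by rewrite rootE !hornerE -thetaE addrC tr.
  by rewrite -size_poly_eq0 size_polyDl ?size_polyXn ?size_polyX.
rewrite cardsT cardF size_polyDl ?size_polyXn ?size_polyX //; nia.
Qed.

Lemma nd_line v : f v v != 0 -> nd <[v]>.
Proof.
move=> fvv; apply/ndP => _ /vlineP[a ->] /(_ v (memv_line v))/eqP.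
by rewrite fZl mulf_eq0 (negPf fvv) orbF => /eqP ->; rewrite scale0r.
Qed.

(** Unlike [norm_set] this keeps the zero vector, which gives the recursion along an orthogonal
    splitting its clean form. *)
Definition iso_set X c := [set x in X | f x x == c].

(** Write a vector of [X] as [t *: v + x] with [x] orthogonal to [v]. The norm of [t] is then
    prescribed: it is zero if [f x x = c], leaving only [t = 0], and nonzero and fixed by [theta]
    otherwise, leaving [q + 1] values. *)
Lemma iso_set_split X v c : nd X -> v \in X -> f v v != 0 -> theta c = c ->
  (#|iso_set X c| + q * #|iso_set (X :&: <[v]>^_) c| = q.+1 * #|F| ^ (\dim X).-1)%N.
Proof.
move=> ndX vX fvv thc; pose X' := (X :&: <[v]>^_)%VS.
have ndv := nd_line fvv; have vLX : (<[v]> <= X)%VS by rewrite -memvE.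
have dimX' : \dim X' = (\dim X).-1.
  have := dim_cap_orthov ndv vLX; rewrite dim_vline -/X'.
  by have -> : v != 0 by [apply: contraNneq fvv => ->; rewrite f0l]; move=> <-.
have fvX' x : x \in X' -> f x v = 0 /\ f v x = 0.
  rewrite memv_cap => /andP[_ /mem_orthovP/(_ v (memv_line v)) fxv].
  by split=> //; apply: form_eq0_sym.
pose h (p : F * V) := p.1 *: v + p.2.
have fh t x : x \in X' -> f (h (t, x)) (h (t, x)) = t * theta t * f v v + f x x.
  move=> /fvX'[fxv fvx]; rewrite /h /= fDl !fDr !fZl !fZr fxv fvx mulr0 addr0.
  by rewrite mulr0 add0r mulrA.
pose S := [set p : F * V | (p.2 \in X') && (f (h p) (h p) == c)].
have cardS : #|iso_set X c| = #|S|.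
  rewrite -(@card_in_imset _ _ h S) => [|[t x] [t' x']].
    apply: eq_card => w; rewrite !inE; apply/idP/imsetP => [/andP[wX fw]|[[t x]]].
      have [l /vlineP[t ->] wl] := orthov_decomp w ndv.
      have wE : w = h (t, w - t *: v) by rewrite /h /= addrC subrK.
      by exists (t, w - t *: v); rewrite // inE -wE fw memv_cap wl memvB // memvZ.
    rewrite inE /= => /andP[xX' fx] ->; rewrite fx andbT /h memvD ?memvZ //=.
    by move: xX'; rewrite memv_cap => /andP[].
  rewrite !inE /= => /andP[/fvX'[fxv _] _] /andP[/fvX'[fxv' _] _].
  move=> e; have := congr1 (fun u => f u v) e; rewrite /h /= !fDl !fZl fxv fxv' !addr0.
  by move=> /(mulIf fvv) et; move: e; rewrite /h et /= => /addrI ->.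
have -> : #|iso_set X c| = (\sum_(x in X') if f x x == c then 1 else q.+1)%N.
  rewrite cardS -sum1_card (partition_big (fun p => p.2) (mem X')) /=; last first.
    by move=> p; rewrite inE => /andP[].
  apply: eq_bigr => x xX'; rewrite sum1_card.
  pose T := [set t : F | t * theta t == (c - f x x) / f v v].
  have -> : #|[pred p | (p \in S) && (p.2 == x)]| = #|T|.
    rewrite -(@card_imset _ _ (fun t => (t, x)) T) => [|t t' [] //].
    apply: eq_card => -[t y]; rewrite !inE; apply/idP/imsetP => [/andP[/andP[_]]|[t']].
      move=> H /eqP /= yx; move: H; rewrite yx => H; exists t => //.
      by rewrite inE -(inj_eq (mulIf fvv)) divfK // eq_sym subr_eq -fh // eq_sym.
    rewrite inE -(inj_eq (mulIf fvv)) divfK // => H [-> ->] /=.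
    by rewrite xX' eqxx fh // andbT (eqP H) subrK eqxx.
  case: eqP => [fx|/eqP fx].
    apply/eqP/cards1P; exists 0; apply/setP => t; rewrite !inE fx subrr mul0r.
    by rewrite mulf_eq0 fmorph_eq0 orbb.
  apply: card_norm_fiber; first by rewrite mulf_neq0 ?invr_eq0 ?subr_eq0 // eq_sym.
  by rewrite rmorphM rmorphB fmorphV /= thc !theta_norm.
rewrite -dimX' -card_vspace_set -/X'.
have -> : #|iso_set X' c| = (\sum_(x in X') if f x x == c then 1 else 0)%N.
  rewrite -sum1_card big_mkcond [RHS]big_mkcond; apply: eq_bigr => x _.
  by rewrite inE; case: (x \in X').
rewrite big_distrr -big_split mulnC /=.
have -> : #|[set x | x \in X']| = #|X'| by rewrite cardsE.
by rewrite -sum_nat_const; apply: eq_bigr => x _; case: ifP; lia.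
Qed.

Lemma card_iso_set X c : nd X -> theta c = c ->
  qr * #|iso_set X c|%:R =
  (qr ^+ 2) ^+ \dim X + ((c == 0)%:R * qr - 1) * (- qr) ^+ \dim X.
Proof.
move=> + thc; have [n] := ubnP (\dim X); elim: n X => // n IH X /ltnSE dimX ndX.
have [X0|X0] := eqVneq X 0%VS.
  rewrite X0 dimv0 !expr0 mulr1.
  have -> : #|iso_set 0 c| = (c == 0).
    rewrite /iso_set; case: eqP => [->|c0].
      by apply/eqP/cards1P; exists 0; apply/setP => x; rewrite !inE memv0; case: eqP => // ->; rewrite f0l eqxx.
    apply/eqP; rewrite cards_eq0; apply/eqP/setP => x; rewrite !inE memv0.
    by case: eqP => // ->; rewrite f0l eq_sym; apply/eqP.
  by case: (c == 0); rewrite /= ?mul1r ?mul0r ?mulr0; ring.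
have [v vX fvv] := exists_nonisotropic ndX X0.
have ndv := nd_line fvv; have vLX : (<[v]> <= X)%VS by rewrite -memvE.
have v0 : v != 0 by apply: contraNneq fvv => ->; rewrite f0l.
have dimE : \dim X = (\dim (X :&: <[v]>^_)).+1.
  by have := dim_cap_orthov ndv vLX; rewrite dim_vline v0.
have ndX' : nd (X :&: <[v]>^_) by rewrite -nd_cap_orthov.
have := IH (X :&: <[v]>^_)%VS; rewrite -ltnS -dimE => /(_ dimX ndX') {}IH.
have := iso_set_split ndX vX fvv thc; rewrite dimE /= => /(congr1 (fun n : nat => n%:R : rat)).
rewrite natrD !natrM IH -natr1 cardF natrX natrX => /(canRL (addrK _)) ->.
rewrite (exprS (qr ^+ 2)) (exprS (- qr)).
move: ((qr ^+ 2) ^+ _) ((- qr) ^+ _) ((c == 0)%:R) => a b c'.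
by move: qr => r; ring.
Qed.

Lemma card_nonisotropic X : nd X ->
  qr * #|[set v | (f v v != 0%R) && (<[v]> <= X)%VS]|%:R = (qr - 1) * nonisotropic_count qr (\dim X).
Proof.
move=> ndX; have := card_iso_set ndX (rmorph0 theta); rewrite eqxx mul1r.
have := card_vspace_set X.
rewrite -(cardsID [set v | f v v == 0] [set x | x \in X]) cardF.
have -> : [set v | v \in X] :&: [set v | f v v == 0] = iso_set X 0.
  by apply/setP => v; rewrite !inE.
have -> : [set v | v \in X] :\: [set v | f v v == 0] = [set v | (f v v != 0) && (<[v]> <= X)%VS].
  by apply/setP => v; rewrite !inE -memvE.
move=> /(congr1 (fun n : nat => n%:R : rat)); rewrite natrD !natrX => e1 e2.
rewrite -[X in _ * X](addKr (#|iso_set X 0|%:R : rat)) e1 mulrDr mulrN e2 /nonisotropic_count.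
ring.
Qed.

Lemma card_nd_in_unitary k X : nd X ->
  #|nd_in f X k|%:R = unitary_count qr k (\dim X).
Proof.
have q2r : 2 <= qr by rewrite ler_nat.
elim: k X => [|k IH] X ndX; first by rewrite card_nd_in0.
have PL v : f v v != 0 -> nd <[v]> /\ \dim <[v]> = 1%N.
  move=> fvv; split; first exact: nd_line.
  by rewrite dim_vline; have -> : v != 0 by apply: contraNneq fvv => ->; rewrite f0l.
have := sum_card_flags X k PL; rewrite add1n.
move/(congr1 (fun n : nat => qr * n%:R)); rewrite !natr_sum !mulr_sumr.
rewrite (eq_bigr (fun=> (qr - 1) * nonisotropic_count qr k.+1)); last first.
  move=> U; rewrite inE => /and3P[ndU /eqP dimU _].
  by rewrite -dimU -card_nonisotropic.
rewrite [RHS](eq_bigr (fun=> qr * unitary_count qr k (\dim X).-1)); last first.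
  move=> t /andP[Pt LX]; have [ndL dimL] := PL _ Pt.
  rewrite IH -?nd_cap_orthov //; congr (_ * unitary_count _ _ _).
  by have := dim_cap_orthov ndL LX; rewrite dimL => <-.
rewrite !sumr_const -[RHS]mulr_natr [RHS]mulrAC.
have -> : qr * #|[pred v : V | (f v v != 0) && (<[v]> <= X)%VS]|%:R = (qr - 1) * nonisotropic_count qr (\dim X).
  by rewrite -card_nonisotropic //; congr (_ * _%:R); apply: eq_card => t; rewrite !inE.
rewrite -[(_ * nonisotropic_count _ _) *+ _]mulr_natr => eN.
have h0 : nonisotropic_count qr k.+1 != 0 by rewrite gt_eqF ?nonisotropic_count_gt0.
have h1 : qr - 1 != 0 by rewrite gt_eqF //; lra.
apply: (mulIf h0); apply: (mulfI h1).
change ((qr - 1) * (#|nd_in f X k.+1|%:R * nonisotropic_count qr k.+1) =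
  (qr - 1) * (nonisotropic_count qr (\dim X) / nonisotropic_count qr k.+1
     * unitary_count qr k (\dim X).-1 * nonisotropic_count qr k.+1)).
rewrite [#|_|%:R * _]mulrC mulrA eN -[LHS]mulrA; congr (_ * _).
by rewrite [RHS]mulrAC mulfVK.
Qed.

End UnitaryCounts.

(* [A0, n0] count the nonzero isotropic vectors in dimensions [k] and [e];
   [A1] counts the nonisotropic vectors in dimension [k] and [n1] the vectors of
   a given nonzero norm in dimension [e]. *)
Lemma unitary_expectation_counts (R : realFieldType) (q A0 A1 n0 n1 : R) e k :
  2 <= q -> (0 < e)%N -> (0 < k)%N ->
  q * (n0 + 1) = (q ^+ 2) ^+ e + (q - 1) * (- q) ^+ e ->
  q * n1 = (q ^+ 2) ^+ e - (- q) ^+ e ->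
  q * (A0 + 1) = (q ^+ 2) ^+ k + (q - 1) * (- q) ^+ k ->
  q * A1 = (q - 1) * nonisotropic_count q k ->
  A0 * n0 + A1 * n1 <= q ^+ (2 * (e + k)) / q * ((1 + q^-1) * (1 - q^-1 ^+ 2)).
Proof.
move=> q2 e0 k0; rewrite /nonisotropic_count.
have q0 : q != 0 by lra.
have qx : q * q^-1 = 1 by rewrite mulfV.
have Hx := inv_ge2_half q2; have [x0 x1] := andP Hx.
set x := q^-1 in qx x0 x1 Hx *.
pose a := (- x) ^+ e; pose b := (- x) ^+ k.
have aE (m : nat) : (- q) ^+ m = (q ^+ 2) ^+ m * (- x) ^+ m.
  by rewrite -exprMn; congr (_ ^+ _); rewrite mulrN expr2 -mulrA qx mulr1.
have a2 (m : nat) : (q ^+ 2) ^+ m * ((- x) ^+ m) ^+ 2 = 1.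
  have -> : ((- x) ^+ m) ^+ 2 = (x ^+ 2) ^+ m by rewrite exprAC sqrrN.
  by rewrite -!exprMn qx !expr1n.
have small (m : nat) : (0 < m)%N -> (- x) ^+ m = - x \/ `|(- x) ^+ m| <= x ^+ 2.
  case: m => [//|[|m]] _; [by left|right].
  by rewrite normrX normrN gtr0_norm // ler_wiXn2l //; lra.
have := unitary_expectation qx Hx (small e e0) (small k k0).
have := a2 e; have := a2 k; rewrite !aE mulnDr exprD !(exprM q 2).
set y := (q ^+ 2) ^+ e; set z := (q ^+ 2) ^+ k; rewrite -/a -/b => zb ya H e1 e2 e3 e4.
have y0 : 0 < y by rewrite !exprn_gt0 //; lra.
have z0 : 0 < z by rewrite !exprn_gt0 //; lra.
have {}e1 : q * n0 = y * ((1 - a) * (1 + q * a)).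
  transitivity (q * (n0 + 1) - q * (y * a ^+ 2)); first by rewrite ya; ring.
  by rewrite e1; ring.
have {}e2 : q * n1 = y * (1 - a) by rewrite e2; ring.
have {}e3 : q * A0 = z * ((1 - b) * (1 + q * b)).
  transitivity (q * (A0 + 1) - q * (z * b ^+ 2)); first by rewrite zb; ring.
  by rewrite e3; ring.
have {}e4 : q * A1 = (q - 1) * (z * (1 - b)) by rewrite e4; ring.
rewrite -(ler_pM2l (_ : 0 < q ^+ 2)); last by rewrite exprn_gt0 //; lra.
have -> : q ^+ 2 * (A0 * n0 + A1 * n1) = (q * A0) * (q * n0) + (q * A1) * (q * n1) by ring.
rewrite e1 e2 e3 e4.
have -> : z * ((1 - b) * (1 + q * b)) * (y * ((1 - a) * (1 + q * a))) +
   (q - 1) * (z * (1 - b)) * (y * (1 - a)) =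
   (y * z * q) * ((1 - a) * (1 - b) * (1 + a + b + q * a * b)) by ring.
have -> : q ^+ 2 * (y * z / q * ((1 + x) * (1 - x ^+ 2))) =
  (y * z * q) * ((1 + x) * (1 - x ^+ 2)) by field.
by rewrite ler_pM2l // !mulr_gt0 //; lra.
Qed.

Lemma unitary_final_bound (R : realFieldType) (r T N N' G : R) e e' :
  2 <= r -> (0 < e)%N -> (0 < e')%N -> 0 < N -> 0 < N' ->
  T <= r ^+ (2 * (e + e')) / r * ((1 + r^-1) * (1 - r^-1 ^+ 2)) ->
  N' * ((1 - r^-1 ^+ 2) / (1 + r^-1 ^+ 3)) <= N * (r ^+ 2) ^+ (e' * e) ->
  N * ((r ^+ 2 - 1) * (r ^+ 2) ^+ (e' * e)) <=
    (r ^+ 2 - 1) * G + N * (T * ((r ^+ 2) ^+ e.-1) ^+ e'.-1) ->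
  (1 - (43 / 25) / r) * N' <= G.
Proof.
move=> r2 e0 e'0 N0 N'0 T_le ratio H; have bound := unitary_bound r2.
have r0 : r != 0 by lra.
have D0 : 0 < r ^+ 2 - 1 by nra.
set P := (r ^+ 2) ^+ (e' * e) in H ratio.
have P0 : 0 < P by rewrite !exprn_gt0 //; lra.
have lost : T * ((r ^+ 2) ^+ e.-1) ^+ e'.-1 <= P * ((r ^+ 2 - 1) * ((r + 1) / r ^+ 2)).
  (* Again the exponents combine: [(e + e') + (e - 1) (e' - 1) = e' e + 1], here as powers of
     [r ^+ 2]. *)
  have -> : P * ((r ^+ 2 - 1) * ((r + 1) / r ^+ 2)) =
      r ^+ (2 * (e + e')) / r * ((1 + r^-1) * (1 - r^-1 ^+ 2)) * ((r ^+ 2) ^+ e.-1) ^+ e'.-1.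
    have -> : r ^+ (2 * (e + e')) / r * ((1 + r^-1) * (1 - r^-1 ^+ 2)) * ((r ^+ 2) ^+ e.-1) ^+ e'.-1 =
      (r ^+ (2 * (e + e')) * ((r ^+ 2) ^+ e.-1) ^+ e'.-1) / r * ((1 + r^-1) * (1 - r^-1 ^+ 2)) by ring.
    have -> : r ^+ (2 * (e + e')) * ((r ^+ 2) ^+ e.-1) ^+ e'.-1 = P * r ^+ 2.
      by rewrite /P -!exprM -!exprD; congr (_ ^+ _); nia.
    by field.
  by rewrite ler_wpM2r // !exprn_ge0 //; lra.
have {}H : N * P * (1 - (r + 1) / r ^+ 2) <= G.
  rewrite -(ler_pM2l D0).
  have -> : (r ^+ 2 - 1) * (N * P * (1 - (r + 1) / r ^+ 2)) =
    N * ((r ^+ 2 - 1) * P) - N * (P * ((r ^+ 2 - 1) * ((r + 1) / r ^+ 2))) by ring.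
  by rewrite lerBlDr; apply: le_trans H _; rewrite lerD2l ler_pM2l.
apply: le_trans H.
apply: (@le_trans _ _ (N' * ((1 - r^-1 ^+ 2) / (1 + r^-1 ^+ 3)) * (1 - (r + 1) / r ^+ 2))).
  by rewrite [X in X <= _]mulrC -[X in _ <= X]mulrA ler_pM2l // [X in _ <= X]mulrC.
rewrite ler_pM2r // subr_gt0 ltr_pdivrMr ?exprn_gt0; nra.
Qed.

Section UnitaryCase.
Variables (F : finFieldType) (d q : nat).
Local Notation V := 'rV[F]_d.
Variables (theta : {rmorphism F -> F}).
Variable f : {hermitian V for false & theta}.
Hypotheses (cardF : #|F| = (q ^ 2)%N) (q2 : (2 <= q)%N).
Hypothesis thetaE : forall x : F, theta x = x ^+ q.
Implicit Types (U W X Y L : {vspace V}) (u v w : V).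
Local Notation "U ^_" := (orthov f U) (at level 2, format "U ^_").
Local Notation nd := (nondegenerate_on f).
Local Notation qr := (q%:R : rat).

Lemma card_norm_set U c : #|norm_set f U c|%:R = #|iso_set f U c|%:R - (c == 0)%:R :> rat.
Proof.
rewrite (cardsD1 0 (iso_set f U c)) inE mem0v f0l [0 == c]eq_sym natrD [RHS]addrC addKr.
by congr (_%:R); apply: eq_card => u; rewrite !inE andbCA.
Qed.

Lemma sum_norm_sets U W : nd U -> nd W -> U != 0%VS -> W != 0%VS ->
  (\sum_(w in W | w != 0%R) #|norm_set f U (- f w w)%R|)%:R
  <= qr ^+ (2 * (\dim U + \dim W)) / qr * ((1 + qr^-1) * (1 - qr^-1 ^+ 2)).
Proof.
move=> ndU ndW U0 W0.
have qr2 : 2 <= qr by rewrite ler_nat.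
have qr0 : qr != 0 by lra.
have fixN w : theta (- f w w) = - f w w by rewrite rmorphN /= theta_norm.
pose n1 : rat := ((qr ^+ 2) ^+ \dim U - (- qr) ^+ \dim U) / qr.
have n1E c : c != 0 -> theta c = c -> #|norm_set f U c|%:R = n1.
  move=> c0 thc; apply: (mulfI qr0); rewrite card_norm_set (negPf c0) subr0.
  rewrite (card_iso_set cardF q2 thetaE ndU thc) (negPf c0) mul0r sub0r mulN1r.
  by rewrite /n1 mulrCA mulfV // mulr1.
have isoE X : nd X -> qr * (#|norm_set f X 0|%:R + 1) =
    (qr ^+ 2) ^+ \dim X + (qr - 1) * (- qr) ^+ \dim X.
  move=> ndX; rewrite card_norm_set eqxx subrK.
  by rewrite (card_iso_set cardF q2 thetaE ndX (rmorph0 theta)) eqxx mul1r.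
have -> : (\sum_(w in W | w != 0%R) #|norm_set f U (- f w w)%R|)%:R =
    #|norm_set f W 0|%:R * #|norm_set f U 0|%:R +
    #|[set v | (f v v != 0%R) && (<[v]> <= W)%VS]|%:R * n1.
  rewrite natr_sum (bigID (fun w => f w w == 0)) /=; congr (_ + _).
    rewrite (eq_bigr (fun=> #|norm_set f U 0|%:R)); last first.
      by move=> w /andP[_ /eqP ->]; rewrite oppr0.
    rewrite sumr_const -[LHS]mulr_natl; congr (_%:R * _); apply: eq_card => w.
    by rewrite !inE andbA.
  rewrite (eq_bigr (fun=> n1)); last first.
    by move=> w /andP[_ fw]; rewrite n1E // oppr_eq0.
  rewrite sumr_const -[LHS]mulr_natl; congr (_%:R * _); apply: eq_card => w.
  rewrite -topredE /= !inE -memvE; case: (w \in W); rewrite ?andbF //= andbT.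
  by have [->|//] := eqVneq w 0; rewrite f0l eqxx.
apply: unitary_expectation_counts; rewrite ?isoE ?card_nonisotropic ?lt0n ?dimv_eq0 //.
by rewrite /n1 mulrCA mulfV // mulr1.
Qed.

Lemma unitary_case (e e' : nat) : nondegenerate f ->
  (0 < e)%N -> (0 < e')%N -> (e + e' <= d)%N ->
  1 - (43 / 25) / qr <= nondeg_sum_proportion f (nondeg_subspaces f e) (nondeg_subspaces f e').
Proof.
rewrite -ndfE => ndV e0 e'0 le_d.
have dimV : \dim {:V} = d by rewrite dimvf /dim /= mul1n.
have qr2 : 2 <= qr by rewrite ler_nat.
have cardN k : #|nondeg_subspaces f k|%:R = unitary_count qr k d.
  by rewrite -nd_in_fullv (card_nd_in_unitary cardF q2 thetaE) // dimV.
have N_gt0 k : (k <= d)%N -> (0 < #|nondeg_subspaces f k|)%N.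
  by move=> kd; rewrite -(ltr_nat rat) cardN // unitary_count_gt0.
apply: nondeg_sum_proportion_ge; [apply: N_gt0 => //; lia ..|].
move=> U; rewrite inE => /andP[ndU /eqP dimU].
have dimUp : \dim U^_ = (d - e)%N.
  by have := dim_cap_orthov ndU (subvf U); rewrite capfv dimU dimV => H; rewrite -(addKn e (\dim U^_)) H.
have ndUp : nd U^_ by have := nd_cap_orthov ndU (subvf U); rewrite capfv ndV.
rewrite -/(nondeg_partners f U e').
have Q1 : (1 < #|F|)%N by exact: finNzRing_gt1.
have Q0 : (0 < #|F|)%N by exact: ltnW.
pose B := qr ^+ (2 * (e + e')) / qr * ((1 + qr^-1) * (1 - qr^-1 ^+ 2)).
have /andP[x0 x1] := inv_ge2_half qr2.
have B0 : 0 <= B.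
  by rewrite /B !mulr_ge0 ?exprn_ge0 ?invr_ge0 // ?subr_ge0 ?exprn_ile1 //; lra.
have : (#|nd_in f U^_ e'| * ((#|F| - 1) * #|F| ^ (e' * e)) <=
    (#|F| - 1) * #|nondeg_partners f U e'| +
    #|nd_in f U^_ e'| * (Num.truncn B * (#|F| ^ e.-1) ^ e'.-1))%N.
  (* The graph inequality lives in [nat]; the sum over [W] is an integer, so the rational bound [B]
     may be truncated, and [Num.truncn B <= B] gives it back after the cast. *)
  have H := @leq_card_nondeg_partners _ _ _ _ f U ndU e' (#|F| - 1)%N (Num.truncn B).
  rewrite -dimU; apply: H => [W A|W]; rewrite inE => /and3P[ndW /eqP dimW WU].
    rewrite nd_limg_eq0 => rad0; rewrite card_radical_coords // -subn1 leq_sub2r //.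
    by rewrite -[X in (X <= _)%N]expn1 leq_exp2l // lt0n.
  rewrite truncn_ge_nat // /B -dimU -dimW; apply: sum_norm_sets => //.
    by rewrite -dimv_eq0 dimU -lt0n.
  by rewrite -dimv_eq0 dimW -lt0n.
rewrite -(ler_nat rat) natrD !natrM.
have -> : #|nd_in f U^_ e'|%:R = unitary_count qr e' (d - e) :> rat.
  by rewrite (card_nd_in_unitary cardF q2 thetaE) // dimUp.
have eF : #|F|%:R = qr ^+ 2 :> rat by rewrite cardF natrX.
have eF1 : (#|F| - 1)%:R = qr ^+ 2 - 1 :> rat by rewrite natrB // eF.
rewrite eF1 cardN !natrX eF.
set N : rat := unitary_count _ _ (d - e); set N' : rat := unitary_count _ _ d.
have := unitary_count_ratio e' (d - e - e') qr2 e0.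
have -> : (e' + (d - e - e') + e = d)%N by lia.
have -> : (e' + (d - e - e') = d - e)%N by lia.
have T_le : (Num.truncn B)%:R <= B by rewrite truncn_le.
rewrite -/N -/N'; set G : rat := #|_|%:R.
have N'0 : 0 < N' by apply: unitary_count_gt0 => //; lia.
have N0 : 0 < N by apply: unitary_count_gt0 => //; lia.
rewrite -mulnA exprM => ratio H; apply: (unitary_final_bound qr2 e0 e'0 N0 N'0 T_le) => //.
Qed.

End UnitaryCase.

(** * Witt's theorem and the first moment for quadratic forms *)

Section Witt.
Variables (F : finFieldType) (d : nat).
Local Notation V := 'rV[F]_d.
Variable Q : quadraticForm V.
Local Notation f := (polar_form Q).
Implicit Types (U W X Y L : {vspace V}) (u v w x y z : V).
Local Notation "U ^_" := (orthov f U) (at level 2, format "U ^_").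
Local Notation nd := (nondegenerate_on f).

Lemma QD u v : Q (u + v) = Q u + Q v + f u v.
Proof. by rewrite /polar_form /= /polar; ring. Qed.

Lemma QZ a u : Q (a *: u) = a ^+ 2 * Q u. Proof. exact: quadraticZ. Qed.

Lemma Q0 : Q 0 = 0. Proof. by rewrite -(scale0r 0) QZ expr0n mul0r. Qed.

Lemma pZl a u v : f (a *: u) v = a * f u v. Proof. exact: fZl. Qed.
Lemma pZr a u v : f u (a *: v) = a * f u v. Proof. exact: fZr. Qed.
Lemma pC u v : f u v = f v u.
Proof. by rewrite fC expr0 mul1r. Qed.

Lemma QN u : Q (- u) = Q u.
Proof. by rewrite -scaleN1r QZ sqrrN expr1n mul1r. Qed.

Lemma QB u v : Q (u - v) = Q u + Q v - f u v.
Proof. by rewrite QD QN fNr. Qed.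

Lemma polarE u : f u u = Q u + Q u.
Proof.
have := QB u u; rewrite subrr Q0 => /esym/eqP; rewrite subr_eq0 => /eqP ->; by [].
Qed.

Definition isometry_of (g : 'End(V)) := forall u, Q (g u) = Q u.

Lemma isometry_polar g u v : isometry_of g -> f (g u) (g v) = f u v.
Proof. by move=> Qg; have := Qg (u + v); rewrite linearD !QD !Qg => /addrI. Qed.

Lemma isometry_comp g h : isometry_of g -> isometry_of h -> isometry_of (g \o h)%VF.
Proof. by move=> Qg Qh u; rewrite comp_lfunE Qg Qh. Qed.

Definition reflection_fun w x := x - (f x w / Q w) *: w.

Fact reflection_is_linear w : linear (reflection_fun w).
Proof.
move=> a u v; rewrite /reflection_fun fDl pZl mulrDl scalerDl opprD addrACA.
by rewrite scalerBr scalerA mulrA.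
Qed.

HB.instance Definition _ w :=
  GRing.isLinear.Build F V V _ (reflection_fun w) (reflection_is_linear w).

Definition reflection w : 'End(V) := linfun (reflection_fun w).

Lemma reflectionE w x : reflection w x = x - (f x w / Q w) *: w.
Proof. by rewrite lfunE. Qed.

Lemma isometry_reflection w : Q w != 0 -> isometry_of (reflection w).
Proof.
move=> w0 x; rewrite reflectionE QB QZ pZr [f x w / _ * _]mulrC.
by field.
Qed.

Lemma reflection_fixes w z : f z w = 0 -> reflection w z = z.
Proof. by move=> fzw; rewrite reflectionE fzw mul0r scale0r subr0. Qed.

(** If [Q u = Q v], then [f u (u - v) = Q (u - v)]. The formula does not divide by 2, so it serves
    every characteristic. *)
Lemma reflection_swap u v : Q u = Q v -> Q (u - v) != 0 -> reflection (u - v) u = v.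
Proof.
move=> Quv w0; rewrite reflectionE.
have -> : f u (u - v) = Q (u - v) by rewrite fBr polarE QB Quv.
by rewrite divff // scale1r opprB addrC subrK.
Qed.

(** Two proper subspaces do not cover [X]: if [z] and [z'] each miss one condition, their sum meets
    both. *)
Lemma exists_form_neq0 X x x' : x \notin X^_ -> x' \notin X^_ ->
  exists z, [/\ z \in X, f x z != 0 & f x' z != 0].
Proof.
case/mem_orthovPn => z zX fxz; case/mem_orthovPn => z' z'X fx'z'.
have [fx'z|] := eqVneq (f x' z) 0; last by exists z.
have [fxz'|] := eqVneq (f x z') 0; last by exists z'.
by exists (z + z'); rewrite memvD // !fDr fx'z fxz' addr0 add0r.
Qed.

(* Two vectors of the same value are swapped by a reflection unless their
   difference is singular; in that case a reflection in [w] first moves one of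
   them to a better position. *)
Lemma witt_vectors X x x' : (2 < #|F|)%N -> x \in X -> x' \in X ->
  x \notin X^_ -> x' \notin X^_ -> Q x = Q x' ->
  exists g : 'End(V), [/\ isometry_of g, g x = x' & {in X^_, forall z, g z = z}].
Proof.
move=> F3 xX x'X xXp x'Xp Qxx'.
have fix_refl w z : w \in X -> z \in X^_ -> reflection w z = z.
  by move=> wX /mem_orthovP/(_ w wX); exact: reflection_fixes.
have [Qd|Qd] := eqVneq (Q (x - x')) 0; last first.
  exists (reflection (x - x')); split; first exact: isometry_reflection.
    exact: reflection_swap.
  by move=> z; apply: fix_refl; rewrite memvB.
have fxx' : f x x' = f x x.
  by apply/esym/eqP; rewrite polarE -subr_eq0 {2}Qxx' -QB Qd.
(* Since [f x x' = f x x], the difference of the reflected vector and [x'] has value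
   [f x w * f w x' / Q w], so a nonsingular [w] orthogonal to neither vector is all that is
   required. *)
suff [w [wX w0 fxw fx'w]] : exists w, [/\ w \in X, Q w != 0, f x w != 0 & f x' w != 0].
  pose x2 := reflection w x; have Qx2 : Q x2 = Q x' by rewrite isometry_reflection.
  have Q2 : Q (x2 - x') != 0.
    rewrite QB Qx2 /x2 reflectionE fBl pZl fxx' polarE Qxx' opprB addrCA subrr addr0.
    by rewrite [f w x']pC !mulf_neq0 ?invr_neq0.
  exists (reflection (x2 - x') \o reflection w)%VF; split.
  - by apply: isometry_comp; apply: isometry_reflection.
  - by rewrite comp_lfunE reflection_swap.
  - move=> z zX; rewrite comp_lfunE !fix_refl // memvB // /x2 reflectionE.
    by rewrite memvB ?memvZ.
have [fxx|fxx] := eqVneq (f x x) 0; last first.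
  exists x; split; rewrite // ?[f x' x]pC ?fxx' //.
  by apply: contraNneq fxx => Qx; rewrite polarE Qx addr0.
have [z [zX fxz fx'z]] := exists_form_neq0 xXp x'Xp.
have [Qz|Qz] := eqVneq (Q z) 0; last by exists z.
(* For a singular [z], the value of [z + s *: x] is [s * (f x z + s * Q x)]. At most two scalars [s]
   are forbidden, so a third element of the field suffices. *)
have [s s0 Qs] : exists2 s, s != 0 & f x z + s * Q x != 0.
  pose B := [set 0; - f x z / Q x]; have : (0 < #|~: B|)%N.
    rewrite -(ltn_add2l #|B|) addn0 cardsC; apply: leq_ltn_trans F3.
    by rewrite cards2; case: (_ != _).
  case/card_gt0P => s; rewrite !inE negb_or => /andP[s0 sQ]; exists s => //.
  have [->|Qx] := eqVneq (Q x) 0; first by rewrite mulr0 addr0.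
  apply: contra sQ; rewrite addrC addr_eq0 => /eqP e.
  by rewrite -e mulfK.
exists (z + s *: x); split.
- by rewrite memvD ?memvZ.
- rewrite QD Qz QZ add0r pZr [f z x]pC.
  have -> : s ^+ 2 * Q x + s * f x z = s * (f x z + s * Q x) by ring.
  exact: mulf_neq0.
- by rewrite fDr pZr fxx mulr0 addr0.
- by rewrite fDr pZr [f x' x]pC fxx' fxx mulr0 addr0.
Qed.

End Witt.

(** * Transitivity on vectors and flags, and the averages that follow *)

Section Incidence.
Variables (F : finFieldType) (d : nat).
Local Notation V := 'rV[F]_d.
Variable Q : quadraticForm V.
Local Notation f := (polar_form Q).
Implicit Types (U W X Y L : {vspace V}) (u v w x y z : V).
Local Notation "U ^_" := (orthov f U) (at level 2, format "U ^_").
Local Notation nd := (nondegenerate_on f).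

Definition val_set X (c : F) := [set x in X | (x != 0) && (Q x == c)].

(** The pairs of the form [(u + y, y)] that witness a bad partner; on the pairs with fixed [c] the
    isometry group is transitive. *)
Definition flag_set (c : F) := [set p : V * V |
  [&& p.2 \in val_set fullv 0, p.1 \in <[p.2]>^_, p.1 \notin <[p.2]>%VS & Q p.1 == c]].

Hypotheses (ndV : nd fullv) (F3 : (2 < #|F|)%N).

Lemma orthov_orthov_line y z : y != 0 -> z \in (<[y]>^_)^_ -> z \in <[y]>%VS.
Proof.
move=> y0 zp; have /mem_orthovPn[v _ fyv] := nd_radical_notin ndV (memvf y) y0.
suff -> : z = (f v z / f v y) *: y by rewrite memvZ // memv_line.
have fvy : f v y != 0 by rewrite pC.
apply/eqP; rewrite -subr_eq0; apply/eqP/(nd_eq0 ndV (memvf _)) => u _.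
pose u' := u - (f u y / f v y) *: v.
have : f z u' = 0.
  move/mem_orthovP: zp; apply; rewrite mem_orthov1; apply/eqP.
  by rewrite /u' fBl pZl divfK ?subrr.
rewrite /u' fBr pZr => /eqP; rewrite subr_eq0 => /eqP fzu.
by rewrite fBl pZl fzu [f z v]pC [f y u]pC; field.
Qed.

Lemma isometry_lker g : isometry_of Q g -> lker g == 0%VS.
Proof.
move=> Qg; rewrite -subv0; apply/subvP => x; rewrite memv_ker memv0 => /eqP gx.
apply/eqP/(nd_eq0 ndV (memvf x)) => y _.
by rewrite -(isometry_polar x y Qg) gx f0l.
Qed.

Lemma isometry_inj (g : 'End(V)) : isometry_of Q g -> injective g.
Proof. by move=> Qg; apply/lker0P/isometry_lker. Qed.

Lemma isometry_orthov g U y : isometry_of Q g -> y \in U^_ -> g y \in (g @: U)^_.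
Proof.
move=> Qg /mem_orthovP yU; apply/mem_orthovP => _ /memv_imgP[u uU ->].
by rewrite isometry_polar // yU.
Qed.

(** Move [y] to [y'] first. Then move the image of [x] to [x'] inside the perp of [y'], by an
    isometry that fixes the perp of that space and hence [y']; the vectors are movable there because
    the radical of this space is only the line of [y']. *)
Lemma witt_flags x y x' y' : (x, y) \in flag_set (Q x) -> (x', y') \in flag_set (Q x) ->
  exists g : 'End(V), [/\ isometry_of Q g, g x = x' & g y = y'].
Proof.
rewrite !inE /= => /and4P[/and3P[_ y0 /eqP Qy] xy xNy _].
move=> /and4P[/and3P[_ y'0 /eqP Qy'] x'y' x'Ny' /eqP Qx'].
have notin v : v != 0 -> v \notin fullv^_ by exact: nd_radical_notin ndV (memvf v).
have Qyy' : Q y = Q y' by rewrite Qy Qy'.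
have [g [Qg gy _]] := witt_vectors F3 (memvf y) (memvf y') (notin _ y0) (notin _ y'0) Qyy'.
have gx : g x \in <[y']>^_.
  by rewrite mem_orthov1 -gy isometry_polar // -mem_orthov1.
have gxN : g x \notin <[y']>%VS.
  apply: contra xNy => /vlineP[a]; rewrite -gy -linearZ => /(isometry_inj Qg) ->.
  by rewrite memvZ ?memv_line.
have Ngx v : v \notin <[y']>%VS -> v \notin (<[y']>^_)^_.
  by apply: contra; exact: orthov_orthov_line.
have Qgx : Q (g x) = Q x' by rewrite Qg Qx'.
have [h [Qh hx hfix]] := witt_vectors F3 gx x'y' (Ngx _ gxN) (Ngx _ x'Ny') Qgx.
exists (h \o g)%VF; split; first exact: isometry_comp.
  by rewrite comp_lfunE.
rewrite comp_lfunE gy hfix //; apply/mem_orthovP => z.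
by rewrite mem_orthov1 pC => /eqP.
Qed.

Variable A : {set {vspace V}}.
Hypothesis A_isometry : forall g U, isometry_of Q g -> U \in A -> (g @: U)%VS \in A.
Hypothesis A_nd : forall U, U \in A -> nd U.

Definition num_containing x := #|[set U in A | x \in U]|.
Definition num_incident x y := #|[set U in A | (x \in U) && (y \in U^_)]|.

Lemma num_incident_isometry g x y : isometry_of Q g ->
  (num_incident x y <= num_incident (g x) (g y))%N.
Proof.
move=> Qg; have kg := isometry_lker Qg.
have inj : injective (fun U => g @: U)%VS.
  by move=> U U' /eqP; rewrite eq_limg_ker0 // => /eqP.
rewrite /num_incident -(card_imset _ inj); apply/subset_leq_card/subsetP => U1 /imsetP[U].
rewrite inE => /and3P[UA xU yU] ->; rewrite inE A_isometry // memv_img //.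
exact: isometry_orthov.
Qed.

Lemma num_containingE x : num_containing x = num_incident x 0.
Proof. by apply: eq_card => U; rewrite !inE mem0v andbT. Qed.

Lemma num_containing_mul x : x != 0 ->
  (num_containing x * #|val_set fullv (Q x)| = \sum_(U in A) #|val_set U (Q x)|)%N.
Proof.
move=> x0; rewrite mulnC -sum_nat_const.
have const x1 x2 : x1 \in val_set fullv (Q x) -> x2 \in val_set fullv (Q x) ->
    (num_containing x1 <= num_containing x2)%N.
  rewrite !inE => /and3P[_ x10 /eqP Q1] /and3P[_ x20 /eqP Q2].
  have notin v : v != 0 -> v \notin fullv^_ by exact: nd_radical_notin ndV (memvf v).
  have [|g [Qg gx _]] := witt_vectors F3 (memvf x1) (memvf x2) (notin _ x10) (notin _ x20).
    by rewrite Q1.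
  rewrite !num_containingE -gx; apply: leq_trans (num_incident_isometry _ _ Qg) _.
  by rewrite linear0.
have xV : x \in val_set fullv (Q x) by rewrite inE memvf x0 eqxx.
rewrite (eq_bigr num_containing); last first.
  by move=> x1 x1V; apply/eqP; rewrite eqn_leq !const.
rewrite (eq_bigr (fun x1 => \sum_(U in A) (x1 \in U : nat))%N); last first.
  move=> x1 _; rewrite /num_containing -sum1_card big_mkcond [RHS]big_mkcond.
  by apply: eq_bigr => U _; rewrite inE; case: (U \in A) => //=; case: ifP.
rewrite exchange_big; apply: eq_bigr => U _ /=.
rewrite -[RHS]sum1_card big_mkcond [RHS]big_mkcond; apply: eq_bigr => x1 _.
by rewrite !inE; case: (x1 \in U); rewrite ?memvf /= ?if_same.
Qed.

(** Count the incidences of flags and members of [A]. For nondegenerate [U], a nonzero vector of [U]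
    and a nonzero singular vector of [U^_] automatically form a flag, so each [U] contributes a
    product. *)
Lemma num_incident_mul x y : (x, y) \in flag_set (Q x) ->
  (num_incident x y * #|flag_set (Q x)| =
   \sum_(U in A) #|val_set U (Q x)| * #|val_set U^_ 0%R|)%N.
Proof.
move=> xyP; rewrite mulnC -sum_nat_const.
have const p1 p2 : p1 \in flag_set (Q x) -> p2 \in flag_set (Q x) ->
    (num_incident p1.1 p1.2 <= num_incident p2.1 p2.2)%N.
  case: p1 p2 => [x1 y1] [x2 y2] P1 P2; have Q1 : Q x1 = Q x.
    by move: P1; rewrite inE /= => /and4P[_ _ _ /eqP].
  rewrite -Q1 in P1 P2; have [g [Qg gx gy]] := witt_flags P1 P2.
  by rewrite -gx -gy num_incident_isometry.
rewrite (eq_bigr (fun p => num_incident p.1 p.2)); last first.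
  by move=> p pP; apply/eqP; rewrite eqn_leq (const (x, y) p) // (const p (x, y)).
rewrite (eq_bigr (fun p => \sum_(U in A) ((p.1 \in U) && (p.2 \in U^_) : nat))%N); last first.
  move=> p _; rewrite /num_incident -sum1_card big_mkcond [RHS]big_mkcond.
  by apply: eq_bigr => U _; rewrite inE; case: (U \in A) => //=; case: ifP.
rewrite exchange_big; apply: eq_bigr => U /A_nd ndU /=.
rewrite -cardsX -[RHS]sum1_card big_mkcond [RHS]big_mkcond; apply: eq_bigr => -[x1 y1] _.
rewrite !inE /= memvf; case x1U: (x1 \in U); last by rewrite if_same.
case y1U: (y1 \in U^_); last by rewrite if_same andbF.
rewrite /=; have [y0|y0] /= := eqVneq y1 0; first by rewrite andbF.
have [Qy|Qy] /= := eqVneq (Q y1) 0; last by rewrite andbF.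
rewrite mem_orthov1; have -> : f x1 y1 == 0.
  by move/mem_orthovP: y1U => /(_ _ x1U); rewrite pC => ->.
rewrite andbT /=; have [x10|x10] /= := eqVneq x1 0; first by rewrite x10 mem0v.
case: (boolP (x1 \in <[y1]>%VS)) => // x1y; case/negP: x10.
rewrite -memv0 -(eqP ndU) memv_cap x1U; move/vlineP: x1y => [a ->].
by rewrite memvZ.
Qed.

Section FirstMoment.
Variables (U : {vspace V}) (e' : nat).
Hypotheses (ndU : nd U) (U_even : ~~ odd (\dim U)) (e'_even : ~~ odd e').
Hypothesis A_dim : forall U', U' \in A -> \dim U' = e'.

Definition bad_partners :=
  [set U' in A | ~~ (((U :&: U')%VS == 0%VS) && nd (U + U'))].

(** If 2 is invertible, each radical vector is singular, since [f y y] is twice [Q y]. In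
    characteristic 2 the radical has at least [q ^ 2] vectors, so two of them share a value and
    their difference is singular. *)
Lemma exists_singular_radical X : nd X = false -> ~~ odd (\dim X) ->
  exists y, [/\ y != 0, Q y = 0 & y \in (X :&: X^_)%VS].
Proof.
move=> ndX X_even.
have R0 : (X :&: X^_)%VS != 0%VS by rewrite -[_ == _]/(nd X) ndX.
have [two0|two0] := eqVneq (1 + 1 : F) 0; last first.
  exists (vpick (X :&: X^_)); rewrite vpick0 R0 memv_pick; split=> //.
  have := memv_pick (X :&: X^_); rewrite memv_cap => /andP[yX /mem_orthovP/(_ _ yX)].
  rewrite polarE -[X in X + X]mul1r -mulrDl => /eqP; rewrite mulf_eq0 (negPf two0).
  by move/eqP.
have alt u : f u u = 0 by rewrite polarE -[X in X + X]mul1r -mulrDl two0 mul0r.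
have := odd_dim_radical_alternating alt X; rewrite (negPf X_even).
set R := (X :&: X^_)%VS in R0 *; move=> R_even.
have R2 : (1 < \dim R)%N.
  by move: R_even R0; rewrite -dimv_eq0; case: (\dim R) => [|[]].
have : ~~ [forall x in R, forall y in R, (Q x == Q y) ==> (x == y)].
  apply/negP => /forall_inP inj.
  have : (#|[set x | x \in R]| <= #|[set: F]|)%N.
    rewrite -(card_in_imset (f := Q) (D := mem [set x | x \in R])); last first.
      move=> x y; rewrite !inE => xR yR Qxy.
      by have /forall_inP/(_ y yR) := inj x xR; rewrite Qxy eqxx => /eqP.
    exact/subset_leq_card/subsetT.
  rewrite card_vspace_set cardsT leqNgt => /negP; apply.
  by rewrite -[X in (X < _)%N]expn1 ltn_exp2l ?finNzRing_gt1.
case/forall_inPn => x xR /forall_inPn[y yR]; rewrite negb_imply => /andP[/eqP Qxy xy].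
exists (x - y); rewrite subr_eq0 xy memvB //; split=> //.
have fxy : f x y = 0.
  move: xR yR; rewrite !memv_cap => /andP[_ /mem_orthovP xX] /andP[yX _]; exact: xX.
by rewrite QB fxy subr0 Qxy -[X in X + X]mul1r -mulrDl two0 mul0r.
Qed.

Lemma bad_partners_witness U' : U' \in bad_partners ->
  (exists2 u, u != 0 & u \in (U :&: U')%VS) \/
  (exists u y, [/\ u \in U, u != 0, y \in val_set U^_ 0, u + y \in U' & y \in U'^_]).
Proof.
rewrite inE => /andP[U'A]; have [cap0|cap0 _] := eqVneq (U :&: U')%VS 0%VS; last first.
  by left; exists (vpick (U :&: U')); rewrite ?vpick0 ?memv_pick.
move=> /negbTE nd0; right.
have [|y [y0 Qy]] := exists_singular_radical nd0.
  by rewrite dimv_disjoint_sum // oddD (negPf U_even) A_dim // (negPf e'_even).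
rewrite memv_cap => /andP[/memv_addP[u1 u1U [u' u'U' ey]] yp].
have : (U + U' <= <[y]>^_)%VS by rewrite -mem_orthov_sym.
rewrite subv_add -!mem_orthov_sym => /andP[yU yU'].
(* From [y = u1 + u'] one gets [- u1 + y = u'] in [U']. If [u1] were 0, then [y] would be a nonzero
   radical vector of [U']. *)
exists (- u1), y; rewrite memvN u1U oppr_eq0 inE y0 yU Qy eqxx yU' ey addKr u'U'.
split=> //; apply/eqP => u10; case/negP: y0; rewrite -memv0 -(eqP (A_nd U'A)).
by rewrite memv_cap yU' ey u10 add0r u'U'.
Qed.

Definition common_vectors U' := [set u in U | (u != 0) && (u \in U')].

Definition common_flags U' := [set p : V * V |
  [&& p.1 \in U, p.1 != 0, p.2 \in val_set U^_ 0, p.1 + p.2 \in U' & p.2 \in U'^_]].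

Lemma card_common_vectors U' u : u != 0 -> u \in (U :&: U')%VS ->
  (#|F| - 1 <= #|common_vectors U'|)%N.
Proof.
move=> u0; rewrite memv_cap => /andP[uU uU'].
have inj : injective (fun a : F => a *: u) by move=> a b /eqP; rewrite -subr_eq0 -scalerBl scaler_eq0 (negPf u0) orbF subr_eq0 => /eqP.
rewrite subn1 -(cardsC1 (0 : F)) -(card_imset _ inj); apply/subset_leq_card/subsetP => v.
case/imsetP => a; rewrite !inE => a0 ->.
by rewrite !memvZ // scaler_eq0 negb_or a0 u0.
Qed.

Lemma card_common_flags U' u y : u \in U -> u != 0 -> y \in val_set U^_ 0 ->
  u + y \in U' -> y \in U'^_ -> (#|F| - 1 <= #|common_flags U'|)%N.
Proof.
move=> uU u0; rewrite inE => /and3P[yU y0 /eqP Qy] uyU' yU'.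
have inj : injective (fun a : F => (a *: u, a *: y)).
  by move=> a b [/eqP + _]; rewrite -subr_eq0 -scalerBl scaler_eq0 (negPf u0) orbF subr_eq0 => /eqP.
rewrite subn1 -(cardsC1 (0 : F)) -(card_imset _ inj); apply/subset_leq_card/subsetP => v.
case/imsetP => a; rewrite !inE => a0 -> /=.
rewrite -scalerDr !memvZ // !scaler_eq0 !negb_or a0 u0 y0 QZ Qy mulr0 eqxx.
by rewrite !andbT.
Qed.

Lemma sum_common_vectors :
  (\sum_(U' in A) #|common_vectors U'| = \sum_(u in U | u != 0%R) num_containing u)%N.
Proof.
rewrite (eq_bigr (fun U' => \sum_(u in U | u != 0%R) (u \in U' : nat))%N).
  rewrite exchange_big; apply: eq_bigr => u _ /=; rewrite /num_containing -sum1_card.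
  rewrite big_mkcond [RHS]big_mkcond; apply: eq_bigr => U' _.
  by rewrite inE; case: (U' \in A) => //=; case: ifP.
move=> U' _; rewrite -sum1_card big_mkcond [RHS]big_mkcond; apply: eq_bigr => u _.
by rewrite inE; case: (u \in U) => //=; case: (u != 0) => //=; case: ifP.
Qed.

Lemma sum_common_flags :
  (\sum_(U' in A) #|common_flags U'| =
   \sum_(u in U | u != 0%R) \sum_(y in val_set U^_ 0%R) num_incident (u + y)%R y)%N.
Proof.
rewrite pair_big_dep /=.
rewrite (eq_bigr (fun U' => \sum_(p : V * V | ((p.1 \in U) && (p.1 != 0%R)) && (p.2 \in val_set U^_ 0%R))
   ((p.1 + p.2 \in U')%R && (p.2 \in U'^_) : nat))%N).
  rewrite exchange_big; apply: eq_bigr => p _ /=; rewrite /num_incident -sum1_card.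
  rewrite big_mkcond [RHS]big_mkcond; apply: eq_bigr => U' _.
  by rewrite inE; case: (U' \in A) => //=; case: ifP.
move=> U' _; rewrite -sum1_card big_mkcond [RHS]big_mkcond; apply: eq_bigr => p _.
rewrite inE; case: (p.1 \in U) => //=; case: (p.1 != 0) => //=.
by case: (p.2 \in val_set _ _) => //=; case: ifP.
Qed.

Lemma first_moment :
  ((#|F| - 1) * #|bad_partners| <=
   \sum_(u in U | u != 0%R) num_containing u +
   \sum_(u in U | u != 0%R) \sum_(y in val_set U^_ 0%R) num_incident (u + y)%R y)%N.
Proof.
rewrite -sum_common_vectors -sum_common_flags -big_split mulnC -sum_nat_const /=.
rewrite [X in (X <= _)%N]big_mkcond [X in (_ <= X)%N]big_mkcond /=.
apply: leq_sum => U' _; case: ifP => // Ub.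
have -> : U' \in A by move: Ub; rewrite inE => /andP[].
case: (bad_partners_witness Ub) => [[u u0 uUU']|[u [y [uU u0 yU uyU' yU']]]].
  by apply: leq_trans (card_common_vectors u0 uUU') (leq_addr _ _).
by apply: leq_trans (card_common_flags uU u0 yU uyU' yU') (leq_addl _ _).
Qed.

(** A zero intersection already gives [U + U' = fullv], which is nondegenerate, so common vectors
    account for all bad partners. *)
Lemma first_moment_complementary : (\dim U + e' = d)%N ->
  ((#|F| - 1) * #|bad_partners| <= \sum_(u in U | u != 0%R) num_containing u)%N.
Proof.
move=> dimUU'; rewrite -sum_common_vectors mulnC -sum_nat_const.
rewrite [X in (X <= _)%N]big_mkcond [X in (_ <= X)%N]big_mkcond /=.
apply: leq_sum => U' _; case: ifP => //; rewrite inE => /andP[U'A].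
rewrite U'A; have [cap0|cap0 _] := eqVneq (U :&: U')%VS 0%VS; last first.
  by apply: (@card_common_vectors _ (vpick (U :&: U'))); rewrite ?vpick0 ?memv_pick.
suff -> : (U + U')%VS = fullv by rewrite ndV.
have dimE : \dim (U + U') = d by rewrite dimv_disjoint_sum // (A_dim U'A).
by apply/eqP; rewrite eqEdim subvf dimE dimvf /dim /= mul1n leqnn.
Qed.

End FirstMoment.

Section Average.
Variables (U : {vspace V}).
Hypothesis ndU : nd U.
Local Notation n X c := (#|val_set X c|%:R : rat).

Lemma sum_by_value X (g : F -> rat) :
  \sum_(u in X | u != 0) g (Q u) = \sum_c n X c * g c.
Proof.
rewrite (partition_big Q predT) //=; apply: eq_bigr => c _.
rewrite (eq_bigr (fun=> g c)); last by move=> u /andP[_ /eqP ->].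
rewrite sumr_const mulr_natl; congr (_ *+ _); apply: eq_card => u.
by rewrite inE -topredE /= andbA.
Qed.

Lemma average_containing :
  (\sum_(u in U | u != 0%R) num_containing u)%:R =
  \sum_(U' in A) \sum_c n U c * n U' c / n fullv c.
Proof.
rewrite exchange_big /= natr_sum.
rewrite (eq_bigr (fun u => (fun c => (\sum_(U' in A) n U' c) / n fullv c) (Q u))).
  rewrite (sum_by_value U (fun c => (\sum_(U' in A) n U' c) / n fullv c)); apply: eq_bigr => c _.
  by rewrite mulr_suml mulr_sumr; apply: eq_bigr => U' _; rewrite mulrA.
move=> u /andP[_ u0]; have := num_containing_mul u0.
move/(congr1 (fun m : nat => m%:R : rat)); rewrite natrM natr_sum => <-.
rewrite mulfK // pnatr_eq0 -lt0n; apply/card_gt0P; exists u.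
by rewrite inE memvf u0 eqxx.
Qed.

Lemma flag_addv u y : u \in U -> u != 0 -> y \in val_set U^_ 0 ->
  (u + y, y) \in flag_set (Q u) /\ Q (u + y) = Q u.
Proof.
move=> uU u0; rewrite inE => /and3P[yU y0 /eqP Qy].
have fyu : f y u = 0 by move/mem_orthovP: yU => /(_ u uU).
have Quy : Q (u + y) = Q u by rewrite QD Qy pC fyu !addr0.
split=> //; rewrite !inE /= memvf y0 Qy Quy !eqxx andbT /=; apply/andP; split.
  by rewrite mem_orthov1 fDl pC fyu polarE Qy !addr0.
rewrite andbT; apply: contra u0 => /vlineP[a uay]; rewrite -memv0 -(eqP ndU) memv_cap uU.
have -> : u = (a - 1) *: y by rewrite scalerBl scale1r -uay addrK.
by rewrite memvZ.
Qed.

Lemma average_incident :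
  (\sum_(u in U | u != 0%R) \sum_(y in val_set U^_ 0%R) num_incident (u + y)%R y)%:R =
  \sum_(U' in A) \sum_c n U c * n U^_ 0 * n U' c * n U'^_ 0 / #|flag_set c|%:R.
Proof.
rewrite [RHS]exchange_big /= natr_sum.
pose g c := n U^_ 0 * (\sum_(U' in A) n U' c * n U'^_ 0) / #|flag_set c|%:R.
rewrite (eq_bigr (fun u => g (Q u))).
  rewrite (sum_by_value U g) /g; apply: eq_bigr => c _.
  rewrite mulr_sumr mulr_suml mulr_sumr; apply: eq_bigr => U' _.
  by rewrite !mulrA.
move=> u /andP[uU u0]; rewrite natr_sum /g -mulrA mulr_natl -sumr_const.
apply: eq_bigr => y yU; have [uyP Quy] := flag_addv uU u0 yU.
rewrite -Quy in uyP *; have := num_incident_mul uyP.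
move/(congr1 (fun m : nat => m%:R : rat)); rewrite natrM natr_sum.
rewrite (eq_bigr (fun U' => n U' (Q (u + y)) * n U'^_ 0)) => [<-|U' _]; last by rewrite natrM.
by rewrite mulfK // pnatr_eq0 -lt0n; apply/card_gt0P; exists (u + y, y).
Qed.

End Average.
End Incidence.

(** * Numbers of vectors of a given value *)

Section ValueCounts.
Variables (F : finFieldType) (d : nat).
Local Notation V := 'rV[F]_d.
Variable Q : quadraticForm V.
Local Notation f := (polar_form Q).
Implicit Types (U W X Y L : {vspace V}) (u v w x y z : V).
Local Notation "U ^_" := (orthov f U) (at level 2, format "U ^_").
Local Notation nd := (nondegenerate_on f).
Local Notation q := (#|F|%:R : rat).

(** The counterpart of [val_set] that retains the zero vector; the recursions run on this version,
    the first moment on the other. *)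
Definition value_set X (c : F) := [set x in X | Q x == c].

(** Adding [t *: y] to [x], for singular [y], changes [Q x] by [t * f x y], so the values are
    uniformly distributed over the vectors not orthogonal to [y]. *)
Lemma card_value_set_off_orthov X y c : y \in X -> y \notin X^_ -> Q y = 0 ->
  (#|[set x in X | (f x y != 0%R) && (Q x == c)]| * #|F| = #|F| ^ \dim X - #|F| ^ (\dim X).-1)%N.
Proof.
move=> yX yXp Qy.
pose T c' := [set x in X | (f x y != 0) && (Q x == c')].
have fyy : f y y = 0 by rewrite polarE Qy addr0.
have le c1 c2 : (#|T c1| <= #|T c2|)%N.
  pose h x := x + ((c2 - c1) / f x y) *: y.
  have fh x : f (h x) y = f x y by rewrite /h fDl pZl fyy mulr0 addr0.
  rewrite -(@card_in_imset _ _ h (T c1)) => [|x x' _ _ e].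
    apply/subset_leq_card/subsetP => _ /imsetP[x + ->].
    rewrite !inE fh => /and3P[xX fxy /eqP Qx]; rewrite memvD ?memvZ //= fxy /=.
    by rewrite /h QD QZ Qy mulr0 addr0 pZr divfK // Qx addrC subrK.
  by have := congr1 (fun u => f u y) e; rewrite !fh => exy; move: e; rewrite /h exy => /addIr.
have -> : (#|T c| * #|F| = #|[set x in X | f x y != 0%R]|)%N.
  rewrite mulnC -sum_nat_const -[RHS]sum1_card [RHS](partition_big Q predT) //=.
  apply: eq_bigr => c' _; rewrite sum1_card.
  transitivity #|T c'|; first by apply/eqP; rewrite eqn_leq !le.
  by apply: eq_card => x; rewrite inE -[RHS]topredE /= inE andbA.
have dX : (0 < \dim X)%N.
  rewrite lt0n dimv_eq0; apply: contraNneq yXp => X0; move: yX; rewrite X0 memv0 => /eqP ->.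
  exact: mem0v.
have /eqP := card_level_form 0 yXp.
rewrite -{1}(prednK dX) expnSr eqn_pmul2r; last exact: ltnW (finNzRing_gt1 F).
move/eqP=> <-; rewrite -card_vspace_set -(cardsID [set v | f v y == 0] [set v | v \in X]).
have -> : [set v | v \in X] :&: [set v | f v y == 0] = [set v in X | f v y == 0].
  by apply/setP => v; rewrite !inE.
by rewrite addKn; apply: eq_card => v; rewrite !inE andbC.
Qed.

Lemma card_value_set_orthov y z c X : Q y = 0 -> f y z != 0 ->
  (<[y]> + <[z]> <= X)%VS ->
  #|[set x in X | (f x y == 0) && (Q x == c)]| =
  (#|F| * #|value_set (X :&: (<[y]> + <[z]>)^_) c|)%N.
Proof.
move=> Qy fyz LX; have fyy : f y y = 0 by rewrite polarE Qy addr0.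
have [ndL _] := nd_plane fyy fyz; set L := (<[y]> + <[z]>)%VS in ndL LX *.
have yL : y \in L by rewrite memvE addvSl.
have zL : z \in L by rewrite memvE addvSr.
have y0 : y != 0 by apply: contraNneq fyz => ->; rewrite f0l.
rewrite -(cardsT F) -cardsX.
pose h (p : F * V) := p.1 *: y + p.2.
have h_inj : {in setX [set: F] (value_set (X :&: L^_) c) &, injective h}.
  move=> [a w] [a' w']; rewrite !inE /= !memv_cap => /andP[/andP[_ /mem_orthovP wL] _].
  move=> /andP[/andP[_ /mem_orthovP w'L] _] e.
  have := congr1 (fun u => f u z) e; rewrite /h /= !fDl !pZl (wL _ zL) (w'L _ zL) !addr0.
  by move/(mulIf fyz) => ea; move: e; rewrite /h /= ea => /addrI ->.
rewrite -(card_in_imset h_inj); apply: eq_card => x; rewrite !inE.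
apply/idP/imsetP => [/and3P[xX fxy /eqP Qx]|[[a w]]].
  have [l lL xlL] := orthov_decomp x ndL.
  have fxly : f (x - l) y = 0 by move/mem_orthovP: xlL; apply.
  have : f l y = 0 by move: fxly; rewrite fBl (eqP fxy) sub0r => /eqP; rewrite oppr_eq0 => /eqP.
  case/memv_addP: (lL) => _ /vlineP[a ->] [_ /vlineP[b ->] el].
  rewrite el fDl !pZl fyy mulr0 add0r [f z y]pC => /eqP; rewrite mulf_eq0 (negPf fyz) orbF => /eqP b0.
  have {}el : l = a *: y by rewrite el b0 scale0r addr0.
  exists (a, x - l); last by rewrite /h /= -el addrC subrK.
  have lX : l \in X by apply: (subvP LX).
  rewrite !inE /= memv_cap xlL memvB //= QB -Qx el QZ Qy mulr0 addr0 pZr (eqP fxy) mulr0.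
  by rewrite subr0 eqxx.
rewrite !inE /= memv_cap => /andP[/andP[wX /mem_orthovP wL] /eqP Qw] ->.
have yX : y \in X by apply: (subvP LX).
rewrite /h /= memvD ?memvZ //= fDl pZl fyy mulr0 add0r (wL _ yL) eqxx /=.
by rewrite QD QZ Qy mulr0 add0r pZl [f y w]pC (wL _ yL) mulr0 addr0 Qw.
Qed.

Lemma card_value_set_split y z c X : nd X -> Q y = 0 -> f y z != 0 ->
  (<[y]> + <[z]> <= X)%VS ->
  \dim X = (\dim (X :&: (<[y]> + <[z]>)^_)).+2 /\
  q * #|value_set X c|%:R = q ^+ \dim X - q ^+ (\dim X).-1 +
    q * (q * #|value_set (X :&: (<[y]> + <[z]>)^_) c|%:R).
Proof.
move=> ndX Qy fyz LX; have fyy : f y y = 0 by rewrite polarE Qy addr0.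
have [ndL dimL] := nd_plane fyy fyz.
have yX : y \in X by apply: (subvP LX); rewrite memvE addvSl.
have y0 : y != 0 by apply: contraNneq fyz => ->; rewrite f0l.
split; first by have := dim_cap_orthov ndL LX; rewrite dimL.
have := card_value_set_off_orthov c yX (nd_radical_notin ndX yX y0) Qy.
move/(congr1 (fun m : nat => m%:R : rat)); rewrite natrM natrB ?leq_exp2l ?finNzRing_gt1 ?leq_pred //.
rewrite !natrX => <-; have := card_value_set_orthov c Qy fyz LX.
move/(congr1 (fun m : nat => m%:R : rat)); rewrite natrM => <-.
rewrite [_ * q]mulrC -mulrDr -natrD; congr (_ * _%:R).
rewrite -(cardsID [set x | f x y != 0] (value_set X c)); congr (_ + _)%N.
  by apply: eq_card => x; rewrite !inE; case: (x \in X); case: (f x y == 0); case: (Q x == c).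
by apply: eq_card => x; rewrite !inE; case: (x \in X); case: (f x y == 0); case: (Q x == c).
Qed.

(** The sum of squares counts pairs [(a, b)] with [Q (a + b) = Q b], that is [f b a = - Q a]: all
    [b] for [a = 0], and a level set of a nonzero linear form for every other [a]. *)
Lemma second_moment X : nd X ->
  q * \sum_c #|value_set X c|%:R ^+ 2 = q ^+ (\dim X).+1 + (q ^+ \dim X - 1) * q ^+ \dim X.
Proof.
move=> ndX; pose q' := #|F|.
pose P := [set p : V * V | [&& p.1 \in X, p.2 \in X & Q (p.1 + p.2) == Q p.2]].
have eP : (\sum_c #|value_set X c| ^ 2 = #|P|)%N.
  rewrite -[RHS]sum1_card [RHS](partition_big (fun p => Q p.2) predT) //=.
  apply: eq_bigr => c _; rewrite sum1_card -mulnn -cardsX.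
  have inj : injective (fun p : V * V => (p.1 - p.2, p.2)).
    by move=> [a b] [a' b'] [/= + eb]; rewrite eb => /addIr ->.
  rewrite -(card_imset (setX _ _) inj); apply: eq_card => -[a b].
  rewrite -[RHS]topredE /= [(a, b) \in P]inE /=.
  apply/imsetP/andP => [[[x y]]|[/and3P[aX bX Qab] Qb]].
    rewrite !inE /= => /andP[/andP[xX /eqP Qx] /andP[yX /eqP Qy]] [-> ->].
    by rewrite memvB // subrK Qx Qy yX !eqxx.
  exists (a + b, b); last by rewrite /= addrK.
  by rewrite !inE /= memvD // bX (eqP Qab) Qb.
have eP2 : (#|F| * #|P| = #|F| * #|F| ^ \dim X + (#|F| ^ \dim X - 1) * #|F| ^ \dim X)%N.
  have -> : #|P| = (\sum_(a in X) #|[set b in X | f b a == (- Q a)%R]|)%N.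
    rewrite -sum1_card (partition_big (fun p => p.1) (mem X)) /=; last first.
      by move=> p; rewrite inE => /and3P[].
    apply: eq_bigr => a aX; rewrite sum1_card.
    have inj : injective (fun b : V => (a, b)) by move=> b b' [].
    rewrite -(card_imset [set b in X | _] inj); apply: eq_card => -[a' b].
    rewrite -topredE /= !inE /=; apply/andP/imsetP => [[/and3P[_ bX Qab] /eqP ea]|[b']].
      exists b; rewrite ?ea // inE bX -ea pC -addr_eq0 addrC.
      by rewrite -(inj_eq (addIr (Q b))) add0r addrAC -QD.
    rewrite inE => /andP[bX fb] [-> ->]; have fb' : f b' a = - Q a by apply/eqP.
    rewrite aX bX eqxx QD pC fb'.
    by rewrite addrAC subrr add0r eqxx.
  rewrite (bigD1 0) ?mem0v //= mulnDr; congr (_ + _)%N.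
    congr (_ * _)%N; rewrite -card_vspace_set; apply: eq_card => b.
    by rewrite !inE f0r Q0 oppr0 eqxx andbT.
  rewrite big_distrr /= (eq_bigr (fun=> #|F| ^ \dim X)%N); last first.
    by move=> a /andP[aX a0]; rewrite mulnC card_level_form // nd_radical_notin.
  rewrite sum_nat_const; congr (_ * _)%N; rewrite -card_vspace_set (cardsD1 0) inE mem0v addKn.
  by apply: eq_card => a; rewrite !inE -topredE /= andbC.
have := congr1 (fun m : nat => m%:R : rat) eP2; rewrite /= natrM -eP natrD !natrM natrB; last first.
  by rewrite expn_gt0 (ltnW (finNzRing_gt1 F)).
rewrite natr_sum natrX exprS => <-; congr (_ * _); apply: eq_bigr => c _.
by rewrite natrX.
Qed.

Lemma sum_value_sets X : \sum_c #|value_set X c|%:R = q ^+ \dim X.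
Proof.
rewrite -natrX -card_vspace_set -natr_sum; congr (_%:R).
rewrite -[RHS]sum1_card [RHS](partition_big Q predT) //=; apply: eq_bigr => c _.
by rewrite sum1_card; apply: eq_card => x; rewrite -[RHS]topredE /= !inE.
Qed.

End ValueCounts.

Lemma sqr_sub1_div (r : rat) : 1 < r -> (r ^+ 2 - 1) / (r - 1) = r + 1.
Proof. by move=> r1; field; lra. Qed.

Lemma even_counts_algebra (r s e : rat) m k :
  r ^+ m.+2 - r ^+ m.+1 + r * (r ^+ m + s * r ^+ k * (e * r - 1)) =
  r ^+ m.+2 + s * r ^+ k.+1 * (e * r - 1).
Proof. by rewrite !exprS; ring. Qed.

Lemma odd_counts_algebra (r N : rat) m : (r * N - r ^+ m) ^+ 2 = r ^+ m.+1 ->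
  (r ^+ m.+2 - r ^+ m.+1 + r * (r * N) - r ^+ m.+2) ^+ 2 = r ^+ m.+3.
Proof.
move=> e; transitivity (r ^+ 2 * (r * N - r ^+ m) ^+ 2); first by rewrite !exprS; ring.
by rewrite e !exprS; ring.
Qed.

Lemma odd_counts_algebra0 (r : rat) m : r ^+ m.+2 - r ^+ m.+1 + r * r ^+ m = r ^+ m.+2.
Proof. by rewrite !exprS; ring. Qed.

Lemma trivial_counts_algebra (r : rat) :
  [/\ r = 1 + (r - 1), r = r ^+ 2 + (-1) * r * (r - 1),
      r * (r + 1) = r ^+ 2 + (-1) * r * (-1), (r * 0 - r) ^+ 2 = r ^+ 2 &
      (r * 2 - r) ^+ 2 = r ^+ 2].
Proof. by split; ring. Qed.

(** * Value counts of nondegenerate quadratic spaces *)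

Section Classification.
Variables (F : finFieldType) (d : nat).
Local Notation V := 'rV[F]_d.
Variable Q : quadraticForm V.
Local Notation f := (polar_form Q).
Implicit Types (U W X Y L : {vspace V}) (u v w x y z : V).
Local Notation "U ^_" := (orthov f U) (at level 2, format "U ^_").
Local Notation nd := (nondegenerate_on f).
Local Notation q := (#|F|%:R : rat).
Local Notation n X c := (#|value_set Q X c|%:R : rat).

Definition anisotropic X := forall x, x \in X -> Q x = 0 -> x = 0.

Lemma q_gt1 : 1 < q.
Proof. by rewrite ltr1n finNzRing_gt1. Qed.

Lemma anisotropic_value_set0 X : anisotropic X -> #|value_set Q X 0| = 1%N.
Proof.
move=> aX; apply/eqP/cards1P; exists 0; apply/setP => x; rewrite !inE.
apply/andP/eqP => [[xX /eqP]|->]; first exact: aX.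
by rewrite mem0v Q0.
Qed.

(* Cauchy-Schwarz for the values [c <> 0]: the second moment leaves no room for
   an anisotropic space of dimension 3, and in dimension 2 it is an equality. *)
Lemma anisotropic_variance X : nd X -> anisotropic X ->
  let mu := (q ^+ \dim X - 1) / (q - 1) in
  q * \sum_(c | c != 0) (n X c - mu) ^+ 2 =
  (q ^+ \dim X - 1) / (q - 1) * (q ^+ 2 - q ^+ \dim X).
Proof.
move=> ndX aX mu; have q1 := q_gt1.
have := second_moment ndX; have := sum_value_sets Q X.
rewrite (bigD1 0) //= [X in _ -> q * X = _ -> _](bigD1 0) //= anisotropic_value_set0 // expr1n.
move=> S1 S2.
have {}S1 : \sum_(c | c != 0) n X c = q ^+ \dim X - 1 by apply/eqP; rewrite eq_sym subr_eq -S1 addrC.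
have -> : \sum_(c | c != 0) (n X c - mu) ^+ 2 =
    \sum_(c | c != 0) n X c ^+ 2 - mu * (q ^+ \dim X - 1) *+ 2 + mu ^+ 2 * (q - 1).
  rewrite (eq_bigr (fun c => n X c ^+ 2 + (- (mu *+ 2)) * n X c + mu ^+ 2)); last by move=> c _; ring.
  rewrite !big_split /= -mulr_sumr S1 sumr_const cardC1 -[mu ^+ 2 *+ _]mulr_natr.
  by rewrite -subn1 natrB ?(ltnW (finNzRing_gt1 F)) //; ring.
have alg (r t T : rat) : 1 < r -> r * (1 + T) = r * t + (t - 1) * t ->
    r * (T - (t - 1) / (r - 1) * (t - 1) *+ 2 + ((t - 1) / (r - 1)) ^+ 2 * (r - 1)) =
    (t - 1) / (r - 1) * (r ^+ 2 - t).
  move=> r1 e; have -> : T = (r * t + (t - 1) * t) / r - 1 by rewrite -e; field; lra.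
  by field; apply/andP; split; lra.
by apply: alg => //; rewrite S2 exprS.
Qed.

Lemma anisotropic_dim X : nd X -> anisotropic X -> (\dim X <= 2)%N.
Proof.
move=> ndX aX; have q1 := q_gt1; rewrite leqNgt; apply/negP => X3.
have := anisotropic_variance ndX aX; move=> /= e.
have : 0 <= q * \sum_(c | c != 0) (n X c - (q ^+ \dim X - 1) / (q - 1)) ^+ 2.
  by rewrite mulr_ge0 ?sumr_ge0 // => c _; exact: sqr_ge0.
rewrite e leNgt => /negP; apply.
have t2 : q ^+ 2 < q ^+ \dim X by rewrite ltr_eXn2l.
rewrite nmulr_llt0 ?subr_lt0 // divr_gt0 ?subr_gt0 // exprn_egt1 //.
by case: (\dim X) X3.
Qed.

Lemma anisotropic_plane_counts X c : nd X -> anisotropic X -> \dim X = 2%N ->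
  c != 0 -> n X c = q + 1.
Proof.
move=> ndX aX X2 c0; have q1 := q_gt1.
have := anisotropic_variance ndX aX; rewrite X2 subrr mulr0 /= => /eqP.
have -> : (q ^+ 2 - 1) / (q - 1) = q + 1.
  exact: sqr_sub1_div.
rewrite mulf_eq0 gt_eqF /=; last by apply: lt_trans q1.
rewrite psumr_eq0 => [/allP/(_ c (mem_index_enum _))|c' _]; last exact: sqr_ge0.
by rewrite c0 /= sqrf_eq0 subr_eq0 => /eqP.
Qed.

Lemma exists_singular X : nd X -> (2 < \dim X)%N ->
  exists y, [/\ y \in X, y != 0 & Q y = 0].
Proof.
move=> ndX X3.
case: (pickP (fun y => [&& y \in X, y != 0 & Q y == 0])) => [y /and3P[yX y0 /eqP Qy]|H].
  by exists y.
have aX : anisotropic X.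
  move=> x xX Qx; apply/eqP; have := H x; rewrite xX Qx eqxx andbT /=.
  by move/negbFE.
by have := anisotropic_dim ndX aX; rewrite leqNgt X3.
Qed.

Lemma hyperbolic_partner X y : nd X -> y \in X -> y != 0 ->
  exists2 z, z \in X & f y z != 0.
Proof. by move=> ndX yX y0; apply/mem_orthovPn/nd_radical_notin. Qed.

(** In dimension [2k] this is the classical count [q^(2k-1) + s (q^k - q^(k-1))] of singular
    vectors, and [q^(2k-1) - s q^(k-1)] for each other value, multiplied by [q]. The sign [s] is the
    type. *)
Definition even_counts X (s : rat) := forall c,
  q * n X c = q ^+ \dim X + s * q ^+ (\dim X)./2 * ((c == 0)%:R * q - 1).

(** For [c != 0] only the square of the deviation is recorded: its sign varies with [c], and the
    later sums use only the square and the total. *)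
Definition odd_counts X := n X 0 * q = q ^+ \dim X /\
  forall c, c != 0 -> (q * n X c - q ^+ \dim X) ^+ 2 = q ^+ (\dim X).+1.

Lemma even_counts_split y z s X : nd X -> Q y = 0 -> f y z != 0 ->
  (<[y]> + <[z]> <= X)%VS -> even_counts (X :&: (<[y]> + <[z]>)^_) s ->
  even_counts X s.
Proof.
move=> ndX Qy fyz LX H c; have [dimX ->] := card_value_set_split c ndX Qy fyz LX.
by rewrite H dimX even_counts_algebra.
Qed.

Lemma odd_counts_split y z X : nd X -> Q y = 0 -> f y z != 0 ->
  (<[y]> + <[z]> <= X)%VS -> odd_counts (X :&: (<[y]> + <[z]>)^_) ->
  odd_counts X.
Proof.
move=> ndX Qy fyz LX [H0 H]; split=> [|c c0].
  have [dimX] := card_value_set_split 0 ndX Qy fyz LX.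
  rewrite mulrC => ->; rewrite [q * n _ _]mulrC H0 dimX /=.
  exact: odd_counts_algebra0.
have [dimX ->] := card_value_set_split c ndX Qy fyz LX; rewrite dimX /=.
exact: odd_counts_algebra (H c c0).
Qed.

Lemma value_counts X : nd X ->
  if odd (\dim X) then odd_counts X else even_counts X 1 \/ even_counts X (-1).
Proof.
have [m] := ubnP (\dim X); elim: m X => // m IH X /ltnSE dimX ndX.
case: (pickP (fun y => [&& y \in X, y != 0 & Q y == 0])) => [y /and3P[yX y0 /eqP Qy]|H].
  have [z zX fyz] := hyperbolic_partner ndX yX y0.
  have fyy : f y y = 0 by rewrite polarE Qy addr0.
  have [ndL _] := nd_plane fyy fyz.
  have LX : (<[y]> + <[z]> <= X)%VS by rewrite subv_add -!memvE yX.
  have [dimE _] := card_value_set_split 0 ndX Qy fyz LX.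
  have ndX' : nd (X :&: (<[y]> + <[z]>)^_) by rewrite -nd_cap_orthov.
  have := IH _ _ ndX'; rewrite dimE /= negbK.
  have -> : (\dim (X :&: (<[y]> + <[z]>)^_) < m)%N by move: dimX; rewrite dimE => /ltnW.
  move=> /(_ isT); case: ifP => _.
    exact: odd_counts_split.
  by case=> /(even_counts_split ndX Qy fyz LX); [left|right].
have aX : anisotropic X.
  move=> x xX Qx; apply/eqP; have := H x; rewrite xX Qx eqxx andbT /=.
  by move/negbFE.
have n0 : n X 0 = 1 by rewrite anisotropic_value_set0.
have := anisotropic_dim ndX aX; have := @anisotropic_plane_counts X ^~ ndX ^~ aX.
(* Splitting off hyperbolic planes ends in an anisotropic space of dimension 0, 1 or 2, which yields
   sign plus, the odd case and sign minus respectively. *)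
case X2 : (\dim X) => [|[|[|//]]] /= plane _.
- left=> c; have X0 : X = 0%VS by apply/eqP; rewrite -dimv_eq0 X2.
  rewrite X2 !expr0 mulr1 mul1r.
  have [A1 _ _ _ _] := trivial_counts_algebra q.
  have [->|c0] := eqVneq c 0; first by rewrite n0 mulr1 mul1r.
  have -> : value_set Q X c = set0.
    apply/setP => x; rewrite !inE X0 memv0; case: eqP => // ->.
    by rewrite Q0 eq_sym (negPf c0).
  by rewrite cards0 mulr0 mul0r sub0r subrr.
- split=> [|c c0]; first by rewrite n0 mul1r X2.
  rewrite X2 expr1; suff : n X c = 0 \/ n X c = 2.
    have [_ _ _ A1 A2] := trivial_counts_algebra q.
    by case=> ->.
  have [->|[x]] := set_0Vmem (value_set Q X c); first by left; rewrite cards0.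
  rewrite inE => /andP[xX /eqP Qx]; right.
  have x0 : x != 0 by apply: contraNneq c0 => x0; rewrite -Qx x0 Q0.
  have Xx : X = <[x]>%VS.
    by apply/esym/eqP; rewrite eqEdim -memvE xX X2 dim_vline x0.
  have two0 : (1 + 1 : F) != 0.
    apply: contra x0 => /eqP two0; apply/eqP/(nd_eq0 ndX xX) => y.
    rewrite Xx => /vlineP[a ->].
    by rewrite pZr polarE -[Q x]mul1r -mulrDl two0 mul0r mulr0.
  have xNx : x != - x.
    by rewrite -addr_eq0 -[x]scale1r -scalerDl scaler_eq0 negb_or two0.
  suff -> : value_set Q X c = [set x; - x] by rewrite cards2 xNx.
  apply/setP => y; rewrite !inE; apply/andP/orP => [[]|[]/eqP->].
  - rewrite Xx => /vlineP[a ->]; rewrite QZ Qx -subr_eq0 -{2}[c]mul1r -mulrBl.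
    rewrite mulf_eq0 (negPf c0) orbF -[X in _ - X](expr1n _ 2) subr_sqr mulf_eq0 subr_eq0 addr_eq0.
    by case/orP=> /eqP ->; [left; rewrite scale1r|right; rewrite scaleN1r].
  - by rewrite xX Qx.
  - by rewrite memvN xX QN Qx.
have [_ A1 A2 _ _] := trivial_counts_algebra q.
right=> c; have [->|c0] := eqVneq c 0; rewrite X2 expr1.
  by rewrite n0 mulr1 mul1r -A1.
by rewrite plane // mul0r sub0r.
Qed.

End Classification.

(** * Types of orthogonal subspaces *)

Definition type_sign (s : subspace_type) : rat := if s is PlusType then 1 else -1.

(* [r] is the Witt index of a space of dimension [2k] and sign [s]; the left-hand
   side increases strictly with [r]. *)
Lemma witt_index_sign (q : rat) (r k : nat) s : 1 < q -> (r <= k.*2)%N ->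
  (q ^+ r.+1 - q ^+ (k.*2 - r) == type_sign s * (q ^+ k.+1 - q ^+ k)) =
  (match s with PlusType => r | MinusType => r.+1 end == k).
Proof.
move=> q1 rk.
have lt i j : (i < j)%N -> q ^+ i < q ^+ j by move=> ij; rewrite ltr_eXn2l.
have le i j : (i <= j)%N -> q ^+ i <= q ^+ j by move=> ij; rewrite ler_eXn2l.
case: s; rewrite /= ?mul1r ?mulN1r.
  apply/idP/idP => [e|/eqP ->]; last by rewrite -addnn addnK.
  case: (ltngtP r k) => // [rk'|kr]; move/eqP: e.
    have h : (k.+1 <= k.*2 - r)%N by lia.
    by have := le _ _ rk'; have := lt _ _ (ltnSn k); have := le _ _ h; lra.
  have h : (k.*2 - r < k)%N by lia.
  have kr' : (k.+1 < r.+1)%N by [].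
  by have := lt _ _ kr'; have := lt _ _ h; lra.
rewrite opprB; apply/idP/idP => [/eqP e|/eqP rk']; last first.
  by rewrite rk' (_ : k.*2 - r = k.+1)%N //; lia.
case: (ltngtP r.+1 k) => // [rk'|kr].
  have h : (k.+1 < k.*2 - r)%N by lia.
  by have := lt _ _ rk'; have := lt _ _ h; lra.
have h : (k.*2 - r <= k)%N by lia.
have kr' : (k.+1 <= r.+1)%N by lia.
by have := lt _ _ (ltnSn k); have := le _ _ kr'; have := le _ _ h; lra.
Qed.

Lemma singular_count_algebra (q a b c : rat) :
  a * (q * a) + (b - c) * a = a * (b + (q * a - c)).
Proof. by ring. Qed.

Section Types.
Variables (F : finFieldType) (d : nat).
Local Notation V := 'rV[F]_d.
Variable Q : quadraticForm V.
Local Notation f := (polar_form Q).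
Implicit Types (U W X Y L : {vspace V}) (u v w x y z : V).
Local Notation "U ^_" := (orthov f U) (at level 2, format "U ^_").
Local Notation nd := (nondegenerate_on f).
Local Notation q := (#|F|%:R : rat).
Local Notation n X c := (#|value_set Q X c|%:R : rat).

Lemma card_level_form_dichotomy W x c :
  (#|F| * #|[set w in W | f w x == c]| =
   if x \in W^_ then (if c == 0%R then #|F| * #|F| ^ \dim W else 0) else #|F| ^ \dim W)%N.
Proof.
case: ifP => [xW|/negbT xW]; last by rewrite mulnC card_level_form.
have fwx w : w \in W -> f w x = 0 by move=> wW; rewrite pC; move/mem_orthovP: xW => /(_ w wW).
case: ifP => [/eqP ->|c0].
  by rewrite -card_vspace_set; congr (_ * _)%N; apply: eq_card => w; rewrite !inE; case wW: (w \in W); rewrite //= fwx ?eqxx.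
rewrite (_ : [set _ in _ | _] = set0) ?cards0 ?muln0 //; apply/setP => w; rewrite !inE.
by case wW: (w \in W); rewrite //= fwx // eq_sym c0.
Qed.

(** Here [X] rather than [W] is nondegenerate, as is needed for totally singular [W]. Orthogonal
    pairs in [X] and [W] are counted in both orders. *)
Lemma card_cap_orthov X W : nd X -> (W <= X)%VS ->
  (\dim (X :&: W^_) + \dim W = \dim X)%N.
Proof.
move=> ndX WX; have F1 := finNzRing_gt1 F.
have e : (\sum_(x in X) #|F| * #|[set w in W | f w x == 0%R]| =
          \sum_(w in W) #|F| * #|[set x in X | f x w == 0%R]|)%N.
  rewrite -!big_distrr; congr (_ * _)%N.
  have cardE Y x : (#|[set w in Y | f w x == 0%R]| = \sum_(w in Y) (f w x == 0%R : nat))%N.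
    rewrite -sum1_card big_mkcond [RHS]big_mkcond; apply: eq_bigr => w _.
    by rewrite inE; case: (w \in Y) => //=; case: ifP.
  rewrite (eq_bigr _ (fun x _ => cardE W x)) [RHS](eq_bigr _ (fun x _ => cardE X x)).
  by rewrite exchange_big; apply: eq_bigr => w _; apply: eq_bigr => x _; rewrite herm_eq0C.
have e1 : (\sum_(x in X) #|F| * #|[set w in W | f w x == 0%R]| =
   #|F| ^ \dim (X :&: W^_) * (#|F| * #|F| ^ \dim W) +
   (#|F| ^ \dim X - #|F| ^ \dim (X :&: W^_)) * #|F| ^ \dim W)%N.
  rewrite (bigID (mem W^_)) /=; congr (_ + _)%N.
    rewrite -card_vspace_set -sum_nat_const; apply: eq_big => x; first by rewrite inE memv_cap.
    by move=> /andP[_ xW]; rewrite card_level_form_dichotomy xW eqxx.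
  rewrite -!card_vspace_set -(cardsID [set x | x \in W^_] [set x | x \in X]).
  have -> : [set x | x \in X] :&: [set x | x \in W^_] = [set x | x \in (X :&: W^_)%VS].
    by apply/setP => x; rewrite !inE memv_cap.
  rewrite addKn -sum_nat_const; apply: eq_big => x; first by rewrite !inE andbC.
  by move=> /andP[_ /negPf xW]; rewrite card_level_form_dichotomy xW card_vspace_set.
have e2 : (\sum_(w in W) #|F| * #|[set x in X | f x w == 0%R]| =
   #|F| * #|F| ^ \dim X + (#|F| ^ \dim W - 1) * #|F| ^ \dim X)%N.
  rewrite (bigD1 0) ?mem0v //= card_level_form_dichotomy mem0v eqxx; congr (_ + _)%N.
  rewrite -(card_vspace_set W) (cardsD1 0) inE mem0v addKn -sum_nat_const.
  apply: eq_big => w; first by rewrite !inE andbC.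
  move=> /andP[wW w0]; rewrite card_level_form_dichotomy ifN //.
  by apply: nd_radical_notin => //; apply: (subvP WX).
have le : (#|F| ^ \dim (X :&: W^_) <= #|F| ^ \dim X)%N by rewrite leq_exp2l // dimvS ?capvSl.
have W1 : (0 < #|F| ^ \dim W)%N by rewrite expn_gt0 ltnW.
apply/eqP; rewrite -(eqn_exp2l _ _ F1) expnD; apply/eqP.
move: e; rewrite e1 e2; move: le W1 F1; clear.
move: (#|F| ^ \dim (X :&: W^_))%N (#|F| ^ \dim X)%N (#|F| ^ \dim W)%N #|F| => a b c r; nia.
Qed.

Lemma totally_singular_polar W : totally_singular Q W -> {in W &, forall u v, f u v = 0}.
Proof.
move=> /forallP tsW u v uW vW.
have Qw w : w \in W -> Q w = 0 by move=> wW; apply/eqP; have /implyP/(_ wW) := tsW w.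
by have := QD Q u v; rewrite !Qw ?memvD // !add0r => <-.
Qed.

Lemma singular_orthov_max U W x : max_totally_singular_in Q U W ->
  x \in U -> x \in W^_ -> Q x = 0 -> x \in W.
Proof.
move=> /and3P[WU tsW /forallP maxW] xU xW Qx.
have /implyP := maxW (W + <[x]>)%VS; rewrite addvSl subv_add WU -memvE xU /=.
have -> : totally_singular Q (W + <[x]>).
  apply/forallP => v; apply/implyP => /memv_addP[w wW [_ /vlineP[a ->] ->]].
  have fwx : f w x = 0 by rewrite pC; move/mem_orthovP: xW => /(_ w wW).
  have /implyP/(_ wW)/eqP Qw := forallP tsW w.
  by rewrite QD QZ Qw Qx pZr fwx !mulr0 !addr0.
by move=> /(_ isT)/eqP <-; rewrite memvE addvSr.
Qed.

Lemma exists_max_totally_singular U : exists W, max_totally_singular_in Q U W.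
Proof.
pose P W := (W <= U)%VS && totally_singular Q W.
have P0 : P 0%VS.
  rewrite /P sub0v; apply/forallP => w; apply/implyP; rewrite memv0 => /eqP ->.
  by rewrite Q0.
case: (arg_maxnP (fun W => \dim W) P0) => W /andP[WU tsW] maxW; exists W.
apply/and3P; split=> //; apply/forallP => W'; apply/implyP => /and3P[WW' W'U tsW'].
rewrite eq_sym eqEdim WW'; apply: maxW; exact/andP.
Qed.

(** Count the pairs [x] in [U], [w] in [W] with [Q (x + w) = 0]. Translation by [w] gives [#|W|]
    times the singular count. For fixed [x] the condition is affine in [w]: outside [W^_] it has
    [#|W| / q] solutions; inside it has none or all, and by maximality all exactly for [x] in
    [W]. *)
Lemma singular_count_max U W : nd U -> max_totally_singular_in Q U W ->
  q * n U 0 = q ^+ \dim U + (q ^+ (\dim W).+1 - q ^+ (\dim U - \dim W)).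
Proof.
move=> ndU maxW; have [WU tsW _] := and3P maxW; have F1 := finNzRing_gt1 F.
have Qw w : w \in W -> Q w = 0 by move=> wW; apply/eqP; have /implyP/(_ wW) := forallP tsW w.
have cardE x : (#|[set w in W | f w x == (- Q x)%R]| = \sum_(w in W) (Q (x + w)%R == 0%R : nat))%N.
  rewrite -sum1_card big_mkcond [RHS]big_mkcond; apply: eq_bigr => w _.
  rewrite inE; case wW: (w \in W) => //=.
  by rewrite QD (Qw _ wW) addr0 addrC addr_eq0 pC; case: ifP.
have e1 : (\sum_(x in U) #|F| * #|[set w in W | f w x == (- Q x)%R]| =
   #|F| * (#|F| ^ \dim W * #|value_set Q U 0%R|))%N.
  rewrite -big_distrr; congr (_ * _)%N; rewrite (eq_bigr _ (fun x _ => cardE x)).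
  rewrite exchange_big -card_vspace_set -sum_nat_const /=.
  apply: eq_big => w; first by rewrite inE.
  move=> wW; have wU : w \in U by apply: (subvP WU).
  rewrite -(card_imset (value_set Q U 0) (addIr (- w))) -sum1_card big_mkcond [RHS]big_mkcond.
  apply: eq_bigr => x _.
  have -> : (x \in [set y + - w | y in value_set Q U 0]) = (x \in U) && (Q (x + w) == 0).
    apply/imsetP/andP => [[y]|[xU Qxw]].
      by rewrite inE => /andP[yU Qy] ->; rewrite memvB // subrK.
    by exists (x + w); rewrite ?addrK // inE memvD.
  by case: (x \in U) => //=; case: ifP.
have e2 : (\sum_(x in U) #|F| * #|[set w in W | f w x == (- Q x)%R]| =
   #|F| ^ \dim W * (#|F| * #|F| ^ \dim W) +
   (#|F| ^ \dim U - #|F| ^ \dim (U :&: W^_)) * #|F| ^ \dim W)%N.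
  rewrite (bigID (mem W^_)) /=; congr (_ + _)%N.
    rewrite -{1}card_vspace_set -sum_nat_const [RHS]big_mkcond [LHS]big_mkcond; apply: eq_bigr => x _.
    rewrite card_level_form_dichotomy oppr_eq0 inE; case xW : (x \in W).
      have -> : x \in U by apply: (subvP WU).
      have -> : x \in W^_ by apply/mem_orthovP => w wW; apply: (totally_singular_polar tsW).
      by rewrite Qw ?eqxx.
    case: ifP => // /andP[xU xWp]; rewrite xWp; case: eqP => // Qx.
    by rewrite (singular_orthov_max maxW xU xWp Qx) in xW.
  rewrite -!card_vspace_set -(cardsID [set x | x \in W^_] [set x | x \in U]).
  have -> : [set x | x \in U] :&: [set x | x \in W^_] = [set x | x \in (U :&: W^_)%VS].
    by apply/setP => x; rewrite !inE memv_cap.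
  rewrite addKn -sum_nat_const; apply: eq_big => x; first by rewrite !inE andbC.
  by move=> /andP[_ /negPf xW]; rewrite card_level_form_dichotomy xW card_vspace_set.
have W1 : (#|F| ^ \dim W)%:R != 0 :> rat by rewrite pnatr_eq0 -lt0n expn_gt0 ltnW.
have dimK : \dim (U :&: W^_) = (\dim U - \dim W)%N.
  by have := card_cap_orthov ndU WU => <-; rewrite addnK.
apply: (mulfI W1).
transitivity ((#|F| * (#|F| ^ \dim W * #|value_set Q U 0%R|))%N%:R : rat).
  by rewrite natrM natrM mulrCA.
rewrite -e1 e2 natrD natrM natrM [((_ - _) * _)%:R]natrM natrB; last first.
  by rewrite leq_exp2l // dimvS ?capvSl.
by rewrite dimK !natrX exprS; exact: singular_count_algebra.
Qed.

(** The singular count determines the dimension of every maximal totally singular subspace, and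
    conversely. The type is a universal statement over such subspaces, so the existence of one,
    [W0], is what makes it informative. *)
Lemma has_type_counts s U : nd U -> ~~ odd (\dim U) ->
  has_type Q s U <-> even_counts Q U (type_sign s).
Proof.
move=> ndU U_even.
have WE W : max_totally_singular_in Q U W -> even_counts Q U (type_sign s) <->
   (match s with PlusType => \dim W | MinusType => (\dim W).+1 end == (\dim U)./2).
  move=> maxW; have := singular_count_max ndU maxW.
  have WU : (\dim W <= (\dim U)./2.*2)%N.
    by rewrite even_halfK //; case/and3P: maxW => WU _ _; exact: dimvS.
  rewrite -(witt_index_sign s (q_gt1 F) WU) -{1 2}(even_halfK U_even) => e.
  have D0 : q ^+ (\dim U)./2.+1 - q ^+ (\dim U)./2 != 0.
    by rewrite subr_eq0 eq_sym lt_eqF // ltr_eXn2l ?q_gt1.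
  have key s0 : even_counts Q U s0 ->
      q ^+ (\dim W).+1 - q ^+ ((\dim U)./2.*2 - \dim W) = s0 * (q ^+ (\dim U)./2.+1 - q ^+ (\dim U)./2).
    move=> /(_ 0); rewrite e eqxx mul1r {1}even_halfK // => /addrI ->.
    by rewrite -mulrA mulrBr mulr1 -exprSr.
  split=> [/key -> //|/eqP es].
  have /= := value_counts ndU; rewrite (negPf U_even).
  by case=> H; have := key _ H; rewrite es => /(mulIf D0) ->.
have [W0 maxW0] := exists_max_totally_singular U.
split=> [/andP[_ /forallP/(_ W0)/implyP/(_ maxW0)] H|H]; first exact/(WE _ maxW0).
by rewrite /has_type U_even; apply/forallP => W; apply/implyP => maxW; exact/(WE _ maxW).
Qed.

End Types.

Lemma minus_sign_algebra (r : rat) : 1 < r -> r * 1 = r ^+ 2 + 1 * r ^+ 1 * (1 * r - 1) -> False.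
Proof. by rewrite expr1 => r1 e; nra. Qed.

(** * Invariance and existence of subspaces of prescribed type *)

Section TypedSubspaces.
Variables (F : finFieldType) (d : nat).
Local Notation V := 'rV[F]_d.
Variable Q : quadraticForm V.
Local Notation f := (polar_form Q).
Implicit Types (U W X Y L : {vspace V}) (u v w x y z : V).
Local Notation "U ^_" := (orthov f U) (at level 2, format "U ^_").
Local Notation nd := (nondegenerate_on f).
Local Notation q := (#|F|%:R : rat).
Local Notation n X c := (#|value_set Q X c|%:R : rat).

Lemma card_value_set_isometry g U c : nd fullv -> isometry_of Q g ->
  #|value_set Q (g @: U) c| = #|value_set Q U c|.
Proof.
move=> ndV Qg; rewrite -(card_imset (value_set Q U c) (isometry_inj ndV Qg)).
apply: eq_card => x; rewrite inE; apply/andP/imsetP => [[/memv_imgP[u uU ->]]|[u]].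
  by rewrite Qg => Qu; exists u => //; rewrite inE uU.
by rewrite inE => /andP[uU Qu] ->; rewrite memv_img // Qg.
Qed.

Lemma nd_isometry g U : nd fullv -> isometry_of Q g -> nd U -> nd (g @: U).
Proof.
move=> ndV Qg ndU; apply/ndP => _ /memv_imgP[u uU ->] gu_perp.
rewrite (nd_eq0 ndU uU) ?linear0 // => v vU.
by rewrite -(isometry_polar u v Qg) gu_perp // memv_img.
Qed.

Lemma dim_isometry g U : nd fullv -> isometry_of Q g -> \dim (g @: U) = \dim U.
Proof. by move=> ndV Qg; rewrite limg_dim_eq ?(eqP (isometry_lker ndV Qg)) ?capv0. Qed.

Lemma mem_typed s e U : ~~ odd e ->
  U \in nondeg_subspaces_of_type Q s e <->
  [/\ nd U, \dim U = e & even_counts Q U (type_sign s)].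
Proof.
move=> e_even; rewrite !inE; split=> [/andP[/andP[ndU /eqP dimU] tU]|[ndU dimU cU]].
  by split=> //; apply/has_type_counts; rewrite ?dimU.
by rewrite ndU dimU eqxx; apply/has_type_counts; rewrite ?dimU.
Qed.

Lemma typed_isometry g s e U : nd fullv -> isometry_of Q g -> ~~ odd e ->
  U \in nondeg_subspaces_of_type Q s e -> (g @: U)%VS \in nondeg_subspaces_of_type Q s e.
Proof.
move=> ndV Qg e_even /(mem_typed _ _ e_even)[ndU dimU cU]; apply/mem_typed => //.
rewrite dim_isometry //; split=> //; first exact: nd_isometry.
by move=> c; rewrite card_value_set_isometry // dim_isometry.
Qed.

Lemma even_counts0 : even_counts Q 0 1.
Proof.
move=> c; rewrite dimv0 !expr0 mulr1 mul1r addrC subrK mulrC; congr (_ * _).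
have [->|c0] := eqVneq c 0.
  by rewrite anisotropic_value_set0 // => x; rewrite memv0 => /eqP.
rewrite (_ : value_set _ _ _ = set0) ?cards0 //; apply/setP => x; rewrite !inE memv0.
by case: eqP => // ->; rewrite Q0 eq_sym (negPf c0).
Qed.

Lemma value_set_nonempty X c : nd X -> (2 <= \dim X)%N -> c != 0 ->
  exists2 x, x \in X & Q x = c.
Proof.
move=> ndX X2 c0; have q1 := q_gt1 F.
suff : n X c != 0.
  rewrite pnatr_eq0 -lt0n => /card_gt0P[x]; rewrite inE => /andP[xX /eqP Qx].
  by exists x.
apply/eqP => nX0; have := value_counts ndX; case: ifP => _.
  case=> _ /(_ c c0); rewrite nX0 mulr0 sub0r sqrrN -exprM => e.
  have : q ^+ (\dim X).+1 < q ^+ (\dim X * 2).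
    by rewrite ltr_eXn2l // muln2 -addnn -addn1 ltn_add2l.
  by rewrite -e ltxx.
have lt : q ^+ (\dim X)./2 < q ^+ \dim X.
  by rewrite ltr_eXn2l // ltn_half_double -addnn -addn1 leq_add2l (leq_trans _ X2).
case=> /(_ c); rewrite nX0 (negPf c0) mul0r sub0r mulr0 ?mul1r ?mulN1r ?mulrN1 ?opprK => /esym/eqP.
  by rewrite subr_eq0 gt_eqF.
by rewrite gt_eqF // addr_gt0 // exprn_gt0 // (lt_trans ltr01).
Qed.

(** The map [t ^+ 2 + t] takes the value 0 at both 0 and -1; on a finite set it is not injective,
    hence not surjective. The argument is uniform in the characteristic. *)
Lemma exists_irreducible_quadratic : exists c : F, forall t : F, t ^+ 2 + t + c != 0.
Proof.
have : ~~ [forall c : F, [exists t, t ^+ 2 + t == - c]].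
  apply/negP => /forallP H.
  have inj : injective (fun t : F => t ^+ 2 + t).
    have /image_injP : #|image (fun t : F => t ^+ 2 + t) F| == #|F|.
      rewrite eqn_leq leq_image_card /=; apply: subset_leq_card; apply/subsetP => c _.
      by have /existsP[t /eqP e] := H (- c); rewrite opprK in e; rewrite -e; exact: image_f.
    by move=> inj t t' e; apply: inj.
  have /inj/eqP : (0 : F) ^+ 2 + 0 = (-1) ^+ 2 + (-1) by rewrite sqrrN expr1n subrr expr0n addr0.
  by rewrite eq_sym oppr_eq0 oner_eq0.
case/forallPn => c /existsPn H; exists c => t; have := H t.
by rewrite -addr_eq0.
Qed.

Lemma exists_minus_plane X : nd X -> (4 <= \dim X)%N ->
  exists U, [/\ (U <= X)%VS, nd U, \dim U = 2%N & even_counts Q U (-1)].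
Proof.
move=> ndX X4; have [y [yX y0 Qy]] := exists_singular ndX (ltnW X4).
have [z1 z1X fyz1] := hyperbolic_partner ndX yX y0.
have fyy : f y y = 0 by rewrite polarE Qy addr0.
pose z2 := (f y z1)^-1 *: z1; have fyz2 : f y z2 = 1 by rewrite pZr mulVf.
pose z := z2 - Q z2 *: y.
have fyz : f y z = 1 by rewrite /z fBr fyz2 (pZr Q (Q z2)) fyy mulr0 subr0.
have zX : z \in X by rewrite !(memvB, memvZ).
have Qz : Q z = 0 by rewrite QB (QZ Q (Q z2)) Qy mulr0 addr0 (pZr Q (Q z2)) [f z2 y]pC fyz2 mulr1 subrr.
have fzz : f z z = 0 by rewrite polarE Qz addr0.
clearbody z; clear z2 fyz2.
have fyz0 : f y z != 0 by rewrite fyz oner_eq0.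
have LX : (<[y]> + <[z]> <= X)%VS by rewrite subv_add -!memvE yX.
have [ndL dimL] := nd_plane fyy fyz0.
set L := (<[y]> + <[z]>)%VS in LX ndL dimL.
have ndX' : nd (X :&: L^_) by rewrite -nd_cap_orthov.
have dimX' : (2 <= \dim (X :&: L^_))%N.
  have := dim_cap_orthov ndL LX; rewrite dimL => e; move: X4; rewrite -e.
  by case: (\dim _) => [|[]].
have [c irr] := exists_irreducible_quadratic.
have c0 : c != 0 by have := irr 0; rewrite expr0n !add0r.
have [w wX' Qw] := value_set_nonempty ndX' dimX' c0.
move: wX'; rewrite memv_cap => /andP[wX /mem_orthovP wL].
have fwy : f w y = 0 by rewrite wL // memvE addvSl.
have fwz : f w z = 0 by rewrite wL // memvE addvSr.
(* The pair is chosen so that [Q] becomes [a ^+ 2 + a * b + c * b ^+ 2] on its span, which is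
   anisotropic by the choice of [c]. *)
pose v1 := y + z; pose v2 := z + w.
have Q1 : Q v1 = 1 by rewrite QD Qy Qz fyz !add0r.
have Q2 : Q v2 = c by rewrite QD Qz Qw pC fwz add0r addr0.
have f12 : f v1 v2 = 1.
  by rewrite fDl !fDr fyz fzz [f y w]pC [f z w]pC fwy fwz !addr0.
have Qab a b : Q (a *: v1 + b *: v2) = a ^+ 2 + a * b + b ^+ 2 * c.
  by rewrite QD !QZ pZl pZr Q1 Q2 f12; ring.
have Qab0 a b : Q (a *: v1 + b *: v2) = 0 -> a = 0 /\ b = 0.
  rewrite Qab; have [->|b0 e] := eqVneq b 0.
    by rewrite mulr0 expr0n mul0r !addr0 => /eqP; rewrite sqrf_eq0 => /eqP.
  case/eqP: (irr (a / b)); rewrite -[RHS](mul0r (b ^- 2)) -e.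
  by field.
pose U := (<[v1]> + <[v2]>)%VS.
have v1U : v1 \in U by rewrite memvE addvSl.
have v2U : v2 \in U by rewrite memvE addvSr.
have aU : anisotropic Q U.
  move=> x /memv_addP[_ /vlineP[a ->] [_ /vlineP[b ->] ->]] /Qab0[-> ->].
  by rewrite !scale0r addr0.
have ndU : nd U.
  apply/ndP => x xU xp; apply: aU => //.
  have := xp _ v1U; have := xp _ v2U.
  case/memv_addP: xU => _ /vlineP[a ->] [_ /vlineP[b ->] ->].
  rewrite !fDl !pZl [f v2 v1]pC f12 !polarE Q1 Q2 Qab => e1 e2.
  have eb : b = - (a + a) by apply/eqP; rewrite -addr_eq0 addrC -e2; apply/eqP; ring.
  (* The value of a radical vector is written as a combination of its two orthogonality relations,
     without division by 2. *)
  have -> : a ^+ 2 + a * b + b ^+ 2 * c =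
    - (a * (a * 1 + b * (c + c))) + (b + (a + a)) * (a + b * c) by ring.
  by rewrite e1 eb addNr mulr0 mul0r oppr0 addr0.
have dimU : \dim U = 2%N.
  have v10 : v1 != 0 by apply: contraTneq isT => v10; move: Q1; rewrite v10 Q0 => /esym/eqP; rewrite oner_eq0.
  have v20 : v2 != 0 by apply: contraTneq isT => v20; move: Q2; rewrite v20 Q0 => /esym/eqP; rewrite (negPf c0).
  rewrite dimv_disjoint_sum ?dim_vline ?v10 ?v20 //.
  apply/eqP; rewrite -subv0; apply/subvP => x; rewrite memv_cap memv0.
  case/andP => /vlineP[a ->] /vlineP[b e].
  have [a0 _] : a = 0 /\ - b = 0.
    by apply: Qab0; rewrite scaleNr -e subrr Q0.
  by rewrite a0 scale0r.
exists U; split=> //.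
  by rewrite subv_add -!memvE !memvD.
have := value_counts ndU; rewrite dimU /=; case=> // /(_ 0).
rewrite anisotropic_value_set0 // eqxx dimU /= => e.
by case: (minus_sign_algebra (q_gt1 F) e).
Qed.

(** Hyperbolic planes are split off until one plane of the wanted type remains to be found. The two
    extra dimensions ensure that dimension at least 4 is left then, as a minus plane requires. *)
Lemma exists_typed s k X : (0 < k)%N -> nd X -> (k.*2 + 2 <= \dim X)%N ->
  exists U, [/\ (U <= X)%VS, nd U, \dim U = k.*2 & even_counts Q U (type_sign s)].
Proof.
case: k => // k _; elim: k X => [|k IH] X ndX kX.
  case: s; last by apply: exists_minus_plane.
  have [y [yX y0 Qy]] := exists_singular ndX (ltnW kX).
  have [z zX fyz] := hyperbolic_partner ndX yX y0.
  have fyy : f y y = 0 by rewrite polarE Qy addr0.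
  have [ndL dimL] := nd_plane fyy fyz.
  exists (<[y]> + <[z]>)%VS; split=> //; first by rewrite subv_add -!memvE yX.
  apply: (even_counts_split ndL Qy fyz (subvv _)).
  by rewrite (eqP ndL); exact: even_counts0.
have [|y [yX y0 Qy]] := exists_singular ndX; first by lia.
have [z zX fyz] := hyperbolic_partner ndX yX y0.
have fyy : f y y = 0 by rewrite polarE Qy addr0.
have [ndL dimL] := nd_plane fyy fyz.
set L := (<[y]> + <[z]>)%VS in ndL dimL.
have LX : (L <= X)%VS by rewrite subv_add -!memvE yX.
have ndX' : nd (X :&: L^_) by rewrite -nd_cap_orthov.
have [|U [UX' ndU dimU cU]] := IH _ ndX'.
  have := dim_cap_orthov ndL LX; rewrite dimL => e; move: kX; rewrite -e.
  by rewrite [k.+2.*2]doubleS 2!addSn add2n 2!ltnS.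
move: UX'; rewrite subv_cap => /andP[UX UL].
exists (L + U)%VS; split.
- by rewrite subv_add LX.
- by rewrite nd_addv.
- by rewrite (dim_nd_addv ndL UL) dimL dimU.
apply: (even_counts_split _ Qy fyz (addvSl _ _)); first by rewrite nd_addv.
by rewrite -/L cap_orthov_addv.
Qed.

End TypedSubspaces.

(** * Bounds for the first moment *)

(* With [z := s * q ^- m], a nondegenerate space of dimension [2m] and sign [s] has
   [z ^- 2 / q * singular_density q z] nonzero singular vectors and
   [z ^- 2 / q * (1 - z)] vectors of each nonzero value. *)
Definition singular_density (R : realFieldType) (r z : R) : R := (1 - z) * (1 + r * z).

(* [|V| / (|U| |U'|)] times the sum over all [c] of [n_U c * n_U' c / n_V c], where
   [n_X c] counts the nonzero vectors of value [c] and [a], [b], [z] encode [U], [U'],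
   [V] as above. *)
Definition overlap (R : realFieldType) (r a b z : R) : R :=
  (singular_density r a * singular_density r b / singular_density r z +
   (r - 1) * ((1 - a) * (1 - b) / (1 - z))) / r.

(** The new case compared with hermitian forms is [a = x] or [b = x], where [r * x = 1] reduces the
    last factor to a linear one; the remaining cases are the hermitian inequality. *)
Lemma orthogonal_expectation (R : realFieldType) (x r a b : R) :
  r * x = 1 -> 0 < x <= 1 / 3 ->
  `|a| = x \/ `|a| <= x ^+ 2 -> `|b| = x \/ `|b| <= x ^+ 2 ->
  (1 - a) * (1 - b) * (1 + a + b + r * a * b) <= (1 + x) ^+ 2 * (1 - x).
Proof.
move=> rx /andP[x0 x3] ha hb.
have -> : (1 + x) ^+ 2 * (1 - x) = (1 + x) * (1 - x ^+ 2) by ring.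
have le_x c : `|c| = x \/ `|c| <= x ^+ 2 -> c <= x.
  by move=> h; apply: le_trans (ler_norm c) _; case: h => [->|/le_trans]//; apply; nra.
have plus c : c <= x -> (1 - x) * (1 - c) * (1 + x + c + r * x * c) <= (1 + x) * (1 - x ^+ 2).
  move=> cx; rewrite rx.
  have -> : (1 - x) * (1 - c) * (1 + x + c + 1 * c) = (1 - x) * (1 + x + c * (1 - x) - 2 * c ^+ 2) by ring.
  have -> : (1 + x) * (1 - x ^+ 2) = (1 - x) * (1 + 2 * x + x ^+ 2) by ring.
  rewrite ler_pM2l; last lra.
  by have := sqr_ge0 c; nra.
have sgn c : `|c| = x \/ `|c| <= x ^+ 2 -> c = x \/ (c = - x \/ `|c| <= x ^+ 2).
  case=> [e|]; last by right; right.
  by case: (ger0P c) e => _ <-; [left|right; left; rewrite opprK].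
case: (sgn a ha) => [->|{}ha']; first by apply: plus; exact: le_x.
case: (sgn b hb) => [->|{}hb']; last by apply: unitary_expectation => //; apply/andP; split; lra.
have := plus a (le_x a ha); congr (_ <= _); ring.
Qed.

(** The density is a concave parabola in [z] with vertex at [(r - 1) / (2 * r)]; the last hypothesis
    places the interval to the left of the vertex, so endpoint values bound it. *)
Lemma singular_density_le (R : realFieldType) (r y z : R) : 0 < r -> `|z| <= y ->
  2 * r * y <= r - 1 -> singular_density r z <= singular_density r y.
Proof.
rewrite ler_norml /singular_density => r0 /andP[z1 z2] ry; rewrite -subr_ge0.
have -> : (1 - y) * (1 + r * y) - (1 - z) * (1 + r * z) = (y - z) * (r - 1 - r * (y + z)) by ring.
by rewrite mulr_ge0 //; nra.
Qed.

Lemma singular_density_ge (R : realFieldType) (r y z : R) : 1 < r -> `|z| <= y ->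
  r * y <= 1 -> 2 * r * y <= r - 1 -> (1 + y) * (1 - r * y) <= singular_density r z.
Proof.
rewrite ler_norml /singular_density => r1 /andP[z1 z2] ry ry2; rewrite -subr_ge0.
have -> : (1 - z) * (1 + r * z) - (1 + y) * (1 - r * y) = (y + z) * (r - 1 + r * (y - z)) by ring.
by rewrite mulr_ge0 //; nra.
Qed.

(** Both denominators in [overlap] are at least [(1 + y) * (1 - r * y)]; over this common bound, the
    numerators sum to [r] times the expression of [orthogonal_expectation]. *)
Lemma overlap_le (R : realFieldType) (x r a b z y : R) :
  r * x = 1 -> 0 < x <= 1 / 3 ->
  `|a| = x \/ `|a| <= x ^+ 2 -> `|b| = x \/ `|b| <= x ^+ 2 ->
  `|z| <= y -> y <= x ^+ 2 ->
  overlap r a b z <= (1 + x) ^+ 2 * (1 - x) / ((1 + y) * (1 - r * y)).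
Proof.
move=> rx x03 ha hb zy yx; have [x0 x3] := andP x03.
have y0 : 0 <= y by apply: le_trans (normr_ge0 z) zy.
have r3 : 3 <= r by nra.
have ry : r * y <= x by apply: (@le_trans _ _ (r * x ^+ 2)); [nra|rewrite expr2 mulrA rx mul1r].
have [zy1 zy2] := andP (etrans (esym (ler_norml z y)) zy).
have m_le := singular_density_ge (_ : 1 < r) zy.
set m := (1 + y) * (1 - r * y) in m_le *.
have m0 : 0 < m by rewrite /m mulr_gt0 //; lra.
have {}m_le : m <= singular_density r z by apply: m_le; nra.
have m_le2 : m <= 1 - z by rewrite /m; nra.
have rng c : `|c| = x \/ `|c| <= x ^+ 2 -> - x <= c <= x.
  by move=> h; rewrite -ler_norml; case: h => [->|/le_trans]//; apply; nra.
have /andP[a1 a2] := rng a ha; have /andP[b1 b2] := rng b hb.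
have sd c : - x <= c -> c <= x -> 0 <= singular_density r c.
  by move=> c1 c2; rewrite mulr_ge0 //; nra.
have H := orthogonal_expectation rx x03 ha hb.
rewrite /overlap ler_pdivrMr; last lra.
apply: (@le_trans _ _ ((singular_density r a * singular_density r b + (r - 1) * ((1 - a) * (1 - b))) / m)).
  rewrite [X in _ <= X]mulrDl; apply: lerD.
    apply: ler_wpM2l; first by rewrite mulr_ge0 ?sd.
    by rewrite lef_pV2 ?posrE //; apply: lt_le_trans m_le.
  rewrite -[X in _ <= X]mulrA; apply: ler_wpM2l; first lra.
  apply: ler_wpM2l; first by rewrite mulr_ge0 //; lra.
  by rewrite lef_pV2 ?posrE //; lra.
rewrite [X in _ <= X]mulrAC ler_pM2r ?invr_gt0 //.
have -> : singular_density r a * singular_density r b + (r - 1) * ((1 - a) * (1 - b)) =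
  (1 - a) * (1 - b) * (1 + a + b + r * a * b) * r by rewrite /singular_density; ring.
by rewrite ler_pM2r //; lra.
Qed.

Lemma even_bound_complementary (R : realFieldType) (r a b z K : R) :
  let x := r^-1 in 3 <= r ->
  `|a| = x \/ `|a| <= x ^+ 2 -> `|b| = x \/ `|b| <= x ^+ 2 -> `|z| <= x ^+ 2 ->
  r = 3 /\ K = 57 / 20 \/ 4 <= r /\ K = 25 / 8 ->
  overlap r a b z <= K * ((r - 1) / r).
Proof.
move=> x r3 ha hb hz hK.
have rx : r * x = 1 by rewrite mulfV; lra.
have x0 : 0 < x by rewrite invr_gt0; lra.
have x3 : x <= 1 / 3 by nra.
have x03 : 0 < x <= 1 / 3 by rewrite x0.
apply: le_trans (overlap_le rx x03 ha hb hz (lexx _)) _.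
have -> : r * x ^+ 2 = x by rewrite expr2 mulrA rx mul1r.
have -> : (r - 1) / r = 1 - x by rewrite mulrBl rx mul1r.
rewrite ler_pdivrMr; last by rewrite mulr_gt0 //; nra.
have -> : K * (1 - x) * ((1 + x ^+ 2) * (1 - x)) = K * (1 - x) * (1 + x ^+ 2) * (1 - x) by ring.
rewrite ler_pM2r; last lra.
case: hK => [[r3' ->]|[r4 ->]].
  have -> : x = 1 / 3 by rewrite /x r3'; field.
  by lra.
have x4 : x <= 1 / 4 by nra.
by nra.
Qed.

(** The parameters are [A] for the whole space, [c] and [c'] for the perps of [U] and [U'], and
    [rho = A^2 / (a^2 b^2)]. The first summand is the contribution of common vectors, the second
    that of flags. *)
Lemma even_bound_ge4 (R : realFieldType) (r a b A c c' rho : R) :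
  let x := r^-1 in 4 <= r ->
  `|a| = x \/ `|a| <= x ^+ 2 -> `|b| = x \/ `|b| <= x ^+ 2 ->
  `|A| <= x ^+ 3 -> `|c| <= x ^+ 2 -> `|c'| <= x ^+ 2 -> 0 <= rho <= x ^+ 2 ->
  rho * overlap r a b A +
    singular_density r c * singular_density r c' / singular_density r A * overlap r a b (r * A)
  <= 25 / 8 * ((r - 1) / r).
Proof.
move=> x r4 ha hb hA hc hc' /andP[rho0 rho2].
have rx : r * x = 1 by rewrite mulfV; lra.
have x0 : 0 < x by rewrite invr_gt0; lra.
have rE : (r - 1) / r = 1 - x by rewrite mulrBl rx mul1r.
clearbody x; have x4 : x <= 1 / 4 by nra.
have x03 : 0 < x <= 1 / 3 by rewrite x0; lra.
have rx2 : r * x ^+ 2 = x by rewrite expr2 mulrA rx mul1r.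
have rx3 : r * x ^+ 3 = x ^+ 2 by rewrite exprS mulrA rx mul1r.
have A2 : `|A| <= x ^+ 2 by apply: le_trans hA _; nra.
have rA2 : `|r * A| <= x ^+ 2.
  by rewrite normrM gtr0_norm; [rewrite -rx3 ler_pM2l //; lra|lra].
have := overlap_le rx x03 ha hb A2 (lexx _); have := overlap_le rx x03 ha hb rA2 (lexx _).
rewrite rx2.
have -> : (1 + x) ^+ 2 * (1 - x) / ((1 + x ^+ 2) * (1 - x)) = (1 + x) ^+ 2 / (1 + x ^+ 2).
  by field; clear - x0 x4; apply/andP; split; nra.
set B := (1 + x) ^+ 2 / (1 + x ^+ 2) => H2 H1.
have sle := singular_density_le (_ : 0 < r).
have wM z : `|z| <= x ^+ 2 -> singular_density r z <= (1 - x ^+ 2) * (1 + x).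
  move=> hz; have -> : (1 - x ^+ 2) * (1 + x) = singular_density r (x ^+ 2).
    by rewrite /singular_density rx2.
  by apply: sle => //; [clear - r4; lra|rewrite -mulrA rx2; clear - r4 x4; lra].
have w1 := wM c hc; have w2 := wM c' hc'.
have v : (1 + x ^+ 3) * (1 - x ^+ 2) <= singular_density r A.
  rewrite -rx3; apply: singular_density_ge => //; first by clear - r4; lra.
    by rewrite rx3; clear - x0 x4; nra.
  by rewrite -mulrA rx3; clear - r4 x0 x4; nra.
have x2s : x ^+ 2 <= x / 4 by clear - x0 x4; nra.
have x22 : 0 < x ^+ 2 by rewrite exprn_gt0.
have x3s : 0 < x ^+ 3 by rewrite exprn_gt0.
have B0 : 0 < B by rewrite divr_gt0 //; clear - x0; nra.
have w0 z : `|z| <= x ^+ 2 -> 0 <= singular_density r z.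
  rewrite ler_norml => /andP[z1 z2]; rewrite mulr_ge0 //; first by clear - z2 x2s x4; lra.
  have : r * - x ^+ 2 <= r * z by rewrite ler_pM2l //; clear - r4; lra.
  by rewrite mulrN rx2; clear - x4; lra.
pose M := (1 - x ^+ 2) * (1 + x).
have M0 : 0 < M by rewrite /M mulr_gt0 //; clear - x0 x4 x2s; lra.
have V0 : 0 < (1 + x ^+ 3) * (1 - x ^+ 2) by rewrite mulr_gt0 //; clear - x3s x4 x2s; lra.
have sA : 0 < singular_density r A := lt_le_trans V0 v.
have T2 : singular_density r c * singular_density r c' / singular_density r A * overlap r a b (r * A)
   <= M * M / ((1 + x ^+ 3) * (1 - x ^+ 2)) * B.
  apply: (@le_trans _ _ (singular_density r c * singular_density r c' / singular_density r A * B)).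
    apply: ler_wpM2l => //; apply: divr_ge0; last exact: ltW.
    by apply: mulr_ge0; apply: w0.
  rewrite ler_pM2r //; apply: ler_pM; rewrite ?invr_ge0 ?(ltW sA) //.
  - by apply: mulr_ge0; apply: w0.
  - by apply: ler_pM => //; apply: w0.
  - by rewrite lef_pV2 ?posrE.
have T1 : rho * overlap r a b A <= x ^+ 2 * B.
  apply: (@le_trans _ _ (rho * B)); first exact: ler_wpM2l.
  by rewrite ler_pM2r.
apply: le_trans (lerD T1 T2) _.
have -> : x ^+ 2 * B + M * M / ((1 + x ^+ 3) * (1 - x ^+ 2)) * B =
  (1 + x) ^+ 2 * (x ^+ 2 * (1 + x ^+ 3) + (1 - x ^+ 2) * (1 + x) ^+ 2) / ((1 + x ^+ 2) * (1 + x ^+ 3)).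
  rewrite /B /M; field; clear - x22 x3s x4 x2s; apply/and3P; split; lra.
rewrite ler_pdivrMr; last by rewrite mulr_gt0 //; clear - x22 x3s; lra.
rewrite rE -subr_ge0.
(* The first bracket decreases in [x]; at [x = 1 / 4], that is [q = 4], it is about 0.13, which
   shows how little room [25 / 8] leaves. *)
have -> : 25 / 8 * (1 - x) * ((1 + x ^+ 2) * (1 + x ^+ 3)) -
   (1 + x) ^+ 2 * (x ^+ 2 * (1 + x ^+ 3) + (1 - x ^+ 2) * (1 + x) ^+ 2) =
  (17 / 8 - 57 / 8 * x - 23 / 8 * x ^+ 2 - 2 * (x * x ^+ 2)) +
  7 / 8 * (x ^+ 2 * x ^+ 2) + (x ^+ 3 * x ^+ 2) * (49 / 8 - 33 / 8 * x - x ^+ 2) by field.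
have x12 : x * x ^+ 2 <= x / 16 by clear - x0 x4 x22 x2s; nra.
apply: addr_ge0; last first.
  by clear - x22 x3s x4 x2s; apply: mulr_ge0; [apply: mulr_ge0; lra|lra].
have : 0 <= x ^+ 2 * x ^+ 2 by apply: mulr_ge0; exact: ltW.
by clear - x4 x2s x12; lra.
Qed.

Lemma even_bound_3 (R : realFieldType) (a b A c c' rho : R) :
  `|a| = 1 / 3 \/ `|a| <= 1 / 9 -> `|b| = 1 / 3 \/ `|b| <= 1 / 9 ->
  `|A| <= 1 / 81 -> `|c| <= 1 / 9 -> `|c'| <= 1 / 9 ->
  `|c| <= 1 / 27 \/ `|c'| <= 1 / 27 -> 0 <= rho <= 1 / 9 ->
  rho * overlap 3 a b A +
    singular_density 3 c * singular_density 3 c' / singular_density 3 A * overlap 3 a b (3 * A)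
  <= 19 / 10.
Proof.
move=> ha hb hA hc hc' hcc /andP[rho0 rho2].
have x03 : 0 < (1 / 3 : R) <= 1 / 3 by apply/andP; split; lra.
have rx : 3 * (1 / 3) = 1 :> R by field.
have sq : (1 / 3) ^+ 2 = 1 / 9 :> R by field.
rewrite -sq in ha hb.
have rA2 : `|3 * A| <= 1 / 27 by rewrite normrM gtr0_norm; clear - hA; lra.
have A2 : `|A| <= 1 / 27 by lra.
have y27 : (1 / 27 : R) <= (1 / 3) ^+ 2 by lra.
have := overlap_le rx x03 ha hb A2 y27; have := overlap_le rx x03 ha hb rA2 y27.
have -> : (1 + 1 / 3) ^+ 2 * (1 - 1 / 3) / ((1 + 1 / 27) * (1 - 3 * (1 / 27))) = 9 / 7 :> R by field.
move=> H2 H1.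
have sle := singular_density_le (_ : 0 < (3 : R)).
have w9 z : `|z| <= 1 / 9 -> singular_density 3 z <= 32 / 27 :> R.
  by move=> /sle H; apply: le_trans (H _ _) _; rewrite /singular_density; clear; lra.
have w27 z : `|z| <= 1 / 27 -> singular_density 3 z <= 260 / 243 :> R.
  by move=> /sle H; apply: le_trans (H _ _) _; rewrite /singular_density; clear; lra.
have v : 2132 / 2187 <= singular_density 3 A.
  have H := singular_density_ge (_ : 1 < (3 : R)) hA.
  by apply: le_trans (H _ _ _); clear; lra.
have w0 z : `|z| <= 1 / 9 -> 0 <= singular_density 3 z :> R.
  by rewrite ler_norml => /andP[z1 z2]; rewrite mulr_ge0 //; clear - z1 z2; lra.
have ww : singular_density 3 c * singular_density 3 c' <= 32 / 27 * (260 / 243).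
  case: hcc => [h|h]; [rewrite mulrC|]; apply: ler_pM; rewrite ?w0 ?w9 ?w27 //.
have T2 : singular_density 3 c * singular_density 3 c' / singular_density 3 A * overlap 3 a b (3 * A)
   <= 32 / 27 * (260 / 243) / (2132 / 2187) * (9 / 7).
  apply: (@le_trans _ _ (singular_density 3 c * singular_density 3 c' / singular_density 3 A * (9 / 7))).
    by apply: ler_wpM2l => //; apply: divr_ge0; [apply: mulr_ge0; apply: w0|clear - v; lra].
  rewrite ler_pM2r; last by clear; lra.
  apply: ler_pM => //; first by apply: mulr_ge0; apply: w0.
    by rewrite invr_ge0; clear - v; lra.
  by rewrite lef_pV2 ?posrE //; clear - v; lra.
have T1 : rho * overlap 3 a b A <= 1 / 9 * (9 / 7).
  apply: (@le_trans _ _ (rho * (9 / 7))); first exact: ler_wpM2l.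
  by clear - rho2; lra.
by apply: le_trans (lerD T1 T2) _; clear; lra.
Qed.

(** With [|A|] up to [1 / 27], separate bounds for the densities and overlaps exceed [19 / 10]. The
    signs of the planes are therefore distinguished and the overlaps computed exactly; an
    anisotropic plane has density 0 and loses the singular summand. *)
Lemma even_bound_3_planes (R : realFieldType) (a b A c c' rho : R) :
  `|a| = 1 / 3 -> `|b| = 1 / 3 ->
  `|A| <= 1 / 27 -> `|c| <= 1 / 9 -> `|c'| <= 1 / 9 -> 0 <= rho <= 1 / 9 ->
  rho * overlap 3 a b A +
    singular_density 3 c * singular_density 3 c' / singular_density 3 A * overlap 3 a b (3 * A)
  <= 19 / 10.
Proof.
move=> ha hb hA hc hc' /andP[rho0 rho2].
have sle := singular_density_le (_ : 0 < (3 : R)).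
have w9 z : `|z| <= 1 / 9 -> singular_density 3 z <= 32 / 27 :> R.
  by move=> /sle H; apply: le_trans (H _ _) _; rewrite /singular_density; lra.
have w0 z : `|z| <= 1 / 9 -> 0 <= singular_density 3 z :> R.
  by rewrite ler_norml => /andP[z1 z2]; rewrite mulr_ge0 //; clear - z1 z2; lra.
have [A1 A2] := andP (etrans (esym (ler_norml A (1 / 27))) hA).
have ww : singular_density 3 c * singular_density 3 c' <= 32 / 27 * (32 / 27).
  by apply: ler_pM; rewrite ?w0 ?w9.
have ww0 : 0 <= singular_density 3 c * singular_density 3 c' by rewrite mulr_ge0 ?w0.
set w := singular_density 3 c * _ in ww ww0 *.
have sgn z : `|z| = 1 / 3 -> z = 1 / 3 \/ z = - (1 / 3) :> R.
  by case: (ger0P z) => _ e; [left|right; rewrite -e opprK].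
(* The density of the whole space is kept together with the second overlap, where factors cancel.
   The coefficient [1024 / 729] is [(32 / 27) ^+ 2]. *)
have key h1 h2 : overlap 3 a b A <= h1 -> h1 <= 27 / 20 ->
    overlap 3 a b (3 * A) / singular_density 3 A <= h2 -> h1 / 9 + 1024 / 729 * h2 <= 19 / 10 ->
    0 <= h1 -> 0 <= h2 ->
    rho * overlap 3 a b A + w / singular_density 3 A * overlap 3 a b (3 * A) <= 19 / 10.
  move=> o1 _ o2 H h10 h20; apply: le_trans H; apply: lerD.
    apply: (@le_trans _ _ (rho * h1)); first exact: ler_wpM2l.
    have : rho * h1 <= 1 / 9 * h1 by apply: ler_wpM2r.
    by clear; lra.
  rewrite [X in X <= _]mulrAC -[X in X <= _]mulrA; apply: (@le_trans _ _ (w * h2)); first exact: ler_wpM2l.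
  by have : w * h2 <= 32 / 27 * (32 / 27) * h2; [apply: ler_wpM2r|clear; lra].
have AA : A ^+ 2 <= 1 / 729 by clear - A1 A2; nra.
have d1 : 0 < 1 - A by clear - A2; lra.
have d2 : 0 < 1 + 3 * A by clear - A1; lra.
have d3 : 0 < 1 - 3 * A by clear - A2; lra.
have d4 : 0 < 1 + 9 * A by clear - A1; lra.
have d5 : 26 / 27 * (80 / 81) <= (1 - A) * ((1 + 3 * A) * (1 - 3 * A)).
  have -> : (1 + 3 * A) * (1 - 3 * A) = 1 - 9 * A ^+ 2 by ring.
  by clear - A2 AA; apply: ler_pM; lra.
have d50 : 0 < (1 - A) * ((1 + 3 * A) * (1 - 3 * A)) by rewrite !mulr_gt0.
have n1 : 1 - A != 0 by rewrite gt_eqF.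
have n2 : 1 + 3 * A != 0 by rewrite gt_eqF.
have n3 : 1 - 3 * A != 0 by rewrite gt_eqF.
have n4 : 1 + 9 * A != 0 by rewrite gt_eqF.
have mixed h : 0 <= h <= 32 / 27 -> (forall z, 1 - z != 0 -> 1 + 3 * z != 0 -> overlap 3 a b z = h / (1 - z)) ->
    rho * overlap 3 a b A + w / singular_density 3 A * overlap 3 a b (3 * A) <= 19 / 10.
  move=> /andP[h0 h1] oE; have n5 : 1 + 3 * (3 * A) != 0.
    by have -> : 1 + 3 * (3 * A) = 1 + 9 * A by ring.
  apply: (key (h * (27 / 26)) (h / (26 / 27 * (80 / 81)))); last 2 first.
  - by clear - h0; lra.
  - by clear - h0; lra.
  - rewrite oE //; apply: ler_wpM2l => //.
    have -> : (27 / 26 : R) = (26 / 27)^-1 by field.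
    by rewrite lef_pV2 ?posrE //; clear - A2; lra.
  - by clear - h1; lra.
  - rewrite oE // /singular_density -[X in X <= _]mulrA; apply: ler_wpM2l => //.
    have -> : (1 - 3 * A)^-1 / ((1 - A) * (1 + 3 * A)) = ((1 - A) * ((1 + 3 * A) * (1 - 3 * A)))^-1.
      by field; rewrite n1 n2 n3.
    by rewrite lef_pV2 ?posrE //; clear - d5; lra.
  - by clear - h1; lra.
case: (sgn a ha) => ea; case: (sgn b hb) => eb.
- have e z : 1 - z != 0 -> 1 + 3 * z != 0 ->
      overlap 3 a b z = 8 / 9 * (1 + z) / ((1 - z) * (1 + 3 * z)).
    by move=> z1 z2; rewrite ea eb /overlap /singular_density; field; rewrite z1 z2.
  have n5 : 1 + 3 * (3 * A) != 0.
    by have -> : 1 + 3 * (3 * A) = 1 + 9 * A by ring.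
  have d6 : 19 / 25 <= (1 - 3 * A) * (1 + 9 * A) * (1 - A).
    have -> : (1 - 3 * A) * (1 + 9 * A) * (1 - A) = 1 + 5 * A - 33 * A ^+ 2 + 27 * A * A ^+ 2 by ring.
    have : - (1 / 27) * A ^+ 2 <= A * A ^+ 2 by rewrite ler_wpM2r ?sqr_ge0.
    by clear - A1 AA; lra.
  apply: (key 1 (8 / 9 / (19 / 25))); first 2 last.
  - rewrite e // /singular_density.
    have -> : 8 / 9 * (1 + 3 * A) / ((1 - 3 * A) * (1 + 3 * (3 * A))) / ((1 - A) * (1 + 3 * A)) =
      8 / 9 * ((1 - 3 * A) * (1 + 9 * A) * (1 - A))^-1.
      by field; rewrite n1 n2 n3 n4.
    apply: ler_wpM2l; first by clear; lra.
    by rewrite lef_pV2 ?posrE //; [clear - d6; lra|clear; lra].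
  - by clear; lra.
  - by clear; lra.
  - by clear; lra.
  - rewrite e // ler_pdivrMr ?mulr_gt0 //.
    have -> : (1 - A) * (1 + 3 * A) = 1 + 2 * A - 3 * A ^+ 2 by ring.
    by clear - A1 A2 AA; lra.
  by clear; lra.
- apply: (mixed (16 / 27)); first by clear; apply/andP; split; lra.
  by move=> z z1 z2; rewrite ea eb /overlap /singular_density; field; rewrite z1 z2.
- apply: (mixed (16 / 27)); first by clear; apply/andP; split; lra.
  by move=> z z1 z2; rewrite ea eb /overlap /singular_density; field; rewrite z1 z2.
apply: (mixed (32 / 27)); first by clear; apply/andP; split; lra.
by move=> z z1 z2; rewrite ea eb /overlap /singular_density; field; rewrite z1 z2.
Qed.

(** Here [E] and [E'] are the sizes of [U] and [U'], and [N = q^(d-1)], so [N - 1] counts nonzero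
    singular vectors of the whole space and [N / E - 1] those of the perp of [U]. *)
Lemma odd_bound (R : realFieldType) (x r a b E E' N S K : R) :
  r * x = 1 -> 3 <= r ->
  `|a| = x \/ `|a| <= x ^+ 2 -> `|b| = x \/ `|b| <= x ^+ 2 ->
  r ^+ 2 <= E -> r ^+ 2 <= E' -> E * E' <= N ->
  S = E * E' * x * ((1 - a) * (1 - b) * (1 + a + b + r * a * b)) ->
  r = 3 /\ K = 57 / 20 \/ 4 <= r /\ K = 25 / 8 ->
  S / (N - 1) + (N / E - 1) * (N / E' - 1) / (N - 1) * (S / (N / r - r)) <= K * ((r - 1) / r).
Proof.
move=> rx r3 ha hb E2 E'2 EN -> hK.
have r0 : 0 < r by clear - r3; lra.
have xE : x = r^-1 by apply: (mulfI (lt0r_neq0 r0)); rewrite rx mulfV ?gt_eqF.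
have x0 : 0 < x by rewrite xE invr_gt0.
have x3 : x <= 1 / 3 by clear - rx r3 x0; nra.
have x03 : 0 < x <= 1 / 3 by rewrite x0.
have := orthogonal_expectation rx x03 ha hb.
set g := (1 - a) * _ * _; set sg := (1 + x) ^+ 2 * (1 - x) => gs.
have r9 : 9 <= r ^+ 2 by clear - r3; nra.
have E0 : 0 < E by clear - r9 E2; lra.
have E'0 : 0 < E' by clear - r9 E'2; lra.
have N81 : 81 <= N by clear - r9 E2 E'2 EN; nra.
have E_le : E <= N by clear - E0 r9 E'2 EN; nra.
have E'_le : E' <= N by clear - E'0 r9 E2 EN; nra.
have N2 : r ^+ 2 < N by clear - E2 E'2 EN E0 r9; nra.
have sg0 : 0 < sg by rewrite /sg mulr_gt0 ?exprn_gt0 //; clear - x0 x3; lra.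
have N10 : 0 < N - 1 by clear - N81; lra.
have Nr0 : 0 < N - r ^+ 2 by clear - N2; lra.
(* Both summands share the factor [g]; the flag part has coefficient at most 1, and the rest at most
   [81 / 80 * x] since [N >= 81]. *)
have e1 : E * E' * x * g / (N - 1) + (N / E - 1) * (N / E' - 1) / (N - 1) * (E * E' * x * g / (N / r - r)) =
   g * (E * E' / (N - 1) * x + (N - E) * (N - E') / ((N - 1) * (N - r ^+ 2))).
  rewrite xE; field; rewrite !gt_eqF //=; clear - N2; lra.
rewrite e1.
have t1 : E * E' / (N - 1) * x <= 81 / 80 * x.
  by rewrite ler_pM2r // ler_pdivrMr //; clear - N81 EN; lra.
have t2 : (N - E) * (N - E') / ((N - 1) * (N - r ^+ 2)) <= 1.
  rewrite ler_pdivrMr ?mul1r; last exact: mulr_gt0.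
  by apply: ler_pM; clear - N2 N81 E0 E'0 E_le E'_le E2 E'2 r9; lra.
have t10 : 0 <= E * E' / (N - 1) * x by rewrite !mulr_ge0 ?invr_ge0 // ltW.
have t20 : 0 <= (N - E) * (N - E') / ((N - 1) * (N - r ^+ 2)).
  by apply: divr_ge0; apply: mulr_ge0; rewrite ?subr_ge0 // ltW // -subr_gt0.
set t1' := E * E' / _ * x in t1 t10 *; set t2' := _ / _ in t2 t20 *.
have tle : t1' + t2' <= 1 + 81 / 80 * x by clear - t1 t2; lra.
have t0 : 0 <= t1' + t2' by rewrite addr_ge0.
apply: (@le_trans _ _ (sg * (1 + 81 / 80 * x))).
  apply: (@le_trans _ _ (sg * (t1' + t2'))); first exact: ler_wpM2r.
  by rewrite ler_pM2l.
have -> : (r - 1) / r = 1 - x by rewrite mulrBl -xE rx mul1r.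
rewrite /sg; clear - x0 x3 r3 hK rx.
have -> : (1 + x) ^+ 2 * (1 - x) * (1 + 81 / 80 * x) = ((1 + x) ^+ 2 * (1 + 81 / 80 * x)) * (1 - x) by ring.
rewrite ler_pM2r; last lra.
case: hK => -[r3' ->].
  have -> : x = 1 / 3 by clear - r3' rx; nra.
  by lra.
have x4 : x <= 1 / 4 by clear - r3' rx x0; nra.
have : (1 + x) ^+ 2 <= 25 / 16 by clear - x4 x0; nra.
have : 0 <= (1 + x) ^+ 2 by exact: sqr_ge0.
by clear - x0 x4; nra.
Qed.

Lemma even_terms (R : realFieldType) (r a b A : R) :
  r != 0 -> a != 0 -> b != 0 -> A != 0 ->
  1 - A != 0 -> 1 + r * A != 0 ->
  let u0 := a ^- 2 / r * singular_density r a in let u1 := a ^- 2 / r * (1 - a) in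
  let w0 := b ^- 2 / r * singular_density r b in let w1 := b ^- 2 / r * (1 - b) in
  let v0 := A ^- 2 / r * singular_density r A in let v1 := A ^- 2 / r * (1 - A) in
  u0 * w0 / v0 + (r - 1) * (u1 * w1 / v1) = A ^+ 2 / (a ^+ 2 * b ^+ 2) * overlap r a b A.
Proof.
move=> r0 a0 b0 A0 A1 A2 /=; rewrite /overlap /singular_density; field.
by rewrite r0 a0 b0 A0 A1 A2.
Qed.

(** The flag counts [p0] and [p1] factor through the quotient of the perp of [y] by its line: its
    dimension is smaller by 2 and its sign the same, so its parameter is [r * A]. Hence the second
    overlap is taken there. *)
Lemma even_terms_flags (R : realFieldType) (r a b A c c' p0 p1 : R) :
  r != 0 -> a != 0 -> b != 0 -> A != 0 ->
  1 - A != 0 -> 1 + r * A != 0 -> 1 - r * A != 0 -> 1 + r * (r * A) != 0 ->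
  let u0 := a ^- 2 / r * singular_density r a in let u1 := a ^- 2 / r * (1 - a) in
  let w0 := b ^- 2 / r * singular_density r b in let w1 := b ^- 2 / r * (1 - b) in
  let v0 := A ^- 2 / r * singular_density r A in
  let t := A ^- 2 * a ^+ 2 / r * singular_density r c in
  let t' := A ^- 2 * b ^+ 2 / r * singular_density r c' in
  r * p0 = v0 * (r * (v0 + 1) - (A ^- 2 - A ^- 2 / r) - r ^+ 2) ->
  r * p1 = v0 * (A ^- 2 * (1 - A) - (A ^- 2 - A ^- 2 / r)) ->
  u0 * t * w0 * t' / p0 + (r - 1) * (u1 * t * w1 * t' / p1) =
  singular_density r c * singular_density r c' / singular_density r A * overlap r a b (r * A).
Proof.
move=> r0 a0 b0 A0 A1 A2 A3 A4 /= e0 e1.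
have -> : p0 = A ^- 2 / r * singular_density r A / r * (A ^- 2 / r * singular_density r (r * A)).
  by apply: (mulfI r0); rewrite e0 /singular_density; field; rewrite r0 A0.
have -> : p1 = A ^- 2 / r * singular_density r A / r * (A ^- 2 / r * (1 - r * A)).
  by apply: (mulfI r0); rewrite e1 /singular_density; field; rewrite r0 A0.
rewrite /overlap /singular_density; field.
by rewrite r0 a0 b0 A0 A1 A2 A3 A4.
Qed.

Lemma val_set_algebra0 (q z N : rat) : q != 0 -> z != 0 ->
  q * N = z ^- 2 + z^-1 * (q - 1) -> N - 1 = z ^- 2 / q * singular_density q z.
Proof.
move=> q0 z0 e; apply: (mulfI q0); rewrite mulrBr e /singular_density.
by field; rewrite q0 z0.
Qed.

Lemma val_set_algebra (q z N : rat) : q != 0 -> z != 0 ->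
  q * N = z ^- 2 - z^-1 -> N = z ^- 2 / q * (1 - z).
Proof. by move=> q0 z0 e; apply: (mulfI q0); rewrite e; field; rewrite q0 z0. Qed.

(** * Flag counts, and value counts in terms of the small parameter *)

Section Counts.
Variables (F : finFieldType) (d : nat).
Local Notation V := 'rV[F]_d.
Variable Q : quadraticForm V.
Local Notation f := (polar_form Q).
Implicit Types (U W X Y L : {vspace V}) (u v w x y z : V).
Local Notation "U ^_" := (orthov f U) (at level 2, format "U ^_").
Local Notation nd := (nondegenerate_on f).
Local Notation q := (#|F|%:R : rat).
Local Notation n X c := (#|value_set Q X c|%:R : rat).
Local Notation nz X c := (#|val_set Q X c|%:R : rat).

Lemma card_val_set X c : nz X c = n X c - (c == 0)%:R.
Proof.
rewrite (cardsD1 0 (value_set Q X c)) inE mem0v Q0 [0 == c]eq_sym natrD [RHS]addrC addKr.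
by congr (_%:R); apply: eq_card => u; rewrite !inE andbCA.
Qed.

(** For each singular [y], remove from the vectors of value [c] those not orthogonal to [y], whose
    values are uniformly distributed, and those on the line of [y], which all have value 0. *)
Lemma card_flag_set c : nd fullv ->
  q * #|flag_set Q c|%:R = nz fullv 0 *
    (q * n fullv c - (q ^+ \dim {:V} - q ^+ (\dim {:V}).-1) - (c == 0)%:R * q ^+ 2).
Proof.
move=> ndV.
pose T y := [set x : V | [&& x \in <[y]>^_, x \notin <[y]>%VS & Q x == c]].
have -> : #|flag_set Q c| = (\sum_(y in val_set Q fullv 0%R) #|T y|)%N.
  rewrite -sum1_card (partition_big (fun p => p.2) (mem (val_set Q fullv 0))) /=; last first.
    by move=> p; rewrite inE => /andP[].
  apply: eq_bigr => y yV; rewrite sum1_card.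
  have inj : injective (fun x : V => (x, y)) by move=> x x' [].
  rewrite -(card_imset (T y) inj); apply: eq_card => -[x y'].
  rewrite -topredE /= inE /=; apply/andP/imsetP => [[/and4P[_ xy xNy Qx] /eqP ey]|[x' + [-> ->]]].
    by exists x; rewrite ?ey // inE -ey xy xNy.
  by rewrite inE => ->; rewrite yV.
rewrite natr_sum mulr_sumr [RHS]mulr_natl -[RHS]sumr_const; apply: eq_bigr => y.
rewrite inE memvf => /and3P[_ y0 /eqP Qy].
have off := card_value_set_off_orthov c (memvf y) (nd_radical_notin ndV (memvf y) y0) Qy.
have fyy : f y y = 0 by rewrite polarE Qy addr0.
have -> : #|T y|%:R = n fullv c - #|[set x in (fullv : {vspace V}) | (f x y != 0) && (Q x == c)]|%:R - (c == 0)%:R * q.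
  rewrite -(cardsID [set x | f x y != 0] (value_set Q fullv c)).
  rewrite -(cardsID [set x | x \in <[y]>%VS] (value_set Q fullv c :\: [set x | f x y != 0])).
  have -> : value_set Q fullv c :&: [set x | f x y != 0] = [set x in (fullv : {vspace V}) | (f x y != 0) && (Q x == c)].
    by apply/setP => x; rewrite !inE memvf andbC.
  have -> : value_set Q fullv c :\: [set x | f x y != 0] :\: [set x | x \in <[y]>%VS] = T y.
    apply/setP => x; rewrite !inE memvf mem_orthov1.
    by case: (x \in <[y]>%VS); case: (f x y == 0); case: (Q x == c).
  have -> : #|(value_set Q fullv c :\: [set x | f x y != 0]) :&: [set x | x \in <[y]>%VS]| = ((c == 0%R) * #|F|)%N.
    have [c0|c0] := eqVneq c 0.
      have := card_vspace_set <[y]>; rewrite dim_vline y0 expn1 mul1n => <-; apply: eq_card => x; rewrite !inE memvf c0.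
      case xy: (x \in <[y]>%VS); rewrite ?andbF //; move/vlineP: xy => [a ->].
      by rewrite pZl fyy mulr0 eqxx QZ Qy mulr0 eqxx.
    rewrite mul0n; apply/eqP; rewrite cards_eq0; apply/eqP/setP => x; rewrite !inE.
    case xy: (x \in <[y]>%VS); rewrite ?andbF //; move/vlineP: xy => [a ->].
    by rewrite QZ Qy mulr0 [0 == c]eq_sym (negPf c0) !andbF.
  by rewrite !natrD natrM [X in X - _ - _]addrC addrK [X in X - _]addrC addrK.
rewrite !mulrBr; congr (_ - _ - _); last by rewrite mulrCA expr2.
transitivity ((#|F| ^ \dim {:V} - #|F| ^ (\dim {:V}).-1)%N%:R : rat).
  by rewrite -natrM; congr (_%:R); rewrite [LHS]mulnC; exact: off.
by rewrite natrB ?natrX // leq_exp2l ?finNzRing_gt1 ?leq_pred.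
Qed.

Lemma sum_values (g : F -> rat) t : (forall c, c != 0 -> g c = t) ->
  \sum_c g c = g 0 + (q - 1) * t.
Proof.
move=> gt; rewrite (bigD1 0) //= (eq_bigr (fun=> t)) // sumr_const cardC1.
by rewrite -[t *+ _]mulr_natl -subn1 natrB // ltnW ?finNzRing_gt1.
Qed.

Lemma even_counts_val_sets X s (z := s * q^-1 ^+ (\dim X)./2) : ~~ odd (\dim X) ->
  s = 1 \/ s = -1 -> even_counts Q X s ->
  [/\ z ^- 2 = q ^+ \dim X, nz X 0 = z ^- 2 / q * singular_density q z
    & forall c, c != 0 -> nz X c = z ^- 2 / q * (1 - z)].
Proof.
move=> even_X s1 hX; set k := (\dim X)./2 in z *.
have dX : \dim X = (k + k)%N by rewrite addnn -[LHS]odd_double_half (negPf even_X).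
have q0 : q != 0 by rewrite gt_eqF ?(lt_trans ltr01) ?ltr1n ?finNzRing_gt1.
have s2 : s * s = 1 by case: s1 => ->; rewrite ?mulrNN mulr1.
have s0 : s != 0 by apply: contra_eq_neq s2 => ->; rewrite mul0r eq_sym oner_eq0.
have z0 : z != 0 by rewrite mulf_neq0 ?expf_neq0 ?invr_neq0.
have zV : z^-1 = s * q ^+ k.
  by rewrite /z invfM exprVn invrK; congr (_ * _); apply: (mulfI s0); rewrite s2 mulfV.
have z2 : z ^- 2 = q ^+ \dim X by rewrite -exprVn zV expr2 mulrACA s2 mul1r dX exprD.
split=> // [|c c0]; rewrite card_val_set.
  by rewrite eqxx; apply: val_set_algebra0 => //; rewrite hX z2 zV eqxx mul1r.
rewrite (negPf c0) subr0; apply: val_set_algebra => //.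
by rewrite hX z2 zV (negPf c0) mul0r sub0r mulrN1.
Qed.

End Counts.

Lemma even_bound_eq3 (R : realFieldType) (r a b A c c' rho : R) :
  let x := r^-1 in r = 3 ->
  `|a| = x \/ `|a| <= x ^+ 2 -> `|b| = x \/ `|b| <= x ^+ 2 ->
  `|A| <= x ^+ 3 -> `|c| <= x ^+ 2 -> `|c'| <= x ^+ 2 -> 0 <= rho <= x ^+ 2 ->
  (`|a| = x /\ `|b| = x) \/ (`|A| <= x ^+ 4 /\ (`|c| <= x ^+ 3 \/ `|c'| <= x ^+ 3)) ->
  rho * overlap r a b A +
    singular_density r c * singular_density r c' / singular_density r A * overlap r a b (r * A)
  <= 57 / 20 * ((r - 1) / r).
Proof.
move=> x er; have -> : 57 / 20 * ((r - 1) / r) = 19 / 10 by rewrite er; field.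
have -> : x ^+ 2 = 1 / 9 by rewrite /x er; field.
have -> : x ^+ 3 = 1 / 27 by rewrite /x er; field.
have -> : x ^+ 4 = 1 / 81 by rewrite /x er; field.
have -> : x = 1 / 3 by rewrite /x er; field.
rewrite er => ha hb hA hc hc' hrho [[a3 b3]|[A4 c3]].
  exact: even_bound_3_planes.
exact: even_bound_3.
Qed.

Section EvenSums.
Variables (r : rat).
Hypothesis r3 : 3 <= r.
Local Notation x := (r^-1).

Lemma normr_sign_exp (s : rat) i : s = 1 \/ s = -1 -> `|s * x ^+ i| = x ^+ i.
Proof.
have x0 : 0 <= x ^+ i by rewrite exprn_ge0 // invr_ge0 (le_trans _ r3).
by case=> ->; rewrite ?mul1r ?mulN1r ?normrN ger0_norm.
Qed.

Lemma exp_inv_le i j : (j <= i)%N -> x ^+ i <= x ^+ j.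
Proof.
have r1 : 1 <= r by apply: le_trans r3.
move=> ji; apply: ler_wiXn2l => //.
  by rewrite invr_ge0 (le_trans ler01).
by rewrite invf_le1 ?(lt_le_trans ltr01).
Qed.

Lemma sign_exp_cases (s : rat) i : s = 1 \/ s = -1 -> (0 < i)%N ->
  `|s * x ^+ i| = x \/ `|s * x ^+ i| <= x ^+ 2.
Proof.
move=> hs; rewrite normr_sign_exp //; case: i => [|[|i]] // _; first by left.
by right; apply: exp_inv_le.
Qed.

Lemma singular_density_neq0 (z : rat) : `|z| <= x ^+ 2 -> 1 - z != 0 /\ 1 + r * z != 0.
Proof.
have r0 : 0 < r by apply: lt_le_trans r3.
have rx : r * x = 1 by rewrite mulfV ?gt_eqF.
have rx2 : r * x ^+ 2 = x by rewrite expr2 mulrA rx mul1r.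
have x3 : x < 1 by rewrite invf_lt1 // (lt_le_trans _ r3).
have x0 : 0 < x by rewrite invr_gt0.
have x2 : x ^+ 2 < 1 by rewrite expr_lt1 // ltW.
rewrite ler_norml => /andP[z1 z2]; split; rewrite gt_eqF //.
  by rewrite subr_gt0 (le_lt_trans z2).
have : r * (- x ^+ 2) <= r * z by rewrite ler_pM2l.
rewrite mulrN rx2 => h; rewrite -(opprK (r * z)) subr_gt0.
by rewrite (le_lt_trans _ x3) // lerNl.
Qed.

Variables (sa sb sA sc sc' K : rat) (i j : nat).
Hypotheses (ha : sa = 1 \/ sa = -1) (hb : sb = 1 \/ sb = -1) (hA : sA = 1 \/ sA = -1)
  (hc : sc = 1 \/ sc = -1) (hc' : sc' = 1 \/ sc' = -1) (i0 : (0 < i)%N) (j0 : (0 < j)%N)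
  (hK : r = 3 /\ K = 57 / 20 \/ 4 <= r /\ K = 25 / 8).
Local Notation a := (sa * x ^+ i).
Local Notation b := (sb * x ^+ j).

Lemma sign_sq (s : rat) : s = 1 \/ s = -1 -> s ^+ 2 = 1.
Proof. by case=> ->; rewrite ?sqrrN expr1n. Qed.

Lemma even_complementary_le (A := sA * x ^+ (i + j)) :
  A ^+ 2 / (a ^+ 2 * b ^+ 2) * overlap r a b A <= K * ((r - 1) / r).
Proof.
have -> : A ^+ 2 / (a ^+ 2 * b ^+ 2) = 1.
  rewrite /A !exprMn (sign_sq ha) (sign_sq hb) (sign_sq hA) !mul1r -exprMn -exprD divff // !expf_neq0 // invr_neq0 //.
  by rewrite gt_eqF // (lt_le_trans _ r3).
rewrite mul1r; apply: even_bound_complementary => //; try exact: sign_exp_cases.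
by rewrite normr_sign_exp // exp_inv_le // (leq_add i0 j0).
Qed.

Lemma even_sum_le h (A := sA * x ^+ (i + j + h)) (c := sc * x ^+ (j + h)) (c' := sc' * x ^+ (i + h)) :
  (0 < h)%N ->
  A ^+ 2 / (a ^+ 2 * b ^+ 2) * overlap r a b A +
    singular_density r c * singular_density r c' / singular_density r A * overlap r a b (r * A)
  <= K * ((r - 1) / r).
Proof.
move=> h0; have r0 : r != 0 by rewrite gt_eqF // (lt_le_trans _ r3).
have -> : A ^+ 2 / (a ^+ 2 * b ^+ 2) = x ^+ (h * 2).
  rewrite /A !exprMn (sign_sq ha) (sign_sq hb) (sign_sq hA) !mul1r -exprMn -exprD [x ^+ (i + j + h)]exprD exprMn.
  by rewrite [X in X / _]mulrC mulfK -?exprM // !expf_neq0 // invr_neq0.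
have a_cases := sign_exp_cases ha i0; have b_cases := sign_exp_cases hb j0.
have nA : `|A| = x ^+ (i + j + h) by rewrite normr_sign_exp.
have nc : `|c| = x ^+ (j + h) by rewrite normr_sign_exp.
have nc' : `|c'| = x ^+ (i + h) by rewrite normr_sign_exp.
have h2 : 0 <= x ^+ (h * 2) <= x ^+ 2.
  rewrite exprn_ge0 ?invr_ge0 ?(le_trans _ r3) //= exp_inv_le //.
  by rewrite muln2 -addnn (leq_add h0 h0).
have A3 : `|A| <= x ^+ 3 by rewrite nA exp_inv_le // (leq_add (leq_add i0 j0) h0).
have c2 : `|c| <= x ^+ 2 by rewrite nc exp_inv_le // (leq_add j0 h0).
have c'2 : `|c'| <= x ^+ 2 by rewrite nc' exp_inv_le // (leq_add i0 h0).
case: hK => -[er ->]; last exact: even_bound_ge4.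
apply: even_bound_eq3 => //; rewrite nA nc nc'.
(* For [q = 3], two planes need the exact evaluation; any larger dimension makes [A] and one of [c],
   [c'] smaller by a further factor of 3. *)
have [/andP[/eqP i1 /eqP j1]|] := boolP ((i == 1%N) && (j == 1%N)).
  by left; rewrite !normr_sign_exp // i1 j1.
rewrite negb_and => ij; right; split.
  by rewrite exp_inv_le //; move: i0 j0 h0 ij; clear; lia.
case/orP: ij => ij; [right|left]; rewrite exp_inv_le //.
  by move: i0 h0 ij; clear; lia.
by move: j0 h0 ij; clear; lia.
Qed.

End EvenSums.

(** * Orthogonal spaces *)

Lemma even_summand m n k : (m + n)%N = k -> ~~ odd k -> ~~ odd m -> ~~ odd n.
Proof. by move=> <-; rewrite oddD => + /negPf m_even; rewrite m_even. Qed.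

Section OverlapSums.
Variables (F : finFieldType) (d : nat).
Local Notation V := 'rV[F]_d.
Variable Q : quadraticForm V.
Local Notation f := (polar_form Q).
Implicit Types (U W X Y L : {vspace V}) (u v w x y z : V).
Local Notation "U ^_" := (orthov f U) (at level 2, format "U ^_").
Local Notation nd := (nondegenerate_on f).
Local Notation q := (#|F|%:R : rat).
Local Notation n X c := (#|value_set Q X c|%:R : rat).
Local Notation nz X c := (#|val_set Q X c|%:R : rat).

Definition containing_term U U' c := nz U c * nz U' c / nz fullv c.
Definition incident_term U U' c :=
  nz U c * nz U^_ 0 * nz U' c * nz U'^_ 0 / #|flag_set Q c|%:R.

Hypothesis ndV : nd fullv.
Hypothesis q3 : 3 <= q.

Lemma dim_orthov U : nd U -> (\dim U + \dim U^_ = d)%N.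
Proof.
by move=> ndU; have := dim_cap_orthov ndU (subvf U); rewrite capfv dimvf /dim /= mul1n.
Qed.

Lemma nd_orthov U : nd U -> nd U^_.
Proof. by move=> ndU; rewrite -[U^_]capfv -nd_cap_orthov ?subvf. Qed.

Lemma sign_counts X : nd X -> ~~ odd (\dim X) ->
  exists2 s : rat, s = 1 \/ s = -1 & even_counts Q X s.
Proof.
move=> ndX X_even; have := value_counts ndX; rewrite (negPf X_even).
by case=> ?; [exists 1; [left|]|exists (-1); [right|]].
Qed.

Variables (U U' : {vspace V}) (K : rat).
Hypotheses (ndU : nd U) (ndU' : nd U') (U_even : ~~ odd (\dim U)) (U'_even : ~~ odd (\dim U')).
Hypotheses (U0 : (0 < \dim U)%N) (U'0 : (0 < \dim U')%N).
Hypothesis hK : q = 3 /\ K = 57 / 20 \/ 4 <= q /\ K = 25 / 8.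

Let q0 : q != 0. Proof. by rewrite gt_eqF // (lt_le_trans _ q3). Qed.

Let dimV : \dim (fullv : {vspace V}) = d.
Proof. by rewrite dimvf /dim /= mul1n. Qed.

Lemma sign_exp_neq0 (s : rat) i : s = 1 \/ s = -1 -> s * q^-1 ^+ i != 0.
Proof.
move=> hs; rewrite mulf_neq0 ?expf_neq0 ?invr_neq0 //.
by case: hs => ->; rewrite ?oppr_eq0 oner_eq0.
Qed.

Lemma containing_sum_complementary : (\dim U + \dim U' = d)%N ->
  \sum_c containing_term U U' c <= K * ((q - 1) / q).
Proof.
move=> dE; have V_even : ~~ odd (\dim (fullv : {vspace V})).
  by rewrite dimV -dE oddD (negPf U_even) (negPf U'_even).
have [sU hsU cU] := sign_counts ndU U_even; have [sU' hsU' cU'] := sign_counts ndU' U'_even.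
have [sV hsV cV] := sign_counts ndV V_even.
have [_ u0 u1] := even_counts_val_sets U_even hsU cU.
have [_ u'0 u'1] := even_counts_val_sets U'_even hsU' cU'.
have [_ v0 v1] := even_counts_val_sets V_even hsV cV.
have i0 : (0 < (\dim U)./2)%N by move: U0 U_even; clear; case: (\dim U) => [|[]].
have j0 : (0 < (\dim U')./2)%N by move: U'0 U'_even; clear; case: (\dim U') => [|[]].
have hE : (\dim (fullv : {vspace V}))./2 = ((\dim U)./2 + (\dim U')./2)%N.
  by have := congr1 half dE; rewrite halfD (negPf U_even) dimV => <-.
rewrite hE in v0 v1.
have := even_complementary_le q3 hsU hsU' hsV i0 j0 hK.
apply: le_trans; have n1 : (1 : F) != 0 := oner_neq0 F.
rewrite (sum_values (t := containing_term U U' 1)); last first.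
  by move=> c c0; rewrite /containing_term !u1 // !u'1 // !v1.
rewrite /containing_term u0 u'0 v0 u1 // u'1 // v1 //.
have [A1 A2] : 1 - sV * q^-1 ^+ ((\dim U)./2 + (\dim U')./2) != 0 /\
  1 + q * (sV * q^-1 ^+ ((\dim U)./2 + (\dim U')./2)) != 0.
  apply: singular_density_neq0 => //.
  by rewrite normr_sign_exp // exp_inv_le // (leq_add i0 j0).
by rewrite even_terms // sign_exp_neq0.
Qed.

Lemma overlap_sum_even : (\dim U + \dim U' < d)%N -> ~~ odd d ->
  \sum_c containing_term U U' c + \sum_c incident_term U U' c <= K * ((q - 1) / q).
Proof.
move=> dE d_even; have V_even : ~~ odd (\dim (fullv : {vspace V})) by rewrite dimV.
have dW := dim_orthov ndU; have dW' := dim_orthov ndU'.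
have W_even : ~~ odd (\dim U^_) := even_summand dW d_even U_even.
have W'_even : ~~ odd (\dim U'^_) := even_summand dW' d_even U'_even.
have [sU hsU cU] := sign_counts ndU U_even; have [sU' hsU' cU'] := sign_counts ndU' U'_even.
have [sV hsV cV] := sign_counts ndV V_even.
have [sW hsW cW] := sign_counts (nd_orthov ndU) W_even.
have [sW' hsW' cW'] := sign_counts (nd_orthov ndU') W'_even.
have [eU u0 u1] := even_counts_val_sets U_even hsU cU.
have [eU' u'0 u'1] := even_counts_val_sets U'_even hsU' cU'.
have [eV v0 v1] := even_counts_val_sets V_even hsV cV.
have [eW w0 _] := even_counts_val_sets W_even hsW cW.
have [eW' w'0 _] := even_counts_val_sets W'_even hsW' cW'.
have i0 : (0 < (\dim U)./2)%N by move: U0 U_even; clear; case: (\dim U) => [|[]].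
have j0 : (0 < (\dim U')./2)%N by move: U'0 U'_even; clear; case: (\dim U') => [|[]].
(* Here [2 * h] is the excess of [d] over the two dimensions; it is positive since the complementary
   case is treated apart. *)
have [h [h0 hV hW hW']] : exists h, [/\ (0 < h)%N,
    (\dim (fullv : {vspace V}))./2 = ((\dim U)./2 + (\dim U')./2 + h)%N,
    (\dim U^_)./2 = ((\dim U')./2 + h)%N & (\dim U'^_)./2 = ((\dim U)./2 + h)%N].
  exists (d./2 - (\dim U)./2 - (\dim U')./2)%N; rewrite dimV.
  move: dE dW dW' d_even U_even U'_even W_even W'_even; clear.
  by move: (\dim U) (\dim U') (\dim U^_) (\dim U'^_); split; lia.
rewrite hV in v0 v1 eV; rewrite hW in w0 eW; rewrite hW' in w'0 eW'.
have := even_sum_le q3 hsU hsU' hsV hsW hsW' i0 j0 hK h0.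
set a := sU * _ in eU u0 u1 *; set b := sU' * _ in eU' u'0 u'1 *.
set A := sV * _ in eV v0 v1 *; set c := sW * _ in eW w0 *; set c' := sW' * _ in eW' w'0 *.
have a0 : a != 0 by exact: sign_exp_neq0.
have b0 : b != 0 by exact: sign_exp_neq0.
have A0 : A != 0 by exact: sign_exp_neq0.
have nA : `|A| <= q^-1 ^+ 3.
  by rewrite /A normr_sign_exp // exp_inv_le // (leq_add (leq_add i0 j0) h0).
have [A1 A2] : 1 - A != 0 /\ 1 + q * A != 0.
  by apply: singular_density_neq0 => //; apply: le_trans nA _; exact: exp_inv_le.
have [A3 A4] : 1 - q * A != 0 /\ 1 + q * (q * A) != 0.
  apply: singular_density_neq0 => //; rewrite normrM ger0_norm ?ler0n //.
  by rewrite -(ler_pM2l (_ : 0 < q^-1)) ?invr_gt0 ?(lt_le_trans _ q3) // mulKf // -exprS.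
have eWA : c ^- 2 = A ^- 2 * a ^+ 2.
  have qV : q ^+ \dim {:V} = q ^+ \dim U * q ^+ \dim U^_ by rewrite -exprD dW dimV.
  by rewrite eW eV qV -eU mulrAC mulVf ?expf_neq0 ?mul1r.
have eW'A : c' ^- 2 = A ^- 2 * b ^+ 2.
  have qV : q ^+ \dim {:V} = q ^+ \dim U' * q ^+ \dim U'^_ by rewrite -exprD dW' dimV.
  by rewrite eW' eV qV -eU' mulrAC mulVf ?expf_neq0 ?mul1r.
rewrite eWA in w0; rewrite eW'A in w'0.
have NV0 : n fullv 0 = nz fullv 0 + 1 by rewrite card_val_set eqxx subrK.
have eV1 : q ^+ (\dim {:V}).-1 = A ^- 2 / q.
  apply: (mulIf q0); rewrite -exprSr prednK ?eV ?divfK // dimV.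
  by apply: leq_ltn_trans dE.
have p0 := card_flag_set 0 ndV; rewrite NV0 -eV eV1 eqxx mul1r in p0.
have p1 : forall c1, c1 != 0 -> q * #|flag_set Q c1|%:R =
    nz fullv 0 * (A ^- 2 * (1 - A) - (A ^- 2 - A ^- 2 / q)).
  move=> c1 c10; rewrite card_flag_set // -eV eV1 (negPf c10) mul0r subr0.
  have <- : nz fullv c1 = n fullv c1 by rewrite card_val_set (negPf c10) subr0.
  by rewrite (v1 c1 c10) [q * (_ * (1 - A))]mulrA [q * (_ / q)]mulrCA mulfV ?mulr1.
have n1 : (1 : F) != 0 := oner_neq0 F.
apply: le_trans; apply: lerD.
  rewrite (sum_values (t := containing_term U U' 1)); last first.
    by move=> c1 c10; rewrite /containing_term !u1 // !u'1 // !v1.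
  by rewrite /containing_term u0 u'0 v0 u1 // u'1 // v1 // even_terms.
rewrite (sum_values (t := incident_term U U' 1)); last first.
  move=> c1 c10; rewrite /incident_term !u1 // !u'1 //; congr (_ / _).
  by apply: (mulfI q0); rewrite !p1.
rewrite /incident_term u0 u'0 w0 w'0 u1 // u'1 //.
rewrite (even_terms_flags (p1 := #|flag_set Q 1|%:R) c c' q0 a0 b0 A0 A1 A2 A3 A4) //.
  by rewrite p0 v0.
by rewrite p1 // v0.
Qed.

End OverlapSums.

Lemma sqr_ge9 (r : rat) : 3 <= r -> 9 <= r ^+ 2.
Proof. by nra. Qed.

Lemma inv_conj (M N D : rat) : M ^+ 2 - N != 0 -> D ^+ 2 = N ->
  (M + D)^-1 = (M - D) / (M ^+ 2 - N).
Proof.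
move=> h e; have e2 : (M + D) * (M - D) = M ^+ 2 - N by rewrite -e; ring.
have h2 : M + D != 0 by apply: contraNneq h => h; rewrite -e2 h mul0r.
by apply: (mulfI h2); rewrite mulfV // mulrA e2 mulfV.
Qed.

(** Multiplying by the conjugate [M - D c] makes all denominators equal, and the unknown signs of
    [D c] then cancel in the sum. This is how the odd case manages without the quadratic
    character. *)
Lemma sum_inv_conj (F : finFieldType) (D : F -> rat) (M N : rat) :
  M ^+ 2 - N != 0 -> (forall c, c != 0 -> D c ^+ 2 = N) -> \sum_(c | c != 0) D c = 0 ->
  \sum_(c | c != 0) (M + D c)^-1 = (#|F|%:R - 1) * M / (M ^+ 2 - N).
Proof.
move=> h sq s0; rewrite (eq_bigr (fun c => (M - D c) / (M ^+ 2 - N))); last first.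
  by move=> c c0; apply: inv_conj => //; exact: sq.
rewrite -mulr_suml sumrB s0 subr0 sumr_const cardC1; congr (_ / _).
by rewrite -[LHS]mulr_natl -subn1 natrB // ltnW ?finNzRing_gt1.
Qed.

Lemma odd_terms (r a b S1 S2 E E' N v0 p0 w w' s1 s2 : rat) :
  r != 0 -> N - 1 != 0 -> N / r - r != 0 -> N != 0 ->
  E = a ^- 2 -> E' = b ^- 2 -> a != 0 -> b != 0 ->
  v0 = N - 1 -> p0 = (N - 1) * (N / r - r) ->
  s1 = (r - 1) * N / (N ^+ 2 - N) -> s2 = (r - 1) * (N / r) / ((N / r) ^+ 2 - N) ->
  let u0 := a ^- 2 / r * singular_density r a in let u1 := a ^- 2 / r * (1 - a) in
  let u'0 := b ^- 2 / r * singular_density r b in let u'1 := b ^- 2 / r * (1 - b) in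
  let S := E * E' * r^-1 * ((1 - a) * (1 - b) * (1 + a + b + r * a * b)) in
  S1 = u0 * u'0 / v0 + u1 * u'1 * s1 ->
  S2 = u0 * w * u'0 * w' / p0 + u1 * w * u'1 * w' * (N - 1)^-1 * s2 ->
  S1 = S / (N - 1) /\ S2 = w * w' / (N - 1) * (S / (N / r - r)).
Proof.
move=> r0 N1 Nr N0 -> -> a0 b0 -> -> -> -> /= -> ->.
have Nr2 : N - r ^+ 2 != 0.
  have rE : N / r - r = (N - r ^+ 2) / r by field.
  by apply: contraNneq Nr => e; rewrite rE e mul0r.
have -> : N ^+ 2 - N = N * (N - 1) by ring.
have -> : (N / r) ^+ 2 - N = N / r * (N / r - r) by field.
rewrite /singular_density; split; field; rewrite r0 N1 a0 b0 N0 //=.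
by rewrite mulNr -expr2 Nr2.
Qed.

(** * Overlap sums in odd-dimensional spaces *)

Section OddSum.
Variables (F : finFieldType) (d : nat).
Local Notation V := 'rV[F]_d.
Variable Q : quadraticForm V.
Local Notation f := (polar_form Q).
Implicit Types (U W X Y L : {vspace V}) (u v w x y z : V).
Local Notation "U ^_" := (orthov f U) (at level 2, format "U ^_").
Local Notation nd := (nondegenerate_on f).
Local Notation q := (#|F|%:R : rat).
Local Notation n X c := (#|value_set Q X c|%:R : rat).
Local Notation nz X c := (#|val_set Q X c|%:R : rat).

Lemma odd_counts_val_sets X : odd_counts Q X -> (0 < \dim X)%N ->
  let N := q ^+ (\dim X).-1 in let D c := n X c - N in
  [/\ nz X 0 = N - 1, forall c, c != 0 -> D c ^+ 2 = N & \sum_(c | c != 0) D c = 0].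
Proof.
move=> [n0 n1] X0 /=; set N := q ^+ _.
have qN : q ^+ \dim X = q * N by rewrite -exprS prednK.
have q0 : q != 0 by rewrite gt_eqF // (lt_trans ltr01) // q_gt1.
have n0E : n X 0 = N by apply: (mulIf q0); rewrite n0 qN mulrC.
split; first by rewrite card_val_set n0E eqxx.
  move=> c c0; have := n1 c c0; rewrite qN -mulrBr exprMn (exprS q (\dim X)) qN mulrA -expr2.
  by apply: mulfI; rewrite expf_neq0.
rewrite sumrB sumr_const cardC1 -[N *+ _]mulr_natl -subn1 natrB; last first.
  by rewrite ltnW ?finNzRing_gt1.
have := sum_value_sets Q X; rewrite (bigD1 0) //= n0E qN => /(canRL (addKr _)) ->.
by rewrite mulrBl mul1r [- N + _]addrC subrr.
Qed.

Hypothesis ndV : nd fullv.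
Hypothesis q3 : 3 <= q.
Variables (U U' : {vspace V}) (K : rat).
Hypotheses (ndU : nd U) (ndU' : nd U') (U_even : ~~ odd (\dim U)) (U'_even : ~~ odd (\dim U')).
Hypotheses (U0 : (0 < \dim U)%N) (U'0 : (0 < \dim U')%N).
Hypothesis hK : q = 3 /\ K = 57 / 20 \/ 4 <= q /\ K = 25 / 8.

Lemma overlap_sum_odd : (\dim U + \dim U' <= d)%N -> odd d ->
  \sum_c containing_term Q U U' c + \sum_c incident_term Q U U' c <= K * ((q - 1) / q).
Proof.
move=> dE d_odd.
have dimV : \dim (fullv : {vspace V}) = d by rewrite dimvf /dim /= mul1n.
have q0 : q != 0 by rewrite gt_eqF // (lt_le_trans _ q3).
have dW := dim_orthov ndU; have dW' := dim_orthov ndU'.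
have [W_odd W'_odd] : odd (\dim U^_) /\ odd (\dim U'^_).
  move: (congr1 odd dW) (congr1 odd dW'); rewrite !oddD (negPf U_even) (negPf U'_even) d_odd.
  by split.
have V_odd : odd (\dim (fullv : {vspace V})) by rewrite dimV.
have [sU hsU cU] := sign_counts ndU U_even; have [sU' hsU' cU'] := sign_counts ndU' U'_even.
have [eU u0 u1] := even_counts_val_sets U_even hsU cU.
have [eU' u'0 u'1] := even_counts_val_sets U'_even hsU' cU'.
have cV := value_counts ndV; rewrite V_odd in cV.
have cW := value_counts (nd_orthov ndV ndU); rewrite W_odd in cW.
have cW' := value_counts (nd_orthov ndV ndU'); rewrite W'_odd in cW'.
have [v0 vD sumD] := odd_counts_val_sets cV (odd_gt0 V_odd).
have [w0 _ _] := odd_counts_val_sets cW (odd_gt0 W_odd).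
have [w'0 _ _] := odd_counts_val_sets cW' (odd_gt0 W'_odd).
have i0 : (0 < (\dim U)./2)%N by move: U0 U_even; clear; case: (\dim U) => [|[]].
have j0 : (0 < (\dim U')./2)%N by move: U'0 U'_even; clear; case: (\dim U') => [|[]].
have ha := sign_exp_cases q3 hsU i0; have hb := sign_exp_cases q3 hsU' j0.
have a0 := sign_exp_neq0 q3 (\dim U)./2 hsU; have b0 := sign_exp_neq0 q3 (\dim U')./2 hsU'.
set a := sU * _ in eU u0 u1 ha a0; set b := sU' * _ in eU' u'0 u'1 hb b0.
set N := q ^+ (\dim {:V}).-1 in v0 vD sumD.
have qge1 : 1 <= q by apply: le_trans q3.
have E2 : q ^+ 2 <= q ^+ \dim U.
  by apply: ler_weXn2l => //; move: U0 U_even; clear; case: (\dim U) => [|[]].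
have E'2 : q ^+ 2 <= q ^+ \dim U'.
  by apply: ler_weXn2l => //; move: U'0 U'_even; clear; case: (\dim U') => [|[]].
have dV1 : (\dim U + \dim U' <= d.-1)%N.
  move: dE d_odd U_even U'_even; clear; move: (\dim U) (\dim U') => m m'; lia.
have EN : q ^+ \dim U * q ^+ \dim U' <= N.
  by rewrite -exprD /N dimV; apply: ler_weXn2l.
have Wsub X : nd X -> odd (\dim X^_) -> q ^+ (\dim X^_).-1 = N / q ^+ \dim X.
  move=> ndX X_odd; apply: (mulIf (expf_neq0 (\dim X) q0)); rewrite divfK ?expf_neq0 //.
  rewrite -exprD /N dimV; congr (_ ^+ _); have := dim_orthov ndX; move: (odd_gt0 X_odd).
  by clear; move: (\dim X) (\dim X^_) => m m'; lia.
rewrite (Wsub U) // in w0; rewrite (Wsub U') // in w'0.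
have q9 : 9 <= q ^+ 2 by exact: sqr_ge9.
have N81 : q ^+ 2 * 9 <= N.
  apply: le_trans EN; apply: ler_pM => //; [exact: le_trans q9|exact: le_trans E'2].
have N2 : q ^+ 2 < N by apply: lt_le_trans N81; rewrite ltr_pMr ?ltr1n // (lt_le_trans _ q9).
have N1 : N - 1 != 0 by rewrite gt_eqF // subr_gt0 (le_lt_trans _ N2) // (le_trans _ q9).
have Nr : N / q - q != 0.
  by rewrite subr_eq0 eq_sym -(inj_eq (mulIf q0)) divfK // -expr2 lt_eqF.
have N0 : N != 0 by rewrite expf_neq0.
have NV0 : n fullv 0 = nz fullv 0 + 1 by rewrite card_val_set eqxx subrK.
have qN : q ^+ \dim {:V} = q * N by rewrite -exprS prednK // odd_gt0.
have p0 := card_flag_set 0 ndV; rewrite NV0 qN -/N v0 eqxx mul1r in p0.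
have {}p0 : #|flag_set Q 0|%:R = (N - 1) * (N / q - q).
  by apply: (mulfI q0); rewrite p0; field.
pose D c := n fullv c - N.
have p1 c : c != 0 -> #|flag_set Q c|%:R = (N - 1) * (N / q + D c).
  move=> c0; apply: (mulfI q0); rewrite card_flag_set // qN -/N v0 (negPf c0) mul0r subr0 /D.
  by field.
(* The vector counts in the denominators are [N + D c], and the flag counts are proportional to
   [N / q + D c], with the same deviation [D c]. *)
have s1 := sum_inv_conj (_ : N ^+ 2 - N != 0) vD sumD.
have s2 := sum_inv_conj (_ : (N / q) ^+ 2 - N != 0) vD sumD.
have h1 : N ^+ 2 - N != 0 by rewrite expr2 -{3}[N]mulr1 -mulrBr mulf_neq0.
have h2 : (N / q) ^+ 2 - N != 0.
  have -> : (N / q) ^+ 2 - N = N / q * (N / q - q) by field.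
  by rewrite !mulf_neq0 ?invr_neq0.
have := odd_bound (mulfV q0) q3 ha hb E2 E'2 EN erefl hK.
have [||-> ->] // := odd_terms (S1 := \sum_c containing_term Q U U' c)
  (S2 := \sum_c incident_term Q U U' c) (w := N / q ^+ \dim U - 1) (w' := N / q ^+ \dim U' - 1)
  q0 N1 Nr N0 (esym eU) (esym eU') a0 b0 v0 p0 (s1 h1) (s2 h2).
- rewrite (bigD1 0) //= mulr_sumr /containing_term u0 u'0; congr (_ + _).
  apply: eq_bigr => c c0; rewrite u1 // u'1 //; congr (_ * _^-1).
  by rewrite addrC subrK card_val_set (negPf c0) subr0.
rewrite (bigD1 0) //= mulr_sumr /incident_term u0 u'0 w0 w'0; congr (_ + _).
by apply: eq_bigr => c c0; rewrite u1 // u'1 // p1 // [((N - 1) * _)^-1]invfM [LHS]mulrA.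
Qed.

End OddSum.

Section OrthogonalCase.
Variables (F : finFieldType) (d : nat).
Local Notation V := 'rV[F]_d.
Variable Q : quadraticForm V.
Local Notation f := (polar_form Q).
Implicit Types (U W X Y L : {vspace V}) (u v w x y z : V).
Local Notation "U ^_" := (orthov f U) (at level 2, format "U ^_").
Local Notation nd := (nondegenerate_on f).
Local Notation q := (#|F|%:R : rat).

Variables (s s' : subspace_type) (e e' : nat) (K : rat).
Hypothesis ndV : nd fullv.
Hypotheses (e_gt0 : (0 < e)%N) (e'_gt0 : (0 < e')%N) (e_even : ~~ odd e) (e'_even : ~~ odd e').
Hypothesis le_d : (e + e' <= d)%N.
Hypothesis hK : q = 3 /\ K = 57 / 20 \/ 4 <= q /\ K = 25 / 8.
Local Notation A s e := (nondeg_subspaces_of_type Q s e).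

Let q3 : 3 <= q.
Proof. by case: hK => -[h _]; rewrite ?h // (le_trans _ h). Qed.

Let F3 : (2 < #|F|)%N.
Proof. by rewrite -(ler_nat rat). Qed.

Let dimV : \dim (fullv : {vspace V}) = d.
Proof. by rewrite dimvf /dim /= mul1n. Qed.

Lemma card_bad_partners_le U : U \in A s e ->
  (q - 1) * #|bad_partners Q (A s' e') U|%:R <= #|A s' e'|%:R * (K * ((q - 1) / q)).
Proof.
move=> /(mem_typed _ _ _ e_even)[ndU dimU _].
have A_isometry g U' : isometry_of Q g -> U' \in A s' e' -> (g @: U')%VS \in A s' e'.
  by move=> Qg; exact: typed_isometry.
have A_nd U' : U' \in A s' e' -> nd U' by case/(mem_typed _ _ _ e'_even).
have A_dim U' : U' \in A s' e' -> \dim U' = e' by case/(mem_typed _ _ _ e'_even).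
have U_even : ~~ odd (\dim U) by rewrite dimU.
have U'_even U' : U' \in A s' e' -> ~~ odd (\dim U') by move=> /A_dim ->.
have U0 : (0 < \dim U)%N by rewrite dimU.
have U'0 U' : U' \in A s' e' -> (0 < \dim U')%N by move=> /A_dim ->.
have -> : (q - 1) * #|bad_partners Q (A s' e') U|%:R =
    ((#|F| - 1) * #|bad_partners Q (A s' e') U|)%N%:R.
  by rewrite natrM natrB // ltnW // ltnW.
have const (g : {vspace V} -> rat) : (forall U', U' \in A s' e' -> g U' <= K * ((q - 1) / q)) ->
    \sum_(U' in A s' e') g U' <= #|A s' e'|%:R * (K * ((q - 1) / q)).
  by move=> h; rewrite mulr_natl -sumr_const; apply: ler_sum.
have [dE|dE] := eqVneq (e + e')%N d.
  have dUE : (\dim U + e')%N = d by rewrite dimU.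
  apply: (@le_trans _ _ (\sum_(u in U | u != 0%R) num_containing (A s' e') u)%N%:R).
    by rewrite ler_nat; exact: (first_moment_complementary ndV A_dim dUE).
  rewrite (average_containing ndV F3 A_isometry); apply: const => U' AU'.
  by apply: containing_sum_complementary => //; rewrite ?A_nd ?U'_even ?U'0 // (A_dim U').
have {}dE : (e + e' < d)%N by rewrite ltn_neqAle dE.
have := first_moment A_nd U_even e'_even A_dim; rewrite -(ler_nat rat) => /le_trans; apply.
rewrite natrD (average_containing ndV F3 A_isometry) (average_incident ndV F3 A_isometry A_nd ndU).
rewrite -big_split /=; apply: const => U' AU'.
have [d_odd|d_even] := boolP (odd d).
  apply: overlap_sum_odd => //; rewrite ?A_nd ?U'_even ?U'0 //.
  by rewrite dimU (A_dim U').
apply: overlap_sum_even => //; rewrite ?A_nd ?U'_even ?U'0 //.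
by rewrite dimU (A_dim U').
Qed.

(** The second dimension [l], positive and even, supplies the two spare dimensions that
    [exists_typed] asks for. *)
Lemma card_nondeg_subspaces_of_type_gt0 t k l : (0 < k)%N -> (0 < l)%N -> ~~ odd k -> ~~ odd l ->
  (k + l <= d)%N -> (0 < #|A t k|)%N.
Proof.
move=> k0 l0 k_even l_even kl.
have kE : k./2.*2 = k by rewrite -[RHS]odd_double_half (negPf k_even).
have [||U [_ ndU dimU cU]] := exists_typed t (k := k./2) _ ndV.
- by rewrite half_gt0; case: (k) k0 k_even => [|[]].
- by rewrite kE dimV; apply: leq_trans kl; rewrite leq_add2l; case: (l) l0 l_even => [|[]].
by apply/card_gt0P; exists U; apply/mem_typed; rewrite // dimU kE.
Qed.

Lemma orthogonal_case : 1 - K / q <= nondeg_sum_proportion f (A s e) (A s' e').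
Proof.
have q0 : 0 < q by apply: lt_le_trans q3.
apply: nondeg_sum_proportion_ge; first exact: (card_nondeg_subspaces_of_type_gt0 _ _ e'_gt0).
  by apply: (card_nondeg_subspaces_of_type_gt0 _ _ e_gt0); rewrite // addnC.
move=> U AU; set good := [set _ in _ | _].
have : (#|good| + #|bad_partners Q (A s' e') U|)%N%:R = #|A s' e'|%:R :> rat.
  rewrite -(cardsID good (A s' e')); congr (_ + _)%N%:R; apply: eq_card => U'.
    by rewrite !inE; case: (_ && has_type _ _ _).
  by rewrite !inE; case: (_ && has_type _ _ _); rewrite ?andbF ?andbT.
rewrite natrD => /(canRL (addrK _)) ->; rewrite mulrBl mul1r lerD2l lerN2.
have := card_bad_partners_le AU.
(* The factor [q - 1] from rescaling configurations cancels here and leaves the loss [K / q]. *)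
have -> : #|A s' e'|%:R * (K * ((q - 1) / q)) = (q - 1) * (K / q * #|A s' e'|%:R).
  by rewrite mulrC !mulrA [K * (q - 1)]mulrC.
by rewrite ler_pM2l // subr_gt0 (lt_le_trans _ q3).
Qed.

End OrthogonalCase.

Theorem theorem1p1 (q d e e' : nat) (F : finFieldType)
  (q_prime_power : exists p k : nat, [/\ prime p, (0 < k)%N & q = (p ^ k)%N])
  (e_gt0 : (0 < e)%N) (e'_gt0 : (0 < e')%N) (le_d : (e + e' <= d)%N) :
  [/\ (* unitary *)
      forall (theta : {rmorphism F -> F}) (f : {hermitian_sym 'rV[F]_d for theta}),
        #|F| = (q ^ 2)%N -> (2 <= q)%N ->
        (forall x : F, theta x = x ^+ q) -> nondegenerate f ->
        0 < 1 - 1.72%Q / q%:R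
          <= nondeg_sum_proportion f (nondeg_subspaces f e) (nondeg_subspaces f e'),
      (* symplectic *)
      forall f : {skew_symmetric 'rV[F]_d},
        #|F| = q -> (2 <= q)%N ->
        (2 <= e)%N -> (2 <= e')%N -> ~~ odd e -> ~~ odd e' ->
        (forall u, f u u = 0) -> nondegenerate f ->
        0 < 1 - 1.75%Q / q%:R
          <= nondeg_sum_proportion f (nondeg_subspaces f e) (nondeg_subspaces f e'),
      (* orthogonal, q >= 4 *)
      forall (Q : quadraticForm 'rV[F]_d) (s s' : subspace_type),
        #|F| = q -> (4 <= q)%N ->
        (2 <= e)%N -> (2 <= e')%N -> ~~ odd e -> ~~ odd e' ->
        nondegenerate (polar_form Q) ->
        0 < 1 - 3.125%Q / q%:R
          <= nondeg_sum_proportion (polar_form Q)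
               (nondeg_subspaces_of_type Q s e) (nondeg_subspaces_of_type Q s' e')
    & (* orthogonal, q = 3 *)
      forall (Q : quadraticForm 'rV[F]_d) (s s' : subspace_type),
        #|F| = q -> q = 3%N ->
        (2 <= e)%N -> (2 <= e')%N -> ~~ odd e -> ~~ odd e' ->
        nondegenerate (polar_form Q) ->
        0 < 1 - 2.85%Q / q%:R
          <= nondeg_sum_proportion (polar_form Q)
               (nondeg_subspaces_of_type Q s e) (nondeg_subspaces_of_type Q s' e')].
Proof.
(* In each case [k] is the least admissible [q], and the constant lies below it. *)
have pos (c : rat) (k m : nat) : c < k%:R -> (k <= m)%N -> 0 < 1 - c / m%:R.
  move=> ck km; have [m0|m0] := posnP m.
    by rewrite m0 invr0 mulr0 subr0 ltr01.
  by rewrite subr_gt0 ltr_pdivrMr ?ltr0n // mul1r (lt_le_trans ck) // ler_nat.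
have -> : 1.72%Q = 43 / 25 by [].
have -> : 1.75%Q = 7 / 4 by [].
have -> : 3.125%Q = 25 / 8 by [].
have -> : 2.85%Q = 57 / 20 by [].
have lt1 : 43 / 25 < 2%:R :> rat by lra.
have lt2 : 7 / 4 < 2%:R :> rat by lra.
have lt3 : 25 / 8 < 4%:R :> rat by lra.
have lt4 : 57 / 20 < 3%:R :> rat by lra.
split.
- move=> theta f cardF q2 thetaE nd_f; rewrite (pos _ _ _ lt1 q2) /=.
  exact: (unitary_case cardF q2 thetaE nd_f e_gt0 e'_gt0 le_d).
- move=> f <- q2 _ _ e_even e'_even alt nd_f; rewrite (pos _ _ _ lt2 q2) /=.
  exact: (symplectic_case alt nd_f e_gt0 e'_gt0 le_d e_even e'_even).
- move=> Q s s' <- q4 _ _ e_even e'_even nd_f; rewrite (pos _ _ _ lt3 q4) /=.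
  rewrite -ndfE in nd_f; apply: (orthogonal_case s s' nd_f e_gt0 e'_gt0 e_even e'_even le_d).
  by right; split; [rewrite (ler_nat _ 4)|reflexivity].
move=> Q s s' <- q3 _ _ e_even e'_even nd_f.
have le3 : (3 <= #|F|)%N by rewrite q3.
rewrite (pos _ _ _ lt4 le3) /=.
rewrite -ndfE in nd_f; apply: (orthogonal_case s s' nd_f e_gt0 e'_gt0 e_even e'_even le_d).
by left; split; [rewrite q3|reflexivity].
Qed.
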